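(* Let $(E,L)$ be a generalized almost contact structure on an odd-dimensional smooth manifold $M$, and let $\mathrm{pr}_{E^\perp}:\mathbb{T}M\to E^\perp$ denote the orthogonal projection. The following are equivalent: (i) $(E,L)$ is normal; (ii) $(E,L)$ is strongly integrable and there exist an isotropic frame $\mathbf{e}_1,\mathbf{e}_2$ of $E$ and $f\in C^\infty(M)$ such that $d\langle\mathbf{e}_1,\mathbf{e}_2\rangle=0$ and $[\mathbf{e}_1,\mathbf{e}_2]=\mathrm{pr}_{E^\perp}(df)$; (iii) $(E,L)$ is strongly integrable and for each isotropic frame $\mathbf{e}_1,\mathbf{e}_2$ of $E$ such that $d\langle\mathbf{e}_1,\mathbf{e}_2\rangle=0$ there exists $f\in C^\infty(M)$ such that $[\mathbf{e}_1,\mathbf{e}_2]=\mathrm{pr}_{E^\perp}(df)$. (When $\langle\mathbf{e}_1,\mathbf{e}_2\rangle=1/2$, $\mathrm{pr}_{E^\perp}(df)=df-2\langle\mathbf{e}_1,df\rangle\mathbf{e}_2-2\langle\mathbf{e}_2,df\rangle\mathbf{e}_1$.)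
   Context: $\mathbb{T}M=TM\oplus T^*M$ carries the inner product $\langle X+\alpha,Y+\beta\rangle=\frac12(\alpha(Y)+\beta(X))$ and the Dorfman bracket $[X+\alpha,Y+\beta]=[X,Y]+\mathcal{L}_X\beta-i_Yd\alpha$ (both extended complex-linearly to $\mathbb{T}M\otimes\mathbb{C}$); $a:\mathbb{T}M\to TM$ is the projection. A subbundle $V\subset\mathbb{T}M\otimes\mathbb{C}$ is involutive if $[\Gamma(V),\Gamma(V)]\subseteq\Gamma(V)$. A generalized almost contact structure on $M$ is a pair $(E,L)$ where $E\simeq M\times\mathbb{R}^2$ is a trivial subbundle of $\mathbb{T}M$ such that $\langle\ ,\ \rangle|_E$ is nondegenerate of signature $(1,1)$, and $L$ is a maximal isotropic subbundle of $E^\perp\otimes\mathbb{C}$ with $L\cap\overline{L}=0$. Triviality of $E$ is understood as triviality as a bundle with inner product, i.e. $E$ has a global isotropic frame $\mathbf{e}_1,\mathbf{e}_2$ with $\langle\mathbf{e}_1,\mathbf{e}_2\rangle=1/2$. An isotropic frame of $E$ is a global frame of isotropic sections. $(E,L)$ is strongly integrable if $L\oplus(\ell\otimes\mathbb{C})$ is involutive for every maximal isotropic subbundle $\ell$ of $E$. A triple $(\Phi,\mathbf{e}_1,\mathbf{e}_2)$ consists of a base-fixing bundle morphism $\Phi:\mathbb{T}M\to\mathbb{T}M$ and sections $\mathbf{e}_1,\mathbf{e}_2\in\Gamma(\mathbb{T}M)$ with $\langle\mathbf{e}_1,\mathbf{e}_1\rangle=\langle\mathbf{e}_2,\mathbf{e}_2\rangle=0$,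 $\langle\mathbf{e}_1,\mathbf{e}_2\rangle=1/2$, $\Phi^*=-\Phi$, $\Phi(\mathbf{e}_1)=\Phi(\mathbf{e}_2)=0$, $\Phi^2(\mathbf{x})=-\mathbf{x}+2\langle\mathbf{x},\mathbf{e}_1\rangle\mathbf{e}_2+2\langle\mathbf{x},\mathbf{e}_2\rangle\mathbf{e}_1$. It represents $(E,L)$ if $E=\mathrm{span}(\mathbf{e}_1,\mathbf{e}_2)$ and $L$ is the $\sqrt{-1}$-eigenbundle of $\Phi$. Let $\mathcal{E}'(M)=\mathbb{T}M\oplus\mathrm{span}(\partial_t,dt)$ (restriction to $M\times\{1\}$ of the generalized tangent bundle of the cone $M\times(0,\infty)$). For sections $\mathbf{X}_i=\mathbf{x}_i+f_i\partial_t+g_idt$ ($\mathbf{x}_i\in\Gamma(\mathbb{T}M)$, $f_i,g_i\in C^\infty(M)$) put $\langle\mathbf{X}_1,\mathbf{X}_2\rangle=\langle\mathbf{x}_1,\mathbf{x}_2\rangle+\frac12(f_1g_2+f_2g_1)$ and $[\mathbf{X}_1,\mathbf{X}_2]=[\mathbf{x}_1,\mathbf{x}_2]+(a(\mathbf{x}_1)(f_2)-a(\mathbf{x}_2)(f_1))\partial_t+(a(\mathbf{x}_1)(g_2)-a(\mathbf{x}_2)(g_1))dt+g_2df_1+f_2dg_1$. $\mathrm{Sek}_0(M)$ is the set of base-preserving bundle morphisms $J:\mathcal{E}'(M)\to\mathcal{E}'(M)$ with $J^2=-\mathrm{Id}$, $J^*=-J$, $J(\mathrm{span}(\partial_t,dt))\subset\mathbb{T}M$.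 The triple associated to $J\in\mathrm{Sek}_0(M)$ is $\mathbf{e}_1=J(\partial_t)$, $\mathbf{e}_2=J(dt)$, $\Phi(\mathbf{x})$ = the $\mathbb{T}M$-component of $J(\mathbf{x})$; $J$ represents $(E,L)$ if its associated triple does. $J$ is integrable if $[J\mathbf{X},J\mathbf{Y}]-[\mathbf{X},\mathbf{Y}]-J([J\mathbf{X},\mathbf{Y}]+[\mathbf{X},J\mathbf{Y}])=0$ for all sections of $\mathcal{E}'(M)$. $(E,L)$ is normal if it is represented by some integrable $J\in\mathrm{Sek}_0(M)$. *)

(* Defs.v *)
From HB Require Import structures.
From mathcomp Require Import all_boot all_order all_algebra.
From mathcomp Require Import complex.
From mathcomp Require Import all_classical all_reals all_analysis.

Set Implicit Arguments.
Unset Strict Implicit.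
Unset Printing Implicit Defensive.

Import Order.TTheory GRing.Theory Num.Theory numFieldNormedType.Exports.

Local Open Scope classical_set_scope.
Local Open Scope ring_scope.

Section Smooth.
Context {R : realType} {n : nat} {V : normedModType R}.

Definition iter_partial (s : seq 'I_n) (f : 'rV[R]_n -> V) : 'rV[R]_n -> V :=
  foldr (fun i g u => 'D_(delta_mx 0 i) g u) f s.

(* To be used with [A] open: f is C^oo on A, i.e. all its iterated partial
   derivatives exist and are continuous at every point of A. *)
Definition smooth_on (A : set 'rV[R]_n) (f : 'rV[R]_n -> V) : Prop :=
  forall s u, A u ->
    {for u, continuous (iter_partial s f)} /\
    forall i, derivable (iter_partial s f) u (delta_mx 0 i).

End Smooth.

(* A homeomorphism between an open set [chart_dom] of T and the open set
   [chart_map @` chart_dom] of R^n, with inverse [chart_inv]; the values of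
   [chart_map] and [chart_inv] outside these sets are irrelevant. *)
Record chart (R : realType) (n : nat) (T : topologicalType) := Chart {
  chart_dom : set T ;
  chart_map : T -> 'rV[R]_n ;
  chart_inv : 'rV[R]_n -> T ;
  open_chart_dom : open chart_dom ;
  open_chart_img : open (chart_map @` chart_dom) ;
  chart_mapK : forall p, chart_dom p -> chart_inv (chart_map p) = p ;
  continuous_chart_map :
    forall p, chart_dom p -> {for p, continuous chart_map} ;
  continuous_chart_inv :
    forall u, (chart_map @` chart_dom) u -> {for u, continuous chart_inv} }.

Record manifold (R : realType) (n : nat) := Manifold {
  carrier :> topologicalType ;
  manifold_hausdorff : hausdorff_space carrier ;
  manifold_second_countable : @second_countable carrier ;
  atlas : set (chart R n carrier) ;
  chart_at : carrier -> chart R n carrier ;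
  chart_at_atlas : forall p, atlas (chart_at p) ;
  mem_chart_at : forall p, chart_dom (chart_at p) p ;
  atlas_compatible : forall c c', atlas c -> atlas c' ->
    smooth_on (chart_map c @` (chart_dom c `&` chart_dom c'))
      (chart_map c' \o chart_inv c) }.

(* The fibres of TM and T^*M at p are R^n: a tangent vector (resp. a covector)
   at p is given by its components in the frame (resp. coframe) of the
   preferred chart [chart_at p].  Hence a vector field or a 1-form is a map
   M -> 'rV_n, and a section of the generalized tangent bundle
   TM (+) T^*M is a map x : M -> gfiber R n, with vector field part
   [(x p).1] and 1-form part [(x p).2].  Over R[i] the same fibre is that of
   the complexified bundle. *)
Notation gfiber K n := ('rV[K]_n * 'rV[K]_n)%type.

Section Fiber.
Context {K : fieldType} {n : nat}.
Implicit Types (u v : gfiber K n) (U V W : {vspace gfiber K n}).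

Definition pairing (a X : 'rV[K]_n) : K := \sum_j a 0 j * X 0 j.

Definition ip u v : K := 2^-1 * (pairing u.2 v.1 + pairing v.2 u.1).

Definition orthv U : {vspace gfiber K n} :=
  (\bigcap_(e <- vbasis U) lker (linfun (ip e : _ -> K^o)))%VS.

Definition isotropic U : Prop := forall u v, u \in U -> v \in U -> ip u v = 0.

(* Maximality is with respect to inclusion of subspaces of the fibre V. *)
Definition maximal_isotropic V W : Prop :=
  [/\ (W <= V)%VS, isotropic W &
      forall W', (W <= W')%VS -> (W' <= V)%VS -> isotropic W' -> W' = W].

End Fiber.

Section Complexification.
Context {R : realType} {n : nat}.

Definition gcplx (u v : gfiber R n) : gfiber R[i] n :=
  (\row_j (u.1 0 j +i* v.1 0 j)%C, \row_j (u.2 0 j +i* v.2 0 j)%C).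

Definition gRe (u : gfiber R[i] n) : gfiber R n :=
  (map_mx (@complex.Re R) u.1, map_mx (@complex.Re R) u.2).

Definition gIm (u : gfiber R[i] n) : gfiber R n :=
  (map_mx (@complex.Im R) u.1, map_mx (@complex.Im R) u.2).

Definition gconj (u : gfiber R[i] n) : gfiber R[i] n :=
  gcplx (gRe u) (- gIm u).

Definition cplxv (U : {vspace gfiber R n}) : {vspace gfiber R[i] n} :=
  <<[seq gcplx u 0%R | u <- vbasis U]>>%VS.

Definition conjv (U : {vspace gfiber R[i] n}) : {vspace gfiber R[i] n} :=
  <<[seq gconj u | u <- vbasis U]>>%VS.

End Complexification.

Section Calculus.
Context {R : realType} {n : nat} {M : manifold R n}.
Implicit Types (p q : M) (U : set M) (X Y Z : M -> 'rV[R]_n)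
  (a b : M -> 'rV[R]_n) (f : M -> R) (x y : M -> gfiber R n).

Definition smooth_fun U f : Prop :=
  forall c, atlas c ->
    smooth_on (chart_map c @` (chart_dom c `&` U))
      (f \o chart_inv c : _ -> R^o).

(* X(F), for F with values in any normed space. *)
Definition lie_act {V : normedModType R} X (F : M -> V) : M -> V :=
  fun p => 'D_(X p) (F \o chart_inv (chart_at p)) (chart_map (chart_at p) p).

(* The coordinate vector field d/dx^j of the chart c, meaningful on
   [chart_dom c]. *)
Definition coord_field (c : chart R n M) (j : 'I_n) : M -> 'rV[R]_n :=
  fun q => 'D_(delta_mx 0 j) (chart_map (chart_at q) \o chart_inv c)
             (chart_map c q).

Definition d_fun f : M -> 'rV[R]_n := fun p =>
  \row_j lie_act (coord_field (chart_at p) j) (f : M -> R^o) p.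

Definition gdiff f : M -> gfiber R n := fun p => (0, d_fun f p).

(* [X, Y] has components X(Y(x^i)) - Y(X(x^i)) in the coordinates x^i. *)
Definition lie_bracket X Y : M -> 'rV[R]_n := fun p =>
  let c := chart_at p in
  lie_act X (lie_act Y (chart_map c)) p - lie_act Y (lie_act X (chart_map c)) p.

Definition pair_fun a X : M -> R^o := fun p => pairing (a p) (X p).

Definition d_form a X Y : M -> R := fun p =>
  lie_act X (pair_fun a Y) p - lie_act Y (pair_fun a X) p
  - pairing (a p) (lie_bracket X Y p).

Definition contract_d X a : M -> 'rV[R]_n := fun p =>
  \row_j d_form a X (coord_field (chart_at p) j) p.

Definition lie_deriv X a : M -> 'rV[R]_n := fun p =>
  \row_j (let Z := coord_field (chart_at p) j in
          lie_act X (pair_fun a Z) p - pairing (a p) (lie_bracket X Z p)).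

Definition vecpart x : M -> 'rV[R]_n := fun p => (x p).1.
Definition formpart x : M -> 'rV[R]_n := fun p => (x p).2.

(* The components of the section x in the chart c, meaningful on [chart_dom c].
   For c = chart_at q they are those of x q itself. *)
Definition gcomponents (c : chart R n M) x : M -> gfiber R n := fun q =>
  (lie_act (vecpart x) (chart_map c) q,
   \row_j pairing (x q).2 (coord_field c j q)).

Definition smooth_section U x : Prop :=
  forall c, atlas c ->
    smooth_on (chart_map c @` (chart_dom c `&` U))
      (gcomponents c x \o chart_inv c).

Definition dorfman x y : M -> gfiber R n := fun p =>
  (lie_bracket (vecpart x) (vecpart y) p,
   lie_deriv (vecpart x) (formpart y) p
     - contract_d (vecpart y) (formpart x) p).

Definition csmooth_section U (x : M -> gfiber R[i] n) : Prop :=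
  smooth_section U (gRe \o x) /\ smooth_section U (gIm \o x).

Definition cdorfman (x y : M -> gfiber R[i] n) : M -> gfiber R[i] n := fun p =>
  gcplx (dorfman (gRe \o x) (gRe \o y) p - dorfman (gIm \o x) (gIm \o y) p)
        (dorfman (gRe \o x) (gIm \o y) p + dorfman (gIm \o x) (gRe \o y) p).

Definition has_local_frames (K : fieldType)
    (smooth : set M -> (M -> gfiber K n) -> Prop)
    (V : M -> {vspace gfiber K n}) : Prop :=
  forall p, exists U r (s : 'I_r -> M -> gfiber K n),
    [/\ open_nbhs p U, forall i, smooth U (s i) &
        forall q, U q -> basis_of (V q) [tuple s i q | i < r]].

Definition subbundle : (M -> {vspace gfiber R n}) -> Prop :=
  has_local_frames smooth_section.

Definition csubbundle : (M -> {vspace gfiber R[i] n}) -> Prop :=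
  has_local_frames csmooth_section.

Definition csections (V : M -> {vspace gfiber R[i] n})
    (x : M -> gfiber R[i] n) : Prop :=
  csmooth_section setT x /\ forall p, x p \in V p.

Definition involutive (V : M -> {vspace gfiber R[i] n}) : Prop :=
  forall x y : M -> gfiber R[i] n,
    csections V x -> csections V y -> csections V (cdorfman x y).

Definition isotropic_frame (E : M -> {vspace gfiber R n})
    (e1 e2 : M -> gfiber R n) : Prop :=
  [/\ smooth_section setT e1, smooth_section setT e2,
      forall p, basis_of (E p) [:: e1 p; e2 p],
      forall p, ip (e1 p) (e1 p) = 0 &
      forall p, ip (e2 p) (e2 p) = 0].

(* The frame in [gac_trivial] makes E a trivial smooth subbundle on which the
   inner product is nondegenerate of signature (1, 1). *)
Record gen_almost_contact (E : M -> {vspace gfiber R n})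
    (L : M -> {vspace gfiber R[i] n}) : Prop := {
  gac_trivial : exists e1 e2, isotropic_frame E e1 e2 /\
    forall p, ip (e1 p) (e2 p) = 2^-1 ;
  gac_subbundle : csubbundle L ;
  gac_maximal : forall p, maximal_isotropic (cplxv (orthv (E p))) (L p) ;
  gac_conj : forall p, (L p :&: conjv (L p) = 0)%VS }.

Definition strongly_integrable (E : M -> {vspace gfiber R n})
    (L : M -> {vspace gfiber R[i] n}) : Prop :=
  forall l, subbundle l -> (forall p, maximal_isotropic (E p) (l p)) ->
    involutive (fun p => L p + cplxv (l p))%VS.

Definition pr_perp (E : M -> {vspace gfiber R n}) p (u : gfiber R n) :=
  daddv_pi (orthv (E p)) (E p) u.

(* A base-fixing bundle morphism is a family of linear maps of the fibres which
   sends smooth sections over open sets to smooth sections; likewise for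
   [sek_smooth] below. *)
Definition smooth_endo (Phi : M -> 'End(gfiber R n)) : Prop :=
  forall U x, open U -> smooth_section U x ->
    smooth_section U (fun p => Phi p (x p)).

Record contact_triple (Phi : M -> 'End(gfiber R n))
    (e1 e2 : M -> gfiber R n) : Prop := {
  ct_smooth : smooth_endo Phi ;
  ct_smooth1 : smooth_section setT e1 ;
  ct_smooth2 : smooth_section setT e2 ;
  ct_ip11 : forall p, ip (e1 p) (e1 p) = 0 ;
  ct_ip22 : forall p, ip (e2 p) (e2 p) = 0 ;
  ct_ip12 : forall p, ip (e1 p) (e2 p) = 2^-1 ;
  ct_skew : forall p u v, ip (Phi p u) v = - ip u (Phi p v) ;
  ct_ker1 : forall p, Phi p (e1 p) = 0 ;
  ct_ker2 : forall p, Phi p (e2 p) = 0 ;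
  ct_square : forall p u, Phi p (Phi p u) =
    - u + (2 * ip u (e1 p)) *: e2 p + (2 * ip u (e2 p)) *: e1 p }.

Definition cextend (h : 'End(gfiber R n)) (u : gfiber R[i] n) :
    gfiber R[i] n :=
  gcplx (h (gRe u)) (h (gIm u)).

Definition triple_represents (Phi : M -> 'End(gfiber R n))
    (e1 e2 : M -> gfiber R n) (E : M -> {vspace gfiber R n})
    (L : M -> {vspace gfiber R[i] n}) : Prop :=
  [/\ contact_triple Phi e1 e2,
      forall p, E p = <<[:: e1 p; e2 p]>>%VS &
      forall p u, u \in L p <-> cextend (Phi p) u = 'i%C *: u].

End Calculus.

(* The fibre of TM (+) T^*M (+) span(d/dt, dt): ((X, a), (f, g)) stands for
   X + a + f d/dt + g dt. *)
Notation efiber R n := (gfiber R n * (R^o * R^o))%type.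

Section Cone.
Context {R : realType} {n : nat} {M : manifold R n}.
Implicit Types (p : M) (U : set M) (X Y : M -> efiber R n)
  (J : M -> 'End(efiber R n)).

Definition eip (u v : efiber R n) : R :=
  ip u.1 v.1 + 2^-1 * (u.2.1 * v.2.2 + v.2.1 * u.2.2).

Definition gpart X : M -> gfiber R n := fun p => (X p).1.
Definition dt_vec X : M -> R^o := fun p => (X p).2.1.
Definition dt_form X : M -> R^o := fun p => (X p).2.2.

Definition smooth_esection U X : Prop :=
  [/\ smooth_section U (gpart X), smooth_fun U (dt_vec X) &
      smooth_fun U (dt_form X)].

Definition ebracket X Y : M -> efiber R n := fun p =>
  (dorfman (gpart X) (gpart Y) p
     + (0, dt_form Y p *: d_fun (dt_vec X) p
           + dt_vec Y p *: d_fun (dt_form X) p),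
   (lie_act (vecpart (gpart X)) (dt_vec Y) p
      - lie_act (vecpart (gpart Y)) (dt_vec X) p,
    lie_act (vecpart (gpart X)) (dt_form Y) p
      - lie_act (vecpart (gpart Y)) (dt_form X) p)).

Definition eapp J X : M -> efiber R n := fun p => J p (X p).

Record Sek0 J : Prop := {
  sek_smooth : forall U X, open U -> smooth_esection U X ->
    smooth_esection U (eapp J X) ;
  sek_square : forall p u, J p (J p u) = - u ;
  sek_skew : forall p u v, eip (J p u) v = - eip u (J p v) ;
  sek_span : forall p (r : R^o * R^o), (J p (0, r)).2 = 0 }.

Definition e1_of J : M -> gfiber R n := fun p => (J p (0, (1, 0))).1.
Definition e2_of J : M -> gfiber R n := fun p => (J p (0, (0, 1))).1.
Definition Phi_of J : M -> 'End(gfiber R n) :=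
  fun p => linfun (fun u : gfiber R n => (J p (u, 0)).1).

Definition integrable_Sek0 J : Prop :=
  forall X Y, smooth_esection setT X -> smooth_esection setT Y -> forall p,
    ebracket (eapp J X) (eapp J Y) p - ebracket X Y p
    - J p (ebracket (eapp J X) Y p + ebracket X (eapp J Y) p) = 0.

Definition is_normal (E : M -> {vspace gfiber R n})
    (L : M -> {vspace gfiber R[i] n}) : Prop :=
  exists J, [/\ Sek0 J, integrable_Sek0 J &
    triple_represents (Phi_of J) (e1_of J) (e2_of J) E L].

End Cone.

(* Main.v *)
From HB Require Import structures.
Require Import Defs.
From mathcomp Require Import all_boot all_order all_algebra.
From mathcomp Require Import complex zify ring lra.
From mathcomp Require Import all_classical all_reals all_analysis.

Set Implicit Arguments.
Unset Strict Implicit.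
Unset Printing Implicit Defensive.

Import Order.TTheory GRing.Theory Num.Theory numFieldNormedType.Exports.

Local Open Scope classical_set_scope.
Local Open Scope ring_scope.

(** Normality amounts to a list of identities between Dorfman
    brackets on M, and strong integrability can be recognised in this list.

    Cone side.  The bracket of E'(M) is the Dorfman bracket of the cone
    restricted to M, so it satisfies the Leibniz rules, is skew up to the
    differential of the inner product, and leaves the inner product invariant
    ([ebrZr], [ebrZl], [ebr_sym], [ebr_inv]).  Together with J^2 = -1 and
    J^* = -J this makes the Nijenhuis expression of J tensorial and
    compatible with J ([nijDl], [nijZl], [nijJl]), so it vanishes as soon as it
    vanishes on sections x of the orthogonal of E and on e1 = J(d/dt) and
    e2 = J(dt).  There it
    says: [e1, e2] = 0, Phi [x, ei] = [Phi x, ei], and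
    [x, y] - [Phi x, Phi y] and [x, Phi y] + [Phi x, y] are exchanged by Phi
    up to sign.  These are the identities of [integrable_triple]; J is
    integrable if and only if they hold ([integrable_triple_of_J],
    [integrable_cone]).

    Strong integrability.  A maximal isotropic line subbundle l of E
    coincides, near each point, with the span of e1 or of e2
    ([maximal_isotropic_line]), and the complex sections x - i Phi x, for x
    orthogonal to E, are the sections of L.  Expanding brackets of sections of
    L + l with the Leibniz rules, the identities of [integrable_triple] give
    involutivity ([integrable_triple_strong]).  Conversely, taking for l the
    spans of e1 and of e2, and using that L is the intersection of L + <e1> and
    L + <e2>, strong integrability together with [e1, e2] = 0 gives all the
    identities back ([strong_integrable_triple]).  Hence (E, L) is normal if
    and only if it is strongly integrable and E has an isotropic frame with
    <e1, e2> = 1/2 and [e1, e2] = 0, once Phi is known to be a smooth bundle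
    morphism determined by L and the frame ([contact_endo_represents]).

    Change of frame.  If h k is constant and <e1, e2> = 1/2, then
    [h e1, k e2] = h k [e1, e2] + k pr(dh) ([rescale]).  A frame with
    <e1, e2> = c/2, c locally constant, and [e1, e2] = pr(df) becomes one with
    vanishing bracket for h = exp(-f/c), k = exp(f/c)/c ([normalize_frame]).
    Conversely an arbitrary isotropic frame with locally constant inner product
    is near each point a rescaling of a given one, possibly with its two members
    exchanged, and f is the locally constant factor times the logarithm of the
    scaling function ([normal_bracket_exact]).

    The analytic input is the symmetry of second derivatives
    ([derive_comm]), which makes the Dorfman bracket, computed at each point in
    the preferred chart of this point, independent of the chart
    ([flat_trans]); smoothness of brackets follows. *)

(** * Mean value theorem and symmetry of second derivatives *)

Section LineDerivative.
Context {R : realType} {V W : normedModType R}.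

(** A directional derivative is an ordinary derivative along a line: this gives
    access to the one-variable mean value theorem. *)
Lemma is_derive_line (f : V -> W) (w v : V) (t : R) :
  derivable f (w + t *: v) v ->
  is_derive t (1 : R) (fun s : R => f (w + s *: v)) ('D_v f (w + t *: v)).
Proof.
move=> df.
have E : (fun h : R => h^-1 *: (((fun s : R => f (w + s *: v)) \o shift t) (h *: 1)
             - f (w + t *: v))) =
         (fun h : R => h^-1 *: ((f \o shift (w + t *: v)) (h *: v) - f (w + t *: v))).
  apply/funext => h /=; congr (_ *: (f _ - _)).
  by rewrite scalerDl addrCA [_ *: 1]mulr1.
by split; rewrite /derivable /derive E.
Qed.

End LineDerivative.

Section MeanValue.
Context {R : realType} {V : normedModType R}.

Lemma mvt_line (f : V -> R^o) (w v : V) (a : R) :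
  (forall t, `|t| <= `|a| -> derivable f (w + t *: v) v) ->
  exists2 x : R, `|x| <= `|a| & f (w + a *: v) - f w = a * 'D_v f (w + x *: v).
Proof.
move=> df; pose g := fun s : R => f (w + s *: v) : R.
pose dg := fun s : R => 'D_v f (w + s *: v) : R.
have dgP t : `|t| <= `|a| -> is_derive t (1 : R) g (dg t).
  by move=> ta; apply: is_derive_line; exact: df.
have cg (b c : R) : (forall t, t \in `[b, c] -> `|t| <= `|a|) ->
    {within `[b, c], continuous g}.
  move=> bca; apply: derivable_within_continuous => t /bca /dgP [].
  by [].
have [a0|a0] := lerP 0 a.
- have B t : t \in `[0, a] -> `|t| <= `|a|.
    by rewrite in_itv /= => /andP[t0 ta]; rewrite !ger0_norm.
  have [|x xI E] := @MVT_segment R g dg 0 a a0 _ (cg _ _ B).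
    by move=> x xI; apply/dgP/B; apply: subset_itv_oo_cc xI.
  exists x; first exact: B.
  by move: E; rewrite /g scale0r addr0 subr0 mulrC.
- have B t : t \in `[a, 0] -> `|t| <= `|a|.
    by rewrite in_itv /= => /andP[t0 ta]; rewrite !ler0_norm ?lerN2 // ltW.
  have [|x xI E] := @MVT_segment R g dg a 0 (ltW a0) _ (cg _ _ B).
    by move=> x xI; apply/dgP/B; apply: subset_itv_oo_cc xI.
  exists x; first exact: B.
  rewrite -opprB; move: E; rewrite /g scale0r addr0 sub0r => ->.
  by rewrite mulrN opprK mulrC.
Qed.

(** Clairaut's theorem.  The second difference of f along the parallelogram of
    sides a v, a w equals, by two applications of the mean value theorem in each
    order, a^2 times either mixed derivative at some point of the
    parallelogram; continuity lets the parallelogram shrink. *)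
Lemma derive_comm (f : V -> R^o) (u v w : V) :
  (\forall z \near u, derivable f z v) -> (\forall z \near u, derivable f z w) ->
  (\forall z \near u, derivable ('D_v f : V -> R^o) z w) ->
  (\forall z \near u, derivable ('D_w f : V -> R^o) z v) ->
  {for u, continuous ('D_w ('D_v f : V -> R^o) : V -> R^o)} ->
  {for u, continuous ('D_v ('D_w f : V -> R^o) : V -> R^o)} ->
  'D_w ('D_v f : V -> R^o) u = 'D_v ('D_w f : V -> R^o) u.
Proof.
move=> dv dw dvw dwv cvw cwv.
apply/eqP; rewrite -subr_eq0 -normr_le0; apply/ler_addgt0Pr => e e0.
rewrite add0r.
have e20 : 0 < e / 2 by rewrite divr_gt0.
have /nbhs_ballP[r /= r0 Hr] : \forall z \near u, [/\ derivable f z v, derivable f z w,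
    derivable ('D_v f : V -> R^o) z w & derivable ('D_w f : V -> R^o) z v] /\
    (`|'D_w ('D_v f : V -> R^o) u - 'D_w ('D_v f : V -> R^o) z| <= e / 2 /\
     `|'D_v ('D_w f : V -> R^o) u - 'D_v ('D_w f : V -> R^o) z| <= e / 2).
  have cvw' : \forall z \near u,
      `|'D_w ('D_v f : V -> R^o) u - 'D_w ('D_v f : V -> R^o) z| <= e / 2.
    exact: ((cvgrPdist_le _ _).1 cvw).
  have cwv' : \forall z \near u,
      `|'D_v ('D_w f : V -> R^o) u - 'D_v ('D_w f : V -> R^o) z| <= e / 2.
    exact: ((cvgrPdist_le _ _).1 cwv).
  have H1 := @filterI _ _ (nbhs_filter u) _ _
    (@filterI _ _ (nbhs_filter u) _ _ dv dw)
    (@filterI _ _ (nbhs_filter u) _ _ dvw dwv).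
  apply: filterS (@filterI _ _ (nbhs_filter u) _ _ H1
    (@filterI _ _ (nbhs_filter u) _ _ cvw' cwv')) => z [[[? ?] [? ?]] [? ?]].
  by split; split.
(* small enough for the parallelogram of sides a v, a w to stay in the ball *)
pose a := r / 2 / (1 + `|v| + `|w|).
have den0 : 0 < 1 + `|v| + `|w| by rewrite -addrA ltr_pwDl // addr_ge0.
have a0 : 0 < a by rewrite divr_gt0 // divr_gt0.
have inball (s t : R) : `|s| <= `|a| -> `|t| <= `|a| -> ball u r (u + s *: v + t *: w).
  move=> sa ta; rewrite -ball_normE /= -addrA opprD addNKr normrN.
  apply: (@le_lt_trans _ _ (a * (1 + `|v| + `|w|))); last first.
    by rewrite /a divfK ?gt_eqF // ltr_pdivrMr // ltr_pMr // ltr1n.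
  move: sa ta; rewrite (gtr0_norm a0) => sa ta.
  rewrite (le_trans (ler_normD _ _)) // !normrZ -addrA mulrDr mulr1.
  rewrite ler_wpDl ?(ltW a0) // mulrDr lerD //; exact: ler_wpM2r.
have in0 : `|0 : R| <= `|a| by rewrite normr0.
have Dv z : ball u r z -> derivable f z v by case/Hr => -[].
have Dw z : ball u r z -> derivable f z w by case/Hr => -[].
have Dvw z : ball u r z -> derivable ('D_v f : V -> R^o) z w by case/Hr => -[].
have Dwv z : ball u r z -> derivable ('D_w f : V -> R^o) z v by case/Hr => -[].
pose F z : R^o := f (z + a *: w) - f z.
pose G z : R^o := f (z + a *: v) - f z.
have shiftD (g : V -> R^o) z d b : derivable g (z + b) d ->
    is_derive z d (fun y => g (y + b) : R^o) ('D_d g (z + b)).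
  move=> dg.
  have E : (fun h : R => h^-1 *: (((fun y => g (y + b) : R^o) \o shift z) (h *: d)
             - g (z + b))) =
         (fun h : R => h^-1 *: ((g \o shift (z + b)) (h *: d) - g (z + b))).
    by apply/funext => h /=; rewrite addrA.
  by split; rewrite /derivable /derive E.
have aa : `|a| <= `|a| by [].
have F1 (t : R) : `|t| <= `|a| -> is_derive (u + t *: v) v F
     ('D_v f (u + t *: v + a *: w) - 'D_v f (u + t *: v)).
  move=> ta; apply: is_deriveB.
    exact/shiftD/Dv/inball.
  have := inball t 0 ta in0; rewrite scale0r addr0 => /Dv; exact: derivableP.
have G1 (t : R) : `|t| <= `|a| -> is_derive (u + t *: w) w G
     ('D_w f (u + t *: w + a *: v) - 'D_w f (u + t *: w)).
  move=> ta; apply: is_deriveB.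
    apply: shiftD; rewrite addrAC; exact/Dw/inball.
  have := inball 0 t in0 ta; rewrite scale0r addr0 => /Dw; exact: derivableP.
have [s sa Es] := @mvt_line F u v a (fun t ta => @ex_derive _ _ _ _ _ _ _ (F1 t ta)).
have [t ta Et] := @mvt_line G u w a (fun t ta => @ex_derive _ _ _ _ _ _ _ (G1 t ta)).
rewrite (@derive_val _ _ _ _ _ _ _ (F1 s sa)) in Es.
rewrite (@derive_val _ _ _ _ _ _ _ (G1 t ta)) in Et.
have [|s' sa' Es'] := @mvt_line ('D_v f) (u + s *: v) w a.
  by move=> z za; exact/Dvw/inball.
have [|t' ta' Et'] := @mvt_line ('D_w f) (u + t *: w) v a.
  by move=> z za; rewrite addrAC; exact/Dwv/inball.
rewrite Es' in Es; rewrite Et' in Et.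
have EFG : F (u + a *: v) - F u = G (u + a *: w) - G u.
  by rewrite /F /G (addrAC u); ring.
move: EFG; rewrite Es Et => /(mulfI (lt0r_neq0 a0)) /(mulfI (lt0r_neq0 a0)) E.
have [_ [H1 _]] := Hr _ (inball _ _ sa sa').
have [_ [_ H2]] := Hr _ (inball _ _ ta' ta).
rewrite -[X in `|X|](subrKA ('D_w ('D_v f : V -> R^o) (u + s *: v + s' *: w))).
rewrite (splitr e); apply: le_trans (ler_normD _ _) _; apply: lerD.
  exact: H1.
by rewrite E (addrAC u) distrC; exact: H2.
Qed.

End MeanValue.

(** * Continuous partial derivatives imply differentiability *)

(** Fréchet differentiability from an epsilon estimate, bypassing the little-o
    notation. *)
Lemma differentiable_bound (R : realType) (V W : normedModType R) (f : V -> W)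
    (df : {linear V -> W}) (x : V) : continuous df ->
  (forall e, 0 < e ->
     \forall h \near 0, `|f (h + x) - f x - df h| <= e * `|h|) ->
  differentiable f x.
Proof.
move=> cdf H.
have E : f \o shift x = cst (f x) + df +o_ 0 id.
  apply/eqaddoP => e e0; apply: filterS (H e e0) => h.
  by rewrite !fctE /= opprD addrA.
have /= dfE := diff_unique cdf E.
by apply/diff_locallyP; rewrite dfE.
Qed.

Section ContinuousPartials.
Context {R : realType} {n : nat}.
Implicit Types (f : 'rV[R]_n -> R^o) (u h : 'rV[R]_n).

(** The linear form of gradient a, the candidate for the differential. *)
Definition lform (a h : 'rV[R]_n) : R^o := pairing a h.

Lemma lform_is_linear a : linear (lform a).
Proof.
move=> k x y; rewrite /lform /pairing scaler_sumr -big_split /=.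
by apply: eq_bigr => j _; rewrite !mxE mulrDr mulrCA.
Qed.
HB.instance Definition _ a :=
  GRing.isLinear.Build R 'rV[R]_n R^o *:%R (lform a) (lform_is_linear a).

Lemma lform_continuous a : continuous (lform a).
Proof.
move=> x; rewrite /lform /pairing.
have -> : (fun h : 'rV[R]_n => \sum_j a 0 j * h 0 j) =
   \sum_j (fun h : 'rV[R]_n => a 0 j * h 0 j).
  by apply/funext => h; rewrite fct_sumE.
apply: (big_ind (fun g : 'rV[R]_n -> R => {for x, continuous g})).
- exact: cst_continuous.
- by move=> g g' cg cg'; apply: continuousD.
- move=> j _; apply: continuousM; first exact: cst_continuous.
  exact: coord_continuous.
Qed.

Lemma mx_norm_le h h' : (forall j, `|h 0 j| <= `|h' 0 j|) -> `|h| <= `|h'|.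
Proof.
move=> hh'; rewrite [leLHS]/Num.Def.normr /= mx_normrE.
apply: bigmax_le => // -[i j] _ /=; rewrite (ord1 i).
apply: le_trans (hh' j) _; rewrite /Num.Def.normr /= mx_normrE.
by apply: (@le_bigmax _ _ _ _ (fun ij : 'I_1 * 'I_n => `|h' ij.1 ij.2|) (0, j)).
Qed.

Lemma mx_norm_coord h j : `|h 0 j| <= `|h|.
Proof.
rewrite [leRHS]/Num.Def.normr /= mx_normrE.
by apply: (@le_bigmax _ _ _ _ (fun ij : 'I_1 * 'I_n => `|h ij.1 ij.2|) (0, j)).
Qed.

Let e (i : 'I_n) : 'rV[R]_n := delta_mx 0 i.

(** Move from u to u + h one coordinate at a time: each step changes f by a
    partial derivative at an intermediate point, close to the one at u. *)
Lemma differentiable_partials f u :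
  (\forall z \near u, forall i, derivable f z (e i)) ->
  (forall i, {for u, continuous ('D_(e i) f : _ -> R^o)}) ->
  differentiable f u.
Proof.
move=> df cdf.
pose a := \row_j 'D_(e j) f u : 'rV[R]_n.
apply: (@differentiable_bound _ _ _ f (lform a) u (@lform_continuous a)).
move=> _/posnumP[eps].
pose ep := eps%:num / n.+1%:R.
have ep0 : 0 < ep by rewrite divr_gt0.
have /nbhs_ballP[r /= r0 Hr] : \forall z \near u,
   (forall i, derivable f z (e i)) /\
   (forall i, `|'D_(e i) f u - 'D_(e i) f z| <= ep).
  near=> z; split; first by near: z; exact: df.
  near: z; apply: filter_forall => i.
  exact: ((cvgrPdist_le _ _).1 (cdf i) _ ep0).
apply/nbhs_ballP; exists r => //= h; rewrite -ball_normE /= sub0r normrN => hr.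
(* the point reached after the first k coordinates of h *)
pose hk k : 'rV[R]_n := \row_j (if (j < k)%N then h 0 j else 0).
have hkS (k : 'I_n) : hk k.+1 = hk k + h 0 k *: e k.
  apply/rowP => j; rewrite !mxE eqxx /= eq_sym ltnS leq_eqVlt.
  rewrite -val_eqE eq_sym; case: eqP => [jk|_] /=; last by rewrite mulr0 addr0.
  by rewrite -(val_inj jk) ltnn add0r mulr1.
have hkball (k : 'I_n) t : `|t| <= `|h 0 k| -> ball u r (u + hk k + t *: e k).
  move=> th; rewrite -ball_normE /= -addrA opprD addNKr normrN.
  apply: le_lt_trans hr; apply: mx_norm_le => j; rewrite !mxE eqxx /= eq_sym.
  case: eqVneq => [<-|_]; first by rewrite ltnn add0r mulr1.
  by rewrite mulr0 addr0; case: ifP => // _; rewrite normr0.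
have main k : (k <= n)%N -> `|f (u + hk k) - f u - lform a (hk k)|
    <= k%:R * (ep * `|h|).
  elim: k => [_|k IH kn].
    have -> : hk 0%N = 0 by apply/rowP => j; rewrite !mxE.
    by rewrite addr0 linear0 subrr subr0 normr0 mul0r.
  have := hkS (Ordinal kn); rewrite /= => ->.
  have [t tk] := @mvt_line _ _ f (u + hk k) (e (Ordinal kn)) (h 0 (Ordinal kn))
    (fun t th => (Hr _ (@hkball (Ordinal kn) t th)).1 _).
  rewrite -addrA => E; rewrite addrA in E.
  have {}IH := IH (ltnW kn).
  rewrite linearD linearZ /=.
  have -> : lform a (e (Ordinal kn)) = 'D_(e (Ordinal kn)) f u.
    rewrite /lform /pairing (bigD1 (Ordinal kn)) //= big1 => [|j jk].
      by rewrite !mxE !eqxx mulr1 addr0.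
    by rewrite !mxE eqxx (negbTE jk) mulr0.
  set B := 'D_ _ _ u; rewrite addrA in E *.
  have -> : f (u + hk k + h 0 (Ordinal kn) *: e (Ordinal kn)) - f u -
     (lform a (hk k) + h 0 (Ordinal kn) *: B) =
     (f (u + hk k) - f u - lform a (hk k)) +
     h 0 (Ordinal kn) * ('D_(e (Ordinal kn)) f
        (u + hk k + t *: e (Ordinal kn)) - B).
    rewrite mulrBr -E; change (h 0 (Ordinal kn) *: B) with (h 0 (Ordinal kn) * B).
    ring.
  rewrite (le_trans (ler_normD _ _)) // -natr1 mulrDl mul1r lerD //.
  rewrite normrM mulrC distrC ler_pM // ?mx_norm_coord //.
  by have [_] := Hr _ (@hkball (Ordinal kn) t tk); apply.
have := main n (leqnn n).
have -> : hk n = h by apply/rowP => j; rewrite !mxE ltn_ord.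
rewrite (addrC h u) => /le_trans; apply.
rewrite mulrA ler_wpM2r // /ep mulrCA ger_pMr //.
by rewrite ler_pdivrMr ?ltr0Sn // mul1r ler_nat.
Unshelve. all: by end_near. Qed.

End ContinuousPartials.

(** * Functions of class C^k *)

Section LineChain.
Context {R : realType} {V W : normedModType R}.

(** Chain rules are proved along lines, where only a function of one variable has
    to be composed. *)
Lemma is_derive_lineP (f : V -> W) (u v : V) (d : W) :
  is_derive u v f d <-> is_derive (0 : R) (1 : R) (fun s : R => f (u + s *: v)) d.
Proof.
have E : (fun h : R => h^-1 *: (((fun s : R => f (u + s *: v)) \o shift 0) (h *: 1)
             - f (u + 0 *: v))) =
         (fun h : R => h^-1 *: ((f \o shift u) (h *: v) - f u)).
  by apply/funext => h /=; rewrite scale0r !addr0 [_ *: 1]mulr1 (addrC u).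
by split=> -[]; rewrite /derivable /derive => d1 d2; split;
  rewrite /derivable /derive; rewrite ?E // -E.
Qed.

Lemma is_derive_linear (g : {linear V -> W}) (U : normedModType R)
    (f : U -> V) (u v : U) (d : V) : continuous g ->
  is_derive u v f d -> is_derive u v (g \o f) (g d).
Proof.
move=> cg [fuv <-].
have C : (fun h : R => h^-1 *: (((g \o f) \o shift u) (h *: v) - (g \o f) u)) @ 0^'
     --> g ('D_v f u).
  have -> : (fun h : R => h^-1 *: (((g \o f) \o shift u) (h *: v) - (g \o f) u)) =
     g \o (fun h : R => h^-1 *: ((f \o shift u) (h *: v) - f u)).
    by apply/funext => h /=; rewrite -linearB -linearZ.
  have {}fuv : (fun h : R => h^-1 *: ((f \o shift u) (h *: v) - f u)) @ 0^'
     --> 'D_v f u by exact: fuv.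
  by apply: continuous_cvg; [exact: cg|exact: fuv].
split; first by apply/cvg_ex; exists (g ('D_v f u)).
by apply/cvg_lim.
Qed.
End LineChain.

Section RealChain.
Context {R : realType} {V : normedModType R}.

Lemma is_derive_comp1 (g : R -> R) (f : V -> R^o) (u v : V) (a b : R) :
  is_derive u v f b -> is_derive (f u : R) (1 : R) g a ->
  is_derive u v (g \o f : V -> R^o) (a * b).
Proof.
move=> /is_derive_lineP fb ga; apply/is_derive_lineP.
apply: (@is_derive1_comp R g (fun s : R => f (u + s *: v))) => //.
by rewrite scale0r addr0.
Qed.
End RealChain.

Section Smoothness.
Context {R : realType} {n : nat}.
Let e (i : 'I_n) : 'rV[R]_n := delta_mx 0 i.

Section Ck.
Context {V : normedModType R}.
(** Smoothness is defined through all iterated partial derivatives; the class C^k,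
    a recursion on k, is what closure properties can be proved for by induction. *)
Fixpoint Ck (k : nat) (A : set 'rV[R]_n) (f : 'rV[R]_n -> V) : Prop :=
  (forall u, A u -> {for u, continuous f} /\ forall i, derivable f u (e i)) /\
  (if k is k'.+1 then forall i, Ck k' A (fun u => 'D_(e i) f u) else True).

Lemma smooth_onE (A : set 'rV[R]_n) (f : 'rV[R]_n -> V) :
  smooth_on A f <-> forall k, Ck k A f.
Proof.
split=> [+ k|].
  elim: k f => [f sf|k IH f sf]; first by split=> // u Au; exact: (sf [::] u Au).
  split=> [u Au|i]; first exact: (sf [::] u Au).
  apply: IH => s u Au; have := sf (rcons s i) u Au.
  by rewrite /iter_partial foldr_rcons.
move=> Cf s; elim/last_ind: s f Cf => [f Cf u Au|s i IH f Cf u Au].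
  by have [/(_ u Au)] := Cf 0%N.
rewrite /iter_partial foldr_rcons; apply: IH => // k.
by have [_] := Cf k.+1; apply.
Qed.

Lemma Ck_mono k A f : Ck k.+1 A f -> Ck k A f.
Proof.
elim: k f => [f [H _]|k IH f [H Hk]]; first by split.
by split=> // i; apply/IH/Hk.
Qed.

Lemma Ck_0 k A f : Ck k A f -> Ck 0 A f.
Proof. by case: k => [|k] [H _]; split. Qed.

Lemma Ck_ext k A (f g : 'rV[R]_n -> V) : open A -> {in A, f =1 g} ->
  Ck k A f -> Ck k A g.
Proof.
move=> oA; elim: k f g => [f g fg [H _]|k IH f g fg [H Hk]].
  split=> // u Au; have [cf df] := H u Au.
  have nfg : \near u, f u = g u.
    by apply: filterS (open_nbhs_nbhs (conj oA Au)) => z Az; apply/fg/mem_set.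
  split; last by move=> i; apply: near_eq_derivable (df i).
  rewrite /prop_for /continuous_at -(nbhs_singleton nfg).
  exact: cvg_trans (near_eq_cvg nfg) cf.
split=> [u Au|i].
  have [cf df] := H u Au.
  have nfg : \near u, f u = g u.
    by apply: filterS (open_nbhs_nbhs (conj oA Au)) => z Az; apply/fg/mem_set.
  split; last by move=> i; apply: near_eq_derivable (df i).
  rewrite /prop_for /continuous_at -(nbhs_singleton nfg).
  exact: cvg_trans (near_eq_cvg nfg) cf.
apply: IH (Hk i) => u /set_mem Au; apply: near_eq_derive.
by apply: filterS (open_nbhs_nbhs (conj oA Au)) => z Az; apply/fg/mem_set.
Qed.

Lemma Ck_cst k A (v : V) : Ck k A (fun _ => v).
Proof.
elim: k v => [v|k IH v]; split=> //.
- by move=> u _; split; [exact: cst_continuous|move=> i; exact: derivable_cst].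
- by move=> u _; split; [exact: cst_continuous|move=> i; exact: derivable_cst].
- move=> i; have -> : (fun u => 'D_(e i) (fun _ : 'rV[R]_n => v) u) = fun _ => 0.
    by apply/funext => u; exact: derive_cst.
  exact: IH.
Qed.

Lemma CkD k A (f g : 'rV[R]_n -> V) : open A -> Ck k A f -> Ck k A g ->
  Ck k A (fun u => f u + g u).
Proof.
move=> oA; elim: k f g => [f g [Hf _] [Hg _]|k IH f g [Hf Hkf] [Hg Hkg]].
  split; last exact: I.
  move=> u Au; have [cf df] := Hf u Au; have [cg dg] := Hg u Au.
  by split; [exact: continuousD|move=> i; exact: derivableD].
split=> [u Au|i].
  have [cf df] := Hf u Au; have [cg dg] := Hg u Au.
  by split; [exact: continuousD|move=> i; exact: derivableD].
apply: Ck_ext (IH _ _ (Hkf i) (Hkg i)) => // u /set_mem Au; apply/esym/deriveD.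
  by have [] := Hf u Au.
by have [] := Hg u Au.
Qed.
End Ck.

Lemma Ck_linear (V W : normedModType R) (g : {linear V -> W}) k A
    (f : 'rV[R]_n -> V) : open A -> continuous g -> Ck k A f ->
  Ck k A (fun u => g (f u)).
Proof.
move=> oA cg; have dl u f' : A u -> Ck 0 A f' ->
    {for u, continuous (fun u => g (f' u))} /\
    forall i, is_derive u (e i) (fun u => g (f' u)) (g ('D_(e i) f' u)).
  move=> Au [/(_ u Au)[cf df] _]; split.
    by apply: continuous_comp => //; exact: cg.
  by move=> i; apply: is_derive_linear => //; exact: derivableP.
elim: k f => [f C0|k IH f C].
  by split=> // u Au; have [? H] := dl u f Au C0; split=> // i; have [] := H i.
have C0 : Ck 0 A f by case: C.
split=> [u Au|i].
  by have [? H] := dl u f Au C0; split=> // i; have [] := H i.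
apply: Ck_ext (IH _ (C.2 i)) => // u /set_mem Au.
by have [_ /(_ i)[_ ->]] := dl u f Au C0.
Qed.

(** By the Leibniz rule the partial derivatives of a product are sums of products
    one class below. *)
Lemma CkM k A (f g : 'rV[R]_n -> R^o) : open A -> Ck k A f -> Ck k A g ->
  Ck k A (fun u => f u * g u : R^o).
Proof.
move=> oA; elim: k f g => [f g [Hf _] [Hg _]|k IH f g Cf Cg].
  split; last exact: I.
  move=> u Au; have [cf df] := Hf u Au; have [cg dg] := Hg u Au.
  by split; [exact: continuousM|move=> i; exact: derivableM].
have [Hf Hkf] := Cf; have [Hg Hkg] := Cg.
split=> [u Au|i].
  have [cf df] := Hf u Au; have [cg dg] := Hg u Au.
  by split; [exact: continuousM|move=> i; exact: derivableM].
have C1 := IH _ _ (Ck_mono Cf) (Hkg i); have C2 := IH _ _ (Ck_mono Cg) (Hkf i).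
apply: Ck_ext (CkD oA C1 C2) => // u /set_mem Au; apply/esym.
by rewrite deriveM //; [have [] := Hf u Au|have [] := Hg u Au].
Qed.

(** The derivative of g o f is (g' o f) times that of f, so the induction on k needs
    g' o f one class below; for exp and inversion g' is expressed by g itself. *)
Lemma Ck_comp1 (g g' : R -> R) k A (f : 'rV[R]_n -> R^o) : open A ->
  (forall u, A u -> is_derive (f u : R) (1 : R) g (g' (f u))) ->
  Ck k A f -> (if k is k'.+1 then Ck k' A (g' \o f : _ -> R^o) else True) ->
  Ck k A (g \o f : _ -> R^o).
Proof.
move=> oA gg' Cf Cg'.
have H u : A u -> {for u, continuous (g \o f : _ -> R^o)} /\
    forall i, is_derive u (e i) (g \o f : _ -> R^o) (g' (f u) * 'D_(e i) f u).
  have [H _] := Ck_0 Cf => Au; have [cf df] := H u Au; split.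
    apply: continuous_comp => //.
    by apply/differentiable_continuous/derivable1_diffP; case: (gg' u Au).
  by move=> i; apply: is_derive_comp1; [exact: derivableP|exact: gg'].
case: k Cf Cg' => [|k] Cf Cg'; split=> //.
- by move=> u /H [? D]; split=> // i; case: (D i).
- by move=> u /H [? D]; split=> // i; case: (D i).
- move=> i; apply: Ck_ext (CkM oA Cg' (Cf.2 i)) => // u /set_mem /H [_ /(_ i)].
  by case=> _ ->.
Qed.

Lemma Ck_exp k A (f : 'rV[R]_n -> R^o) : open A -> Ck k A f ->
  Ck k A (fun u => expR (f u) : R^o).
Proof.
move=> oA; elim: k f => [|k IH] f Cf.
  exact: (@Ck_comp1 _ (@expR R) 0 A f oA (fun u _ => is_derive_expR (f u)) Cf I).
have D u : A u -> is_derive (f u : R) (1 : R) (@expR R) (expR (f u)).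
  by move=> _; exact: is_derive_expR.
exact: (Ck_comp1 oA D Cf (IH f (Ck_mono Cf))).
Qed.

Lemma is_derive1_inv (x : R) : x != 0 ->
  is_derive x (1 : R) (GRing.inv : R -> R) (- (x^-1 * x^-1)).
Proof.
move=> x0; split; first exact: (@derivableV _ _ (id : R -> R)).
rewrite (@deriveV _ _ (id : R -> R)) // derive_id.
by rewrite -exprVn expr2 scaleNr [_ *: 1]mulr1.
Qed.

Lemma CkV k A (f : 'rV[R]_n -> R^o) : open A -> (forall u, A u -> f u != 0) ->
  Ck k A f -> Ck k A (fun u => (f u)^-1 : R^o).
Proof.
move=> oA f0; elim: k f f0 => [|k IH] f f0 Cf.
  exact: (@Ck_comp1 _ (fun x => - (x^-1 * x^-1)) 0 _ _ oA
    (fun u Au => is_derive1_inv (f0 u Au)) Cf I).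
apply: (@Ck_comp1 _ (fun x => - (x^-1 * x^-1)) _ _ _ oA
  (fun u Au => is_derive1_inv (f0 u Au)) Cf).
have C1 := IH f f0 (Ck_mono Cf).
have := CkM oA (Ck_cst k A (-1 : R^o)) (CkM oA C1 C1).
by apply: (Ck_ext oA) => u _; exact: mulN1r.
Qed.

Lemma Ck_ln k A (f : 'rV[R]_n -> R^o) : open A -> (forall u, A u -> 0 < f u) ->
  Ck k A f -> Ck k A (fun u => ln (f u) : R^o).
Proof.
move=> oA f0 Cf; apply: (@Ck_comp1 _ (GRing.inv : R -> R) _ _ _ oA
  (fun u Au => is_derive1_ln (f0 u Au)) Cf).
case: k Cf => // k Cf; apply: CkV => //; last exact: Ck_mono.
by move=> u /f0 /lt0r_neq0.
Qed.

Lemma Ck_differentiable A (f : 'rV[R]_n -> R^o) u : open A -> A u ->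
  Ck 1 A f -> differentiable f u.
Proof.
move=> oA Au [H1 H2]; apply: differentiable_partials.
  by apply: filterS (open_nbhs_nbhs (conj oA Au)) => z /H1 [].
by move=> i; have [/(_ u Au)[]] := H2 i.
Qed.

End Smoothness.

(** * Closure properties of smooth functions on open sets *)

Section SmoothOn.
Context {R : realType} {n : nat}.
Implicit Types (A B : set 'rV[R]_n) (V W : normedModType R).
Let e (i : 'I_n) : 'rV[R]_n := delta_mx 0 i.

Lemma smooth_onW A B V (f : 'rV[R]_n -> V) :
  B `<=` A -> smooth_on A f -> smooth_on B f.
Proof. by move=> BA sf s u /BA; exact: sf. Qed.

Lemma smooth_on_ext A V (f g : 'rV[R]_n -> V) : open A ->
  (forall u, A u -> f u = g u) -> smooth_on A f -> smooth_on A g.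
Proof.
move=> oA fg /smooth_onE sf; apply/smooth_onE => k.
by apply: Ck_ext (sf k) => // u /set_mem; exact: fg.
Qed.

Lemma smooth_on_cst A V (v : V) : smooth_on A (fun _ => v).
Proof. by apply/smooth_onE => k; exact: Ck_cst. Qed.

Lemma smooth_onD A V (f g : 'rV[R]_n -> V) : open A ->
  smooth_on A f -> smooth_on A g -> smooth_on A (fun u => f u + g u).
Proof.
by move=> oA /smooth_onE sf /smooth_onE sg; apply/smooth_onE => k; exact: CkD.
Qed.

Lemma smooth_on_sum A V (I : Type) (r : seq I) (f : I -> 'rV[R]_n -> V) :
  open A -> (forall i, smooth_on A (f i)) ->
  smooth_on A (fun u => \sum_(i <- r) f i u).
Proof.
move=> oA sf; elim: r => [|i r IH].
  have : smooth_on A (fun _ => 0 : V) by exact: smooth_on_cst.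
   apply: (smooth_on_ext oA) => u _.
  by rewrite big_nil.
have := smooth_onD oA (sf i) IH; apply: (smooth_on_ext oA) => u _.
by rewrite big_cons.
Qed.

Lemma smooth_on_linear A V W (g : {linear V -> W}) (f : 'rV[R]_n -> V) :
  open A -> continuous g -> smooth_on A f -> smooth_on A (fun u => g (f u)).
Proof.
by move=> oA cg /smooth_onE sf; apply/smooth_onE => k; exact: Ck_linear.
Qed.

Lemma smooth_onM A (f g : 'rV[R]_n -> R^o) : open A ->
  smooth_on A f -> smooth_on A g -> smooth_on A (fun u => f u * g u : R^o).
Proof.
by move=> oA /smooth_onE sf /smooth_onE sg; apply/smooth_onE => k; exact: CkM.
Qed.

Lemma smooth_onN A (f : 'rV[R]_n -> R^o) : open A ->
  smooth_on A f -> smooth_on A (fun u => - f u : R^o).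
Proof.
move=> oA sf; have := smooth_onM oA (@smooth_on_cst A _ (-1 : R^o)) sf.
by apply: smooth_on_ext => // u _; exact: mulN1r.
Qed.

Lemma smooth_onV A (f : 'rV[R]_n -> R^o) : open A ->
  (forall u, A u -> f u != 0) ->
  smooth_on A f -> smooth_on A (fun u => (f u)^-1 : R^o).
Proof. by move=> oA f0 /smooth_onE sf; apply/smooth_onE => k; exact: CkV. Qed.

Lemma smooth_on_exp A (f : 'rV[R]_n -> R^o) : open A ->
  smooth_on A f -> smooth_on A (fun u => expR (f u) : R^o).
Proof. by move=> oA /smooth_onE sf; apply/smooth_onE => k; exact: Ck_exp. Qed.

Lemma smooth_on_ln A (f : 'rV[R]_n -> R^o) : open A ->
  (forall u, A u -> 0 < f u) ->
  smooth_on A f -> smooth_on A (fun u => ln (f u) : R^o).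
Proof. by move=> oA f0 /smooth_onE sf; apply/smooth_onE => k; exact: Ck_ln. Qed.

Lemma smooth_on_partial A V (f : 'rV[R]_n -> V) i :
  smooth_on A f -> smooth_on A (fun u => 'D_(e i) f u).
Proof.
by move=> /smooth_onE sf; apply/smooth_onE => k; have [_] := sf k.+1; apply.
Qed.

Lemma smooth_on_derivable A V (f : 'rV[R]_n -> V) i u : A u ->
  smooth_on A f -> derivable f u (e i).
Proof. by move=> Au sf; have [_] := sf [::] u Au; apply. Qed.

Lemma smooth_on_differentiable1 A (f : 'rV[R]_n -> R^o) u : open A -> A u ->
  smooth_on A f -> differentiable f u.
Proof. by move=> oA Au /smooth_onE /(_ 1%N); exact: Ck_differentiable. Qed.

Lemma smooth_on_derive_comm A (f : 'rV[R]_n -> R^o) i j u : open A -> A u ->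
  smooth_on A f ->
  'D_(e j) ('D_(e i) f : _ -> R^o) u = 'D_(e i) ('D_(e j) f : _ -> R^o) u.
Proof.
move=> oA Au sf.
have near_in (P : 'rV[R]_n -> Prop) : (forall z, A z -> P z) -> \forall z \near u, P z.
  by move=> AP; exact: filterS (open_nbhs_nbhs (conj oA Au)).
have sp k := smooth_on_partial k sf.
have sq k l := smooth_on_partial k (sp l).
apply: derive_comm.
- by apply: near_in => z Az; exact: smooth_on_derivable Az sf.
- by apply: near_in => z Az; exact: smooth_on_derivable Az sf.
- by apply: near_in => z Az; exact: smooth_on_derivable Az (sp i).
- by apply: near_in => z Az; exact: smooth_on_derivable Az (sp j).
- by have [] := sq j i [::] u Au.
- by have [] := sq i j [::] u Au.
Qed.

(** Multiples of a fixed vector as a linear map of the scalar, so that smoothness of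
    a combination of coordinates is an instance of [smooth_on_linear]. *)
Definition scale_by (V : normedModType R) (v : V) (c : R^o) : V := c *: v.
Lemma scale_by_is_linear V (v : V) : linear (scale_by v).
Proof. by move=> a x y; rewrite /scale_by scalerDl scalerA. Qed.
HB.instance Definition _ (V : normedModType R) (v : V) :=
  GRing.isLinear.Build R R^o V *:%R (scale_by v) (scale_by_is_linear v).
Lemma scale_by_continuous V (v : V) : continuous (scale_by v).
Proof. by move=> c; exact: (@scalel_continuous R V v c). Qed.

Section Coordinates.
Context {V : normedModType R} {I : finType} (co : I -> {linear V -> R^o})
  (ba : I -> V).
Hypothesis co_cont : forall i, continuous (co i).
Hypothesis coE : forall v, v = \sum_i co i v *: ba i.

(** A finite family of continuous coordinate forms reduces smoothness of
    vector-valued maps to real-valued ones; it is used for row vectors and for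
    fibres of the generalized tangent bundle. *)
Lemma smooth_on_coords A (f : 'rV[R]_n -> V) : open A ->
  smooth_on A f <-> forall i, smooth_on A (fun u => co i (f u)).
Proof.
move=> oA; split=> [sf i|sf]; first exact: smooth_on_linear.
have := smooth_on_sum (index_enum I) oA (fun i =>
  smooth_on_linear (g := scale_by (ba i)) oA (@scale_by_continuous _ _) (sf i)).
by apply: smooth_on_ext => // u _; rewrite [RHS]coE.
Qed.

Lemma differentiable_coords (f : 'rV[R]_n -> V) u :
  (forall i, differentiable (fun z => co i (f z)) u) -> differentiable f u.
Proof.
move=> df.
have -> : f = \sum_i (fun z => co i (f z) *: ba i).
  by apply/funext => z; rewrite fct_sumE -coE.
elim/big_ind : _ => [||i _].
- exact: differentiable_cst.
- by move=> g h; exact: differentiableD.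
- exact: differentiableZl.
Qed.

Lemma smooth_on_differentiable_coords A (f : 'rV[R]_n -> V) u : open A -> A u ->
  smooth_on A f -> differentiable f u.
Proof.
move=> oA Au /(smooth_on_coords _ oA) sf; apply: differentiable_coords => i.
exact: smooth_on_differentiable1 (sf i).
Qed.
End Coordinates.

Definition vco (j : 'I_n) (x : 'rV[R]_n) : R^o := x 0 j.
Lemma vco_is_linear j : linear (vco j).
Proof. by move=> a x y; rewrite /vco !mxE. Qed.
HB.instance Definition _ j :=
  GRing.isLinear.Build R 'rV[R]_n R^o *:%R (vco j) (vco_is_linear j).
Lemma vco_continuous j : continuous (vco j).
Proof. exact: coord_continuous. Qed.
Lemma vcoE (x : 'rV[R]_n) : x = \sum_j vco j x *: e j.
Proof. exact: row_sum_delta. Qed.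

(** Coordinates of the fibre, indexed by the tangent (true) and the cotangent
    (false) part. *)
Definition gco (i : bool * 'I_n) (x : gfiber R n) : R^o :=
  if i.1 then x.1 0 i.2 else x.2 0 i.2.
Lemma gco_is_linear i : linear (gco i).
Proof. by move=> a x y; rewrite /gco; case: ifP => _; rewrite !mxE. Qed.
HB.instance Definition _ i :=
  GRing.isLinear.Build R (gfiber R n) R^o *:%R (gco i) (gco_is_linear i).
Lemma gco_continuous i : continuous (gco i).
Proof.
move=> x; rewrite /gco; case: i => -[] i /=.
  exact: (continuous_comp (@cvg_fst _ _ _ _ _) (@coord_continuous _ _ _ _ _ _)).
exact: (continuous_comp (@cvg_snd _ _ _ _ _) (@coord_continuous _ _ _ _ _ _)).
Qed.
(** The basis dual to the coordinates [gco]. *)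
Definition gba (i : bool * 'I_n) : gfiber R n :=
  if i.1 then (e i.2, 0) else (0, e i.2).
Lemma gco_inj (x y : gfiber R n) : (forall i, gco i x = gco i y) -> x = y.
Proof.
case: x y => [x1 x2] [y1 y2] xy; congr (_, _); apply/rowP => j.
  exact: (xy (true, j)).
exact: (xy (false, j)).
Qed.
Lemma gco_gba i k : gco i (gba k) = (i == k)%:R.
Proof.
by case: i k => -[] i [[] k]; rewrite /gco /gba /= !mxE ?eqxx.
Qed.
Lemma gcoE (x : gfiber R n) : x = \sum_i gco i x *: gba i.
Proof.
apply: gco_inj => k; rewrite linear_sum (bigD1 k) //= big1 ?addr0 => [|i ik].
  by rewrite linearZ /= gco_gba eqxx [_ *: _]mulr1.
by rewrite linearZ /= gco_gba eq_sym (negbTE ik) [_ *: _]mulr0.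
Qed.

Lemma smooth_on_gfiber A (f : 'rV[R]_n -> gfiber R n) : open A ->
  smooth_on A f <-> forall i, smooth_on A (fun u => gco i (f u)).
Proof. exact: smooth_on_coords gco_continuous gcoE _ _. Qed.

Lemma smooth_on_vector A (f : 'rV[R]_n -> 'rV[R]_n) : open A ->
  smooth_on A f <-> forall i, smooth_on A (fun u => f u 0 i : R^o).
Proof. exact: smooth_on_coords vco_continuous vcoE _ _. Qed.

Lemma smooth_on_differentiable A (f : 'rV[R]_n -> 'rV[R]_n) u : open A -> A u ->
  smooth_on A f -> differentiable f u.
Proof. exact: smooth_on_differentiable_coords vco_continuous vcoE _ _ _. Qed.

Lemma smooth_on_gdifferentiable A (f : 'rV[R]_n -> gfiber R n) u : open A ->
  A u -> smooth_on A f -> differentiable f u.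
Proof. exact: smooth_on_differentiable_coords gco_continuous gcoE _ _ _. Qed.

Lemma smooth_on_ip A (f g : 'rV[R]_n -> gfiber R n) : open A ->
  smooth_on A f -> smooth_on A g -> smooth_on A (fun u => ip (f u) (g u) : R^o).
Proof.
move=> oA /(smooth_on_gfiber _ oA) sf /(smooth_on_gfiber _ oA) sg.
rewrite /ip /pairing; apply: smooth_onM => //; first exact: smooth_on_cst.
apply: smooth_onD => //; apply: smooth_on_sum => // j; apply: smooth_onM => //.
- exact: (sf (false, j)).
- exact: (sg (true, j)).
- exact: (sg (false, j)).
- exact: (sf (true, j)).
Qed.

Lemma smooth_onZ A (f : 'rV[R]_n -> R^o) (g : 'rV[R]_n -> gfiber R n) :
  open A -> smooth_on A f -> smooth_on A g -> smooth_on A (fun u => f u *: g u).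
Proof.
move=> oA sf /(smooth_on_gfiber _ oA) sg; apply/(smooth_on_gfiber _ oA) => i.
have := smooth_onM oA sf (sg i); apply: (smooth_on_ext oA) => u _.
by rewrite linearZ.
Qed.

End SmoothOn.

(** * Charts and their transition maps *)

Section Charts.
Context {R : realType} {n : nat} {M : manifold R n}.
Implicit Types (c : chart R n M) (p q : M) (U : set M).
Let e (i : 'I_n) : 'rV[R]_n := delta_mx 0 i.

Lemma chart_invK c u : (chart_map c @` chart_dom c) u -> chart_map c (chart_inv c u) = u.
Proof. by move=> [p dp <-]; rewrite chart_mapK. Qed.

Lemma chart_inv_dom c u : (chart_map c @` chart_dom c) u -> chart_dom c (chart_inv c u).
Proof. by move=> [p dp <-]; rewrite chart_mapK. Qed.

Lemma chart_img_open c U : open U -> open (chart_map c @` (chart_dom c `&` U)).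
Proof.
move=> oU; rewrite openE => u [p [dp Up] <-]; rewrite /interior.
have Iu : (chart_map c @` chart_dom c) (chart_map c p) by exists p.
have ci := continuous_chart_inv Iu.
have oI : nbhs (chart_map c p) (chart_map c @` chart_dom c).
  by apply: open_nbhs_nbhs; split; [exact: (@open_chart_img _ _ _ c)|].
have nU : nbhs (chart_inv c (chart_map c p)) U.
  by rewrite chart_mapK //; apply: open_nbhs_nbhs.
apply: filterS (@filterI _ _ (nbhs_filter _) _ _ oI (ci _ nU)) => v [Iv Uv].
exists (chart_inv c v); last exact: chart_invK.
by split=> //; exact: chart_inv_dom.
Qed.

Lemma chart_img_mem c U p : chart_dom c p -> U p ->
  (chart_map c @` (chart_dom c `&` U)) (chart_map c p).
Proof. by move=> dp Up; exists p. Qed.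

(** Neighbourhoods of a point may be read in any chart around it. *)
Lemma near_chart c p (P : M -> Prop) : chart_dom c p ->
  (\forall q \near p, P q) ->
  \forall u \near chart_map c p, [/\ (chart_map c @` chart_dom c) u,
     chart_dom c (chart_inv c u) & P (chart_inv c u)].
Proof.
move=> dp nP.
have Iu : (chart_map c @` chart_dom c) (chart_map c p) by exists p.
have ci := continuous_chart_inv Iu.
have oI : nbhs (chart_map c p) (chart_map c @` chart_dom c).
  by apply: open_nbhs_nbhs; split; [exact: (@open_chart_img _ _ _ c)|].
have nP' : nbhs (chart_inv c (chart_map c p)) P by rewrite chart_mapK.
apply: filterS (@filterI _ _ (nbhs_filter _) _ _ oI (ci _ nP')) => v [Iv Pv].
by split=> //; exact: chart_inv_dom.
Qed.

Lemma near_dom c p : chart_dom c p -> \forall q \near p, chart_dom c q.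
Proof. by move=> dp; apply: open_nbhs_nbhs; split=> //; exact: open_chart_dom. Qed.

Definition trans c c' := chart_map c' \o chart_inv c.

Lemma trans_smooth c c' : atlas c -> atlas c' ->
  smooth_on (chart_map c @` (chart_dom c `&` chart_dom c')) (trans c c').
Proof. exact: atlas_compatible. Qed.

Lemma trans_open c c' : open (chart_map c @` (chart_dom c `&` chart_dom c')).
Proof. by apply: chart_img_open; exact: open_chart_dom. Qed.

Lemma trans_differentiable c c' q : atlas c -> atlas c' ->
  chart_dom c q -> chart_dom c' q -> differentiable (trans c c') (chart_map c q).
Proof.
move=> ac ac' dq dq'; apply: smooth_on_differentiable (trans_smooth ac ac').
  exact: trans_open.
exact: chart_img_mem.
Qed.

Lemma transK c c' q : chart_dom c q -> trans c c' (chart_map c q) = chart_map c' q.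
Proof. by move=> dq; rewrite /trans /= chart_mapK. Qed.

(** The tangent map at q of the change of coordinates from c to c'. *)
Definition tv c c' q (v : 'rV[R]_n) : 'rV[R]_n := 'D_v (trans c c') (chart_map c q).

Lemma tvE c c' q v : atlas c -> atlas c' -> chart_dom c q -> chart_dom c' q ->
  tv c c' q v = 'd (trans c c') (chart_map c q) v.
Proof. by move=> *; rewrite /tv deriveE //; exact: trans_differentiable. Qed.

Lemma tvP c c' q : atlas c -> atlas c' -> chart_dom c q -> chart_dom c' q ->
  linear (tv c c' q).
Proof. by move=> ac ac' dq dq' a v w; rewrite !tvE // linearP. Qed.

Lemma tv_id c q v : chart_dom c q -> tv c c q v = v.
Proof.
move=> dq; rewrite /tv (near_eq_derive (g := id)); first exact: derive_id.
by apply: filterS (near_chart dq (near_dom dq)) => u [Iu _ _]; rewrite /trans /= chart_invK.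
Qed.

Lemma derive_comp_trans (W : normedModType R) c c' q (f : 'rV[R]_n -> W) v :
  atlas c -> atlas c' -> chart_dom c q -> chart_dom c' q ->
  differentiable f (chart_map c' q) ->
  'D_v (f \o trans c c') (chart_map c q) = 'D_(tv c c' q v) f (chart_map c' q).
Proof.
move=> ac ac' dq dq' df; have dt := trans_differentiable ac ac' dq dq'.
have dft : differentiable f (trans c c' (chart_map c q)) by rewrite transK.
rewrite (deriveE _ (differentiable_comp dt dft)).
rewrite (diff_comp dt dft) (deriveE _ df) (tvE _ ac ac' dq dq') /=.
by rewrite (transK _ dq).
Qed.

Lemma tv_comp c c' c'' q v : atlas c -> atlas c' -> atlas c'' ->
  chart_dom c q -> chart_dom c' q -> chart_dom c'' q ->
  tv c' c'' q (tv c c' q v) = tv c c'' q v.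
Proof.
move=> ac ac' ac'' dq dq' dq''.
rewrite {1}/tv -(derive_comp_trans _ ac ac' dq dq'
  (trans_differentiable ac' ac'' dq' dq'')).
apply: near_eq_derive.
apply: filterS (near_chart dq (near_dom dq')) => u [Iu du du'].
by rewrite /trans /= (chart_mapK du').
Qed.

(** The row of values of a form on a transformed basis represents the transposed
    map. *)
Lemma pairing_linear (a : 'rV[R]_n) (g : 'rV[R]_n -> 'rV[R]_n) w : linear g ->
  pairing (\row_j pairing a (g (e j))) w = pairing a (g w).
Proof.
move=> lg; pose h : 'rV[R]_n -> R^o := fun x => pairing a (g x).
have hP k x y : h (k *: x + y) = k * h x + h y.
  by rewrite /h lg; exact: (@lform_is_linear _ _ a).
have h0 : h 0 = 0.
  by have := hP 1 0 0; rewrite scaler0 addr0 mul1r => /esym/eqP; rewrite -subr_eq0 addrK => /eqP.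
have hS I (r : seq I) (F : I -> 'rV[R]_n) (k : I -> R) :
    h (\sum_(i <- r) k i *: F i) = \sum_(i <- r) k i * h (F i).
  elim: r => [|i r IH]; first by rewrite !big_nil.
  by rewrite !big_cons hP IH.
rewrite -/(h w) [w in RHS]row_sum_delta hS /pairing; apply: eq_bigr => j _.
by rewrite mxE mulrC.
Qed.

(** The change of components of a generalized vector: tangent map on vectors,
    transposed inverse on forms. *)
Definition tr c c' q (w : gfiber R n) : gfiber R n :=
  (tv c c' q w.1, \row_j pairing w.2 (tv c' c q (e j))).

Lemma tr_linear c c' q : atlas c -> atlas c' -> chart_dom c q -> chart_dom c' q ->
  linear (tr c c' q).
Proof.
move=> ac ac' dq dq' a v w; rewrite /tr /=; congr (_, _); first exact: tvP.
apply/rowP => j; rewrite !mxE /pairing /= mulr_sumr -big_split /=.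
by apply: eq_bigr => k _; rewrite !mxE; ring.
Qed.

Lemma tr_id c q w : chart_dom c q -> tr c c q w = w.
Proof.
move=> dq; case: w => X a; rewrite /tr /= tv_id //; congr (_, _).
apply/rowP => j; rewrite mxE tv_id // /pairing (bigD1 j) //= big1 => [|k kj].
  by rewrite mxE !eqxx mulr1 addr0.
by rewrite mxE eqxx (negbTE kj) mulr0.
Qed.

Lemma tr_comp c c' c'' q w : atlas c -> atlas c' -> atlas c'' ->
  chart_dom c q -> chart_dom c' q -> chart_dom c'' q ->
  tr c' c'' q (tr c c' q w) = tr c c'' q w.
Proof.
move=> ac ac' ac'' dq dq' dq''.
rewrite /tr /= (tv_comp _ ac ac' ac'' dq dq' dq''); congr (_, _).
apply/rowP => j; rewrite !mxE pairing_linear; last exact: tvP.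
by rewrite (tv_comp _ ac'' ac' ac dq'' dq' dq).
Qed.

(** The tangent maps of the two opposite changes of coordinates are inverse to each
    other, so evaluating a form on a vector does not depend on the chart. *)
Lemma tr_pairing c c' q w w' : atlas c -> atlas c' ->
  chart_dom c q -> chart_dom c' q ->
  pairing (tr c c' q w).2 (tr c c' q w').1 = pairing w.2 w'.1.
Proof.
move=> ac ac' dq dq'; rewrite /tr /= pairing_linear; last exact: tvP.
by rewrite tv_comp // tv_id.
Qed.

Lemma tr_ip c c' q w w' : atlas c -> atlas c' -> chart_dom c q -> chart_dom c' q ->
  ip (tr c c' q w) (tr c c' q w') = ip w w'.
Proof. by move=> *; rewrite /ip !tr_pairing. Qed.

(** Components in a chart are obtained from the value of the section, which is given
    in the preferred chart of the point, by the change of components. *)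
Lemma gcomponentsE c x q : gcomponents c x q = tr (chart_at q) c q (x q).
Proof. by []. Qed.

Lemma coord_fieldE c j q : coord_field c j q = tv c (chart_at q) q (e j).
Proof. by []. Qed.

End Charts.
Arguments chart_img_open {R n M} c {U} _.
Arguments trans_open {R n M} c c'.

(** * Smooth functions and sections on a manifold *)

Section SmoothSections.
Context {R : realType} {n : nat} {M : manifold R n}.
Implicit Types (c : chart R n M) (p q : M) (U : set M) (x y : M -> gfiber R n)
  (f g : M -> R).
Let e (i : 'I_n) : 'rV[R]_n := delta_mx 0 i.

Lemma mem_at p : chart_dom (chart_at p) p. Proof. exact: mem_chart_at. Qed.
Lemma atlas_at p : atlas (chart_at p). Proof. exact: chart_at_atlas. Qed.

Lemma gcomponentsP c q (a b : R) x y z : atlas c -> chart_dom c q ->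
  z q = a *: x q + b *: y q ->
  gcomponents c z q = a *: gcomponents c x q + b *: gcomponents c y q.
Proof.
move=> ac dq zq; rewrite !gcomponentsE zq.
have L := tr_linear (atlas_at q) ac (mem_at q) dq.
have tr0 : tr (chart_at q) c q 0 = 0.
  have := L 1 0 0; rewrite scaler0 addr0 scale1r => /esym/eqP.
  by rewrite -subr_eq0 addrK => /eqP.
rewrite L; congr (_ + _).
by have := L b (y q) 0; rewrite addr0 tr0 addr0.
Qed.

Lemma gcomponents_ip c q x y : atlas c -> chart_dom c q ->
  ip (gcomponents c x q) (gcomponents c y q) = ip (x q) (y q).
Proof.
by move=> ac dq; rewrite !gcomponentsE (tr_ip _ _ (atlas_at q) ac (mem_at q) dq).
Qed.

Lemma gcomponents_at p x : gcomponents (chart_at p) x p = x p.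
Proof. by rewrite gcomponentsE; apply: tr_id; exact: mem_at. Qed.

Lemma img_dom c U u : (chart_map c @` (chart_dom c `&` U)) u ->
  [/\ chart_dom c (chart_inv c u), U (chart_inv c u) & chart_map c (chart_inv c u) = u].
Proof. by move=> [p [dp Up] <-]; rewrite chart_mapK. Qed.

Lemma smooth_section_ext U x y : open U -> (forall q, U q -> x q = y q) ->
  smooth_section U x -> smooth_section U y.
Proof.
move=> oU xy sx c ac; apply: (smooth_on_ext (chart_img_open c oU)) (sx c ac) => u.
by move=> /img_dom [_ Uu _]; rewrite /= !gcomponentsE xy.
Qed.

Lemma smooth_fun_ext U f g : open U -> (forall q, U q -> f q = g q) ->
  smooth_fun U f -> smooth_fun U g.
Proof.
move=> oU xy sx c ac; apply: (smooth_on_ext (chart_img_open c oU)) (sx c ac) => u.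
by move=> /img_dom [_ Uu _]; rewrite /= xy.
Qed.

Lemma smooth_sectionW U U' x : U' `<=` U -> smooth_section U x -> smooth_section U' x.
Proof.
move=> UU sx c ac; apply: smooth_onW (sx c ac) => u [q [dq Uq] <-].
by exists q => //; split=> //; exact: UU.
Qed.

(** Smoothness is a pointwise condition on germs, so it can be tested on the members
    of an open cover. *)
Lemma smooth_section_local U x :
  (forall p, U p -> exists U', [/\ open U', U' p & smooth_section (U `&` U') x]) ->
  smooth_section U x.
Proof.
move=> H c ac s u [p [dp Up] <-]; have [U' [oU' U'p sx]] := H p Up.
by apply: (sx c ac s); exists p.
Qed.

Lemma smooth_fun_cst U (k : R) : smooth_fun U (fun _ => k).
Proof. by move=> c ac; exact: (@smooth_on_cst _ _ _ _ (k : R^o)). Qed.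

Lemma smooth_section0 U : open U -> smooth_section U (fun _ => 0).
Proof.
move=> oU c ac; have : smooth_on (chart_map c @` (chart_dom c `&` U)) (fun _ => 0 : gfiber R n).
  exact: smooth_on_cst.
apply: (smooth_on_ext (chart_img_open c oU)) => u /img_dom [du _ _] /=.
have := @gcomponentsP c (chart_inv c u) 0 0 (fun=> 0) (fun=> 0) (fun=> 0) ac du.
by rewrite !scale0r addr0 => ->.
Qed.

Lemma smooth_sectionD U x y : open U -> smooth_section U x -> smooth_section U y ->
  smooth_section U (fun q => x q + y q).
Proof.
move=> oU sx sy c ac.
have := smooth_onD (chart_img_open c oU) (sx c ac) (sy c ac).
apply: (smooth_on_ext (chart_img_open c oU)) => u /img_dom [du _ _] /=.
have := @gcomponentsP c (chart_inv c u) 1 1 x y (fun q => x q + y q) ac du.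
by rewrite !scale1r => ->.
Qed.

Lemma smooth_sectionZ U f x : open U -> smooth_fun U f -> smooth_section U x ->
  smooth_section U (fun q => f q *: x q).
Proof.
move=> oU sf sx c ac.
have := smooth_onZ (chart_img_open c oU) (sf c ac) (sx c ac).
apply: (smooth_on_ext (chart_img_open c oU)) => u /img_dom [du _ _] /=.
have := @gcomponentsP c (chart_inv c u) (f (chart_inv c u)) 0 x x (fun q => f q *: x q) ac du.
by rewrite !scale0r !addr0 => ->.
Qed.

Lemma smooth_sectionN U x : open U -> smooth_section U x ->
  smooth_section U (fun q => - x q).
Proof.
move=> oU /(smooth_sectionZ oU (@smooth_fun_cst U (-1))).
by apply: (smooth_section_ext oU) => q _; rewrite scaleN1r.
Qed.

Lemma smooth_sectionB U x y : open U -> smooth_section U x -> smooth_section U y ->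
  smooth_section U (fun q => x q - y q).
Proof. move=> oU sx sy; exact: (smooth_sectionD oU sx (smooth_sectionN oU sy)). Qed.

Lemma smooth_section_sum U (I : Type) (r : seq I) (F : I -> M -> gfiber R n) :
  open U -> (forall i, smooth_section U (F i)) ->
  smooth_section U (fun q => \sum_(i <- r) F i q).
Proof.
move=> oU sF; elim: r => [|i r IH].
  by apply: (smooth_section_ext oU) (smooth_section0 oU) => q _; rewrite big_nil.
apply: (smooth_section_ext oU) (smooth_sectionD oU (sF i) IH) => q _.
by rewrite big_cons.
Qed.

Lemma smooth_funD U f g : open U -> smooth_fun U f -> smooth_fun U g ->
  smooth_fun U (fun q => f q + g q).
Proof. by move=> oU sf sg c ac; exact: smooth_onD (chart_img_open c oU) (sf c ac) (sg c ac). Qed.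

Lemma smooth_funM U f g : open U -> smooth_fun U f -> smooth_fun U g ->
  smooth_fun U (fun q => f q * g q).
Proof. by move=> oU sf sg c ac; exact: smooth_onM (chart_img_open c oU) (sf c ac) (sg c ac). Qed.

Lemma smooth_funN U f : open U -> smooth_fun U f -> smooth_fun U (fun q => - f q).
Proof. by move=> oU sf c ac; exact: smooth_onN (chart_img_open c oU) (sf c ac). Qed.

Lemma smooth_funB U f g : open U -> smooth_fun U f -> smooth_fun U g ->
  smooth_fun U (fun q => f q - g q).
Proof. move=> oU sf sg; exact: (smooth_funD oU sf (smooth_funN oU sg)). Qed.

Lemma smooth_funV U f : open U -> (forall q, U q -> f q != 0) -> smooth_fun U f ->
  smooth_fun U (fun q => (f q)^-1).
Proof.
move=> oU f0 sf c ac; apply: (smooth_onV (chart_img_open c oU) _ (sf c ac)).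
by move=> u /img_dom [_ Uu _]; exact: f0.
Qed.

Lemma smooth_fun_exp U f : open U -> smooth_fun U f -> smooth_fun U (fun q => expR (f q)).
Proof. by move=> oU sf c ac; exact: smooth_on_exp (chart_img_open c oU) (sf c ac). Qed.

Lemma smooth_fun_ln U f : open U -> (forall q, U q -> 0 < f q) -> smooth_fun U f ->
  smooth_fun U (fun q => ln (f q)).
Proof.
move=> oU f0 sf c ac; apply: (smooth_on_ln (chart_img_open c oU) _ (sf c ac)).
by move=> u /img_dom [_ Uu _]; exact: f0.
Qed.

Lemma smooth_fun_ip U x y : open U -> smooth_section U x -> smooth_section U y ->
  smooth_fun U (fun q => ip (x q) (y q)).
Proof.
move=> oU sx sy c ac.
have := smooth_on_ip (chart_img_open c oU) (sx c ac) (sy c ac).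
apply: (smooth_on_ext (chart_img_open c oU)) => u /img_dom [du _ _] /=.
by rewrite gcomponents_ip.
Qed.

End SmoothSections.

(** * The Dorfman bracket in coordinates *)

Section Components.
Context {R : realType} {n : nat}.
Implicit Types (f g : 'rV[R]_n -> gfiber R n) (u v : 'rV[R]_n).

Definition gfst (x : gfiber R n) : 'rV[R]_n := x.1.
Lemma gfst_is_linear : linear gfst. Proof. by []. Qed.
HB.instance Definition _ :=
  GRing.isLinear.Build R (gfiber R n) 'rV[R]_n *:%R gfst gfst_is_linear.
Lemma gfst_continuous : continuous gfst.
Proof. by move=> x; exact: cvg_fst. Qed.

Lemma is_derive_fst f u v : differentiable f u ->
  is_derive u v (fun z => (f z).1) ('D_v f u).1.
Proof.
move=> df; have D := derivableP (@diff_derivable _ _ _ f u v df).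
exact: (is_derive_linear (g := gfst) gfst_continuous D).
Qed.

Lemma is_derive_gco i f u v : differentiable f u ->
  is_derive u v (gco i \o f) (gco i ('D_v f u)).
Proof.
move=> df; have D := derivableP (@diff_derivable _ _ _ f u v df).
exact: (@is_derive_linear R (gfiber R n) R^o (gco i) 'rV[R]_n f u v _ (@gco_continuous R n i) D).
Qed.

Lemma is_derive_pairing f g u v : differentiable f u -> differentiable g u ->
  is_derive u v (fun z => pairing (f z).2 (g z).1 : R^o)
    (pairing (f u).2 ('D_v g u).1 + pairing ('D_v f u).2 (g u).1).
Proof.
move=> df dg.
have -> : (fun z => pairing (f z).2 (g z).1 : R^o) =
    \sum_j ((fun z => gco (false, j) (f z) : R^o) * (fun z => gco (true, j) (g z) : R^o)).
  by apply/funext => z; rewrite fct_sumE.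
apply: is_derive_eq.
  apply: is_derive_sum => j; apply: is_deriveM; exact: is_derive_gco.
rewrite /pairing -big_split /=; apply: eq_bigr => j _.
by congr (_ + _); rewrite [LHS]mulrC.
Qed.

Lemma half_sum_swap (a b c d : R) :
  2^-1 *: ((a + b + (c + d)) : R^o) = 2^-1 * (a + d) + 2^-1 * (b + c).
Proof. by rewrite [LHS]mulrDr !mulrDr; ring. Qed.

Lemma is_derive_ip f g u v : differentiable f u -> differentiable g u ->
  is_derive u v (fun z => ip (f z) (g z) : R^o)
    (ip (f u) ('D_v g u) + ip ('D_v f u) (g u)).
Proof.
move=> df dg.
have D := is_deriveZ (2^-1 : R)
  (is_deriveD (is_derive_pairing v df dg) (is_derive_pairing v dg df)).
apply: (is_derive_eq D).
exact: half_sum_swap.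
Qed.

(** The Dorfman bracket of R^n: in coordinates the Cartan formulas collapse to
    D_f g - D_g f plus the 1-form 2 < D f, g >. *)
Definition flat f g u : gfiber R n :=
  'D_((f u).1) g u - 'D_((g u).1) f u +
  (0, \row_j (2 * ip ('D_(delta_mx 0 j) f u) (g u))).

End Components.

Lemma dorfman_alg (R : comRingType) (a b c d f : R) :
  a - - b - (c - (d + f) - - d) = a - c + (f + b).
Proof. by ring. Qed.

Section FlatAtChart.
Context {R : realType} {n : nat} {M : manifold R n}.
Implicit Types (c : chart R n M) (p q : M) (x y : M -> gfiber R n).
Let e (i : 'I_n) : 'rV[R]_n := delta_mx 0 i.

(** The local representative of a section in a chart. *)
Definition lrep c x : 'rV[R]_n -> gfiber R n := gcomponents c x \o chart_inv c.

Lemma lrep_smooth c x : atlas c -> smooth_section setT x ->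
  smooth_on (chart_map c @` chart_dom c) (lrep c x).
Proof. by move=> ac /(_ c ac); rewrite setIT. Qed.

Lemma img_mem c q : chart_dom c q -> (chart_map c @` chart_dom c) (chart_map c q).
Proof. by move=> dq; exists q. Qed.

Lemma lrep_differentiable c x q : atlas c -> chart_dom c q ->
  smooth_section setT x -> differentiable (lrep c x) (chart_map c q).
Proof.
move=> ac dq sx; apply: smooth_on_gdifferentiable (lrep_smooth ac sx).
  exact: (@open_chart_img _ _ _ c).
exact: img_mem.
Qed.

Lemma lrepE c x q : chart_dom c q -> lrep c x (chart_map c q) = gcomponents c x q.
Proof. by move=> dq; rewrite /lrep /= chart_mapK. Qed.

Lemma lrep_at p x : lrep (chart_at p) x (chart_map (chart_at p) p) = x p.
Proof. by rewrite lrepE ?gcomponents_at //; exact: mem_at. Qed.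

(** At p the coordinate fields of the preferred chart are the standard basis and
    bracket with each other to zero, so all terms of the Cartan formulas become
    derivatives of components. *)
Lemma dorfman_flat p x y : smooth_section setT x -> smooth_section setT y ->
  dorfman x y p =
  flat (lrep (chart_at p) x) (lrep (chart_at p) y) (chart_map (chart_at p) p).
Proof.
move=> sx sy; set c := chart_at p; set u := chart_map c p.
have dp : chart_dom c p := mem_at p.
have ac : atlas c := atlas_at p.
have dx : differentiable (lrep c x) u := lrep_differentiable ac dp sx.
have dy : differentiable (lrep c y) u := lrep_differentiable ac dp sy.
have xp : lrep c x u = x p := lrep_at p x.
have yp : lrep c y u = y p := lrep_at p y.
have D1 (X : M -> 'rV[R]_n) z : differentiable (lrep c z) u ->
    lie_act X (lie_act (vecpart z) (chart_map c)) p = ('D_(X p) (lrep c z) u).1.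
  by move=> dz; have [_ <-] := is_derive_fst (X p) dz.
(* at p the coordinate fields are the basis, and near p they have constant
   components in the chart of p, whence D0 *)
have Zp j : coord_field c j p = e j by rewrite coord_fieldE; exact: tv_id.
have D0 (X : M -> 'rV[R]_n) j :
    lie_act X (lie_act (coord_field c j) (chart_map c)) p = 0.
  rewrite /lie_act (near_eq_derive (g := cst (e j))); first exact: derive_cst.
  apply: filterS (near_chart dp (near_dom dp)) => z [Iz dz _] /=.
  rewrite -/(tv (chart_at (chart_inv c z)) c (chart_inv c z) _) coord_fieldE.
  have a1 := atlas_at (chart_inv c z); have m1 := mem_at (chart_inv c z).
  by rewrite (tv_comp _ ac a1 ac dz m1 dz) (tv_id _ dz).
have LB z j : differentiable (lrep c z) u ->
    lie_bracket (vecpart z) (coord_field c j) p = - ('D_(e j) (lrep c z) u).1.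
  by move=> dz; rewrite /lie_bracket -/c D0 D1 // sub0r Zp.
have P1 (X : M -> 'rV[R]_n) z j : differentiable (lrep c z) u ->
    lie_act X (pair_fun (formpart z) (coord_field c j)) p =
    ('D_(X p) (lrep c z) u).2 0 j.
  move=> dz; rewrite -[RHS]/(gco (false, j) ('D_(X p) (lrep c z) u)).
  have [_ <-] := is_derive_gco (false, j) (X p) dz.
  rewrite /lie_act.
  have -> : pair_fun (formpart z) (coord_field c j) \o chart_inv (chart_at p) =
      gco (false, j) \o lrep c z.
    by apply/funext => w; rewrite [RHS]mxE.
  by [].
have P2 z w j : differentiable (lrep c z) u -> differentiable (lrep c w) u ->
    lie_act (coord_field c j) (pair_fun (formpart z) (vecpart w)) p =
    pairing (lrep c z u).2 ('D_(e j) (lrep c w) u).1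
    + pairing ('D_(e j) (lrep c z) u).2 (lrep c w u).1.
  move=> dz dw; rewrite /lie_act Zp; have [_ <-] := is_derive_pairing (e j) dz dw.
  apply: near_eq_derive; apply: filterS (near_chart dp (near_dom dp)) => v [Iv dv _].
  set q := chart_inv c v.
  rewrite -[RHS]/(pairing (gcomponents c z q).2 (gcomponents c w q).1).
  by rewrite !gcomponentsE (tr_pairing _ _ (atlas_at q) ac (mem_at q) dv).
have pairN a X : pairing a (- X) = - pairing a X :> R.
  by rewrite /pairing -sumrN; apply: eq_bigr => j _; rewrite mxE mulrN.
rewrite /dorfman /flat xp yp; congr (_, _).
  rewrite /= addr0 /lie_bracket -/c D1 // D1 //.
apply/rowP => j; rewrite !mxE /d_form /= -/c.
rewrite !P1 // !LB // P2 //.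
rewrite !pairN xp yp /ip mulrA mulfV ?pnatr_eq0 // mul1r /vecpart /formpart.
exact: dorfman_alg.
Qed.

End FlatAtChart.

(** * Chart independence of the coordinate formula *)

Section FlatLemmas.
(* conversion must not unfold the limits defining derivatives *)
#[local] Opaque derive derivable.
Context {R : realType} {n : nat}.
Implicit Types (f g : 'rV[R]_n -> gfiber R n) (u v z : 'rV[R]_n).
Let e (i : 'I_n) : 'rV[R]_n := delta_mx 0 i.

Lemma pairingDl (a b X : 'rV[R]_n) : pairing (a + b) X = pairing a X + pairing b X.
Proof. by rewrite /pairing -big_split; apply: eq_bigr => j _; rewrite mxE mulrDl. Qed.
Lemma pairingNl (a X : 'rV[R]_n) : pairing (- a) X = - pairing a X.
Proof. by rewrite /pairing -sumrN; apply: eq_bigr => j _; rewrite mxE mulNr. Qed.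
Lemma pairingDr (a X Y : 'rV[R]_n) : pairing a (X + Y) = pairing a X + pairing a Y.
Proof. by rewrite /pairing -big_split; apply: eq_bigr => j _; rewrite mxE mulrDr. Qed.
Lemma pairingNr (a X : 'rV[R]_n) : pairing a (- X) = - pairing a X.
Proof. by rewrite /pairing -sumrN; apply: eq_bigr => j _; rewrite mxE mulrN. Qed.
Lemma pairing_delta (a : 'rV[R]_n) j : pairing a (e j) = a 0 j.
Proof.
rewrite /pairing (bigD1 j) //= big1 => [|k kj].
  by rewrite mxE !eqxx mulr1 addr0.
by rewrite mxE eqxx (negbTE kj) mulr0.
Qed.

Lemma derive_sum_delta (W : normedModType R) (h : 'rV[R]_n -> W) u w :
  differentiable h u -> 'D_w h u = \sum_j w 0 j *: 'D_(e j) h u.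
Proof.
move=> dh; rewrite (deriveE _ dh) [in LHS](row_sum_delta w) linear_sum.
by apply: eq_bigr => j _; rewrite linearZ (deriveE _ dh).
Qed.

Lemma ipE2 (v w : gfiber R n) : 2 * ip v w = pairing v.2 w.1 + pairing w.2 v.1.
Proof. by rewrite /ip mulrA mulfV ?mul1r ?pnatr_eq0. Qed.

Lemma ip_sumZl (I : Type) (r : seq I) (k : I -> R) (F : I -> gfiber R n) w :
  ip (\sum_(i <- r) k i *: F i) w = \sum_(i <- r) k i * ip (F i) w.
Proof.
elim: r => [|i r IH].
  rewrite !big_nil /ip /pairing /= !big1 ?addr0 ?mulr0 // => j _.
    by rewrite mxE mulr0.
  by rewrite mxE mul0r.
rewrite !big_cons -IH; set s := \sum_(_ <- _) _.
rewrite /ip mulrCA -mulrDr; congr (_ * _).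
rewrite mulrDr /pairing !mulr_sumr -!big_split /=; apply: eq_bigr => j _.
by rewrite !mxE; ring.
Qed.

Lemma flat_pairing f g u z : differentiable f u ->
  pairing (flat f g u).2 z =
  pairing ('D_((f u).1) g u).2 z - pairing ('D_((g u).1) f u).2 z +
  2 * ip ('D_z f u) (g u).
Proof.
move=> df; rewrite /flat /= !pairingDl pairingNl; congr (_ + _).
rewrite (derive_sum_delta z df) ip_sumZl mulr_sumr /pairing; apply: eq_bigr => j _.
by rewrite mxE; ring.
Qed.

Lemma flat_fst f g u :
  (flat f g u).1 = ('D_((f u).1) g u).1 - ('D_((g u).1) f u).1.
Proof. exact: addr0. Qed.

Lemma is_derive_sumM m (F G : 'I_m -> 'rV[R]_n -> R^o) u v (dF dG : 'I_m -> R) :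
  (forall k, is_derive u v (F k) (dF k)) -> (forall k, is_derive u v (G k) (dG k)) ->
  is_derive u v (fun z => \sum_k F k z * G k z : R^o)
    (\sum_k (F k u * dG k + dF k * G k u)).
Proof.
move=> hF hG.
have -> : (fun z => \sum_k F k z * G k z : R^o) = \sum_k (F k * G k).
  by apply/funext => z; rewrite fct_sumE.
have D := is_derive_sum (fun k => is_deriveM (hF k) (hG k)).
apply: (is_derive_eq D); apply: eq_bigr => k _.
by congr (_ + _); exact: mulrC.
Qed.

End FlatLemmas.

Lemma sum_swap_sym (R : comRingType) n (a b A B : 'I_n -> R) (s : 'I_n -> 'I_n -> R) :
  (forall k, A k = \sum_l a l * s k l) -> (forall k, B k = \sum_l b l * s k l) ->
  (forall k l, s k l = s l k) -> \sum_k b k * A k = \sum_k a k * B k.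
Proof.
move=> hA hB ss; under eq_bigr do rewrite hA mulr_sumr.
under [RHS]eq_bigr do rewrite hB mulr_sumr.
rewrite exchange_big; apply: eq_bigr => l _; apply: eq_bigr => k _.
by rewrite mulrCA ss.
Qed.

(** The derivative of the transformation rule of a form, in coordinates: d stands
    for second derivatives of the change of coordinates and p for first ones. *)
Lemma pairing_trans_alg (R : comRingType) n (D a D' z Pz T : 'rV[R]_n)
    (d p : 'I_n -> 'I_n -> R) :
  (forall k, D' 0 k = \sum_i (a 0 i * d k i + D 0 i * p k i)) ->
  (forall i, Pz 0 i = \sum_k z 0 k * p k i) ->
  (forall i, T 0 i = \sum_k z 0 k * d k i) ->
  \sum_j D' 0 j * z 0 j = \sum_j D 0 j * Pz 0 j + \sum_j a 0 j * T 0 j.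
Proof.
move=> hD hP hT; under eq_bigr do rewrite hD mulr_suml.
rewrite exchange_big -big_split; apply: eq_bigr => i _ /=.
rewrite hP hT !mulr_sumr -big_split; apply: eq_bigr => k _ /=; ring.
Qed.

Lemma addr_sub_cancel (V : zmodType) (a b s t : V) :
  s = t -> a + s - (b + t) = a - b.
Proof. by move=> ->; rewrite opprD addrACA subrr addr0. Qed.

Lemma sub_of_add (V : zmodType) (a b t : V) : b = a + t -> a = b - t.
Proof. by move=> ->; rewrite addrK. Qed.

Lemma flat_pairing_alg (R : comRingType) (a b s t s' t' c d : R) :
  s = s' -> t = t' ->
  a + s - (b + t) + (c + t' + (d - s')) = a - b + (c + d).
Proof. by move=> -> ->; ring. Qed.

Section Equivariance.
#[local] Opaque derive derivable.
Context {R : realType} {n : nat} {M : manifold R n}.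
Implicit Types (x y : M -> gfiber R n).
Variables (c' c : chart R n M) (q : M).
Hypotheses (ac' : atlas c') (ac : atlas c) (dq' : chart_dom c' q) (dq : chart_dom c q).
Let e (i : 'I_n) : 'rV[R]_n := delta_mx 0 i.
Let phi := trans c' c.
Let u' := chart_map c' q.
Let u := chart_map c q.
Let P := tv c' c q.
Let A := chart_map c' @` (chart_dom c' `&` chart_dom c).

Let oA : open A. Proof. exact: trans_open. Qed.
Let Au' : A u'. Proof. exact: chart_img_mem. Qed.
Let sphi : smooth_on A phi. Proof. exact: trans_smooth. Qed.

Let pk (k i : 'I_n) : 'rV[R]_n -> R^o := fun z => ('D_(e k) phi z) 0 i.
Let spk k i : smooth_on A (pk k i).
Proof.
have := smooth_on_partial k sphi.
by move/(smooth_on_vector _ oA); apply.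
Qed.
Let dpk k i : differentiable (pk k i) u'.
Proof. exact: smooth_on_differentiable1 oA Au' (spk k i). Qed.

Let dd (w : 'rV[R]_n) (k i : 'I_n) : R := 'D_w (pk k i) u'.

Let dd_sum (w : 'rV[R]_n) k i : dd w k i = \sum_l w 0 l * dd (e l) k i.
Proof. exact: (derive_sum_delta w (dpk k i)). Qed.

(** The second derivative of the change of coordinates, as a bilinear map. *)
Definition transD2 (w z : 'rV[R]_n) : 'rV[R]_n :=
  \row_i \sum_k z 0 k * dd w k i.

Lemma transD2E w z i :
  transD2 w z 0 i = \sum_k z 0 k * dd w k i.
Proof. exact: (@mxE _ _ _ _ _ 0 i). Qed.

(** This is where the symmetry of second derivatives enters. *)
Lemma transD2C w z : transD2 w z = transD2 z w.
Proof.
apply/rowP => i.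
apply: etrans (transD2E w z i) _.
apply: etrans _ (esym (transD2E z w i)).
have sphii : smooth_on A (fun v => phi v 0 i : R^o).
  by move/(smooth_on_vector _ oA) : sphi; apply.
have pkE k v : A v -> pk k i v = 'D_(e k) (fun v => phi v 0 i : R^o) v.
  move=> Av; have D := derivableP (smooth_on_derivable (i := k) Av sphi).
  by have [_ ->] := is_derive_linear (g := vco i) (@vco_continuous _ _ i) D.
have sym k l : 'D_(e l) (pk k i) u' = 'D_(e k) (pk l i) u'.
  transitivity ('D_(e l) ('D_(e k) (fun v => phi v 0 i : R^o) : _ -> R^o) u').
    apply: near_eq_derive; apply: filterS (open_nbhs_nbhs (conj oA Au')) => v.
    exact: pkE.
  rewrite (smooth_on_derive_comm k l oA Au' sphii).
  apply: near_eq_derive; apply: filterS (open_nbhs_nbhs (conj oA Au')) => v Av.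
  by rewrite pkE.
apply: (sum_swap_sym (s := fun k l => dd (e l) k i)) => [k|k|k l]; exact: dd_sum || exact: sym.
Qed.

#[local] Opaque transD2.

Let near_A (Q : 'rV[R]_n -> Prop) : (forall v, A v -> Q v) -> \forall v \near u', Q v.
Proof. by move=> AQ; apply: filterS (open_nbhs_nbhs (conj oA Au')). Qed.

Let AP v : A v -> let q0 := chart_inv c' v in
  [/\ chart_dom c' q0, chart_dom c q0, chart_map c' q0 = v & chart_map c q0 = phi v].
Proof. by move=> /img_dom [d1 d2 d3]; split. Qed.

(** Representatives in two charts are related by the change of components at
    every point of the overlap, so the relation can be differentiated. *)
Lemma lrep_trans x v : A v -> let q0 := chart_inv c' v in
  lrep c x (phi v) = tr c' c q0 (lrep c' x v) /\
  lrep c' x v = tr c c' q0 (lrep c x (phi v)).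
Proof.
move=> Av; have [d1 d2 d3 d4] := AP Av; set q0 := chart_inv c' v.
have E1 : lrep c x (phi v) = gcomponents c x q0 by rewrite -d4 (lrepE _ d2).
have E2 : lrep c' x v = gcomponents c' x q0 by exact: erefl.
have a0 := atlas_at q0; have m0 := mem_at q0.
split; rewrite E1 E2 !gcomponentsE.
  by rewrite (tr_comp _ a0 ac' ac m0 d1 d2).
by rewrite (tr_comp _ a0 ac ac' m0 d2 d1).
Qed.

Lemma derive_lrep_trans x w : smooth_section setT x ->
  'D_w (lrep c x \o phi) u' = 'D_(P w) (lrep c x) u.
Proof.
move=> sx; apply: derive_comp_trans => //.
exact: lrep_differentiable.
Qed.

Lemma differentiable_lrep_trans x : smooth_section setT x ->
  differentiable (lrep c x \o phi) u'.
Proof.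
move=> sx; apply: differentiable_comp; first exact: trans_differentiable.
by rewrite /phi (transK _ dq'); exact: lrep_differentiable.
Qed.

Let dphi : differentiable phi u'.
Proof. exact: trans_differentiable. Qed.

Let P_coord v i : (P v) 0 i = \sum_k v 0 k * pk k i u'.
Proof.
have E : P v = \sum_k v 0 k *: 'D_(e k) phi u' := derive_sum_delta v dphi.
apply: etrans (congr1 (fun m : 'rV[R]_n => m 0 i) E) _.
by rewrite summxE; apply: eq_bigr => k _; exact: mxE.
Qed.

Let add_coord (a b : 'rV[R]_n) i : (a + b) 0 i = a 0 i + b 0 i.
Proof. exact: mxE. Qed.

(** Differentiating the transformation rule of vector fields produces a term with
    second derivatives of the change of coordinates. *)
Lemma derive_trans_fst x w : smooth_section setT x ->
  ('D_(P w) (lrep c x) u).1 =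
  P ('D_w (lrep c' x) u').1 + transD2 w (lrep c' x u').1.
Proof.
move=> sx; apply/rowP => i.
have dx' := lrep_differentiable ac' dq' sx.
have L1 := derive_lrep_trans w sx.
have L2 := is_derive_gco (true, i) w (differentiable_lrep_trans sx).
pose F k := gco (true, k) \o lrep c' x : 'rV[R]_n -> R^o.
have L3 : \forall v \near u', (gco (true, i) \o (lrep c x \o phi)) v =
   \sum_k F k v * pk k i v.
  apply: near_A => v Av.
  have [d1 d2 d3 d4] := AP Av; have [E _] := lrep_trans x Av.
  have dphiv : differentiable phi v by exact: smooth_on_differentiable oA Av sphi.
  rewrite -[LHS]/(gco (true, i) (lrep c x (phi v))) E.
  rewrite -[LHS]/((tv c' c (chart_inv c' v) (lrep c' x v).1) 0 i) /tv d3.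
  rewrite (derive_sum_delta _ dphiv) summxE.
  by apply: eq_bigr => k _; exact: mxE.
have L4 := is_derive_sumM (fun k => is_derive_gco (true, k) w dx')
  (fun k => derivableP (@diff_derivable _ _ _ _ _ w (dpk k i))).
have E := etrans (congr1 (gco (true, i)) (esym L1)) (etrans (esym (@derive_val _ _ _ _ _ _ _ L2))
  (etrans (near_eq_derive w L3) (@derive_val _ _ _ _ _ _ _ L4))).
apply: etrans E _; rewrite big_split /=.
apply: etrans (addrC _ _) _; apply: etrans _ (esym (add_coord _ _ i)).
congr (_ + _); last exact: esym (transD2E _ _ _).
exact: esym (P_coord _ _).
Qed.

(** The same for 1-forms, evaluated on a vector. *)
Lemma derive_trans_snd x w z : smooth_section setT x ->
  pairing ('D_w (lrep c' x) u').2 z =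
  pairing ('D_(P w) (lrep c x) u).2 (P z) +
  pairing (lrep c x u).2 (transD2 w z).
Proof.
move=> sx; have dx' := lrep_differentiable ac' dq' sx.
have phiu : phi u' = u by exact: (transK _ dq').
have key k : ('D_w (lrep c' x) u').2 0 k =
   \sum_i ((lrep c x u).2 0 i * dd w k i +
           ('D_(P w) (lrep c x) u).2 0 i * pk k i u').
  have L1 := derive_lrep_trans w sx.
  have L2 := is_derive_gco (false, k) w dx'.
  pose F i := gco (false, i) \o (lrep c x \o phi) : 'rV[R]_n -> R^o.
  have L3 : \forall v \near u', (gco (false, k) \o lrep c' x) v =
     \sum_i F i v * pk k i v.
    apply: near_A => v Av.
    have [d1 d2 d3 d4] := AP Av; have [_ E] := lrep_trans x Av.
    rewrite -[LHS]/(gco (false, k) (lrep c' x v)) E.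
    rewrite -[LHS]/((\row_j pairing (lrep c x (phi v)).2 (tv c' c (chart_inv c' v) (e j))) 0 k).
    by rewrite mxE /tv d3 /pairing.
  have L4 := is_derive_sumM
    (fun i => is_derive_gco (false, i) w (differentiable_lrep_trans sx))
    (fun i => derivableP (@diff_derivable _ _ _ _ _ w (dpk k i))).
  have E := etrans (esym (@derive_val _ _ _ _ _ _ _ L2))
    (etrans (near_eq_derive w L3) (@derive_val _ _ _ _ _ _ _ L4)).
  apply: etrans E _; rewrite L1; apply: eq_bigr => i _.
  by rewrite -[X in lrep c x X]phiu.
exact: (pairing_trans_alg key (P_coord z) (transD2E w z)).
Qed.

(** The change of components of forms involves the inverse of P; pulling the form of F
    back along P avoids it. *)
Lemma tr_charac (F W : gfiber R n) :
  F.1 = P W.1 -> (forall z, pairing W.2 z = pairing F.2 (P z)) -> F = tr c' c q W.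
Proof.
case: F W => [F1 F2] [W1 W2] /= -> h; congr (_, _); apply/rowP => j.
apply: etrans _ (esym (mxE _ _ _ _)).
apply: etrans _ (esym (h _)); rewrite /P (tv_comp _ ac ac' ac dq dq' dq).
by rewrite (tv_id _ dq) pairing_delta.
Qed.

(** The second-derivative terms cancel between the four derivatives, because the
    second derivative is symmetric; what remains transforms as a generalized
    vector. *)
Lemma flat_trans x y : smooth_section setT x -> smooth_section setT y ->
  flat (lrep c x) (lrep c y) u = tr c' c q (flat (lrep c' x) (lrep c' y) u').
Proof.
move=> sx sy.
have [d1 d2 d3 d4] := AP Au'.
have q0E : chart_inv c' u' = q by rewrite /u' chart_mapK.
have phiu : phi u' = u by rewrite /phi (transK _ dq').
have LP : linear P by exact: tvP.
have PB a b : P (a - b) = P a - P b.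
  by rewrite addrC -scaleN1r LP scaleN1r addrC.
have X1 s : (lrep c s u).1 = P (lrep c' s u').1.
  by have [E _] := lrep_trans s Au'; rewrite -phiu E q0E.
have X2 s z : pairing (lrep c' s u').2 z = pairing (lrep c s u).2 (P z).
  have [_ ->] := lrep_trans s Au'; rewrite q0E phiu /tr /=.
  exact: (pairing_linear _ _ LP).
have dx := lrep_differentiable ac dq sx.
have dx' := lrep_differentiable ac' dq' sx.
have D1 s t : smooth_section setT t ->
    ('D_((lrep c s u).1) (lrep c t) u).1 =
    P ('D_((lrep c' s u').1) (lrep c' t) u').1 + transD2 (lrep c' s u').1 (lrep c' t u').1.
  move=> st; exact: etrans (congr1 (fun X => ('D_X (lrep c t) u).1) (X1 s))
    (derive_trans_fst (lrep c' s u').1 st).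
have D2 s t z : smooth_section setT t ->
    pairing ('D_((lrep c' s u').1) (lrep c' t) u').2 z =
    pairing ('D_((lrep c s u).1) (lrep c t) u).2 (P z) +
    pairing (lrep c t u).2 (transD2 (lrep c' s u').1 z).
  move=> st; apply: etrans (derive_trans_snd (lrep c' s u').1 z st) _.
  exact: (congr1 (fun X => pairing ('D_X (lrep c t) u).2 (P z) +
    pairing (lrep c t u).2 (transD2 (lrep c' s u').1 z)) (esym (X1 s))).
have fst_eq : (flat (lrep c x) (lrep c y) u).1 = P (flat (lrep c' x) (lrep c' y) u').1.
  apply: etrans (flat_fst _ _ _) _.
  apply: etrans (congr2 (fun a b => a - b) (D1 x y sy) (D1 y x sx)) _.
  apply: etrans _ (congr1 P (esym (flat_fst _ _ _))).
  apply: etrans _ (esym (PB _ _)).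
  exact: (addr_sub_cancel _ _ (transD2C _ _)).
have snd_eq z : pairing (flat (lrep c' x) (lrep c' y) u').2 z =
    pairing (flat (lrep c x) (lrep c y) u).2 (P z).
  apply: etrans (flat_pairing _ z dx') _; apply: etrans _ (esym (flat_pairing _ (P z) dx)).
  (* the form part of the bracket, whose second-derivative terms match those of D2 *)
  have I1 : 2 * ip ('D_z (lrep c' x) u') (lrep c' y u') =
     (pairing ('D_(P z) (lrep c x) u).2 (lrep c y u).1 +
      pairing (lrep c x u).2 (transD2 z (lrep c' y u').1)) +
     (pairing (lrep c y u).2 ('D_(P z) (lrep c x) u).1 -
      pairing (lrep c y u).2 (transD2 z (lrep c' x u').1)).
    apply: etrans (ipE2 _ _) _; congr (_ + _).
      apply: etrans (derive_trans_snd z (lrep c' y u').1 sx) _.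
      exact: (congr1 (fun X => pairing ('D_(P z) (lrep c x) u).2 X +
        pairing (lrep c x u).2 (transD2 z (lrep c' y u').1)) (esym (X1 y))).
    apply: etrans (X2 y _) _; rewrite -pairingNr -pairingDr; congr (pairing _ _).
    exact: (sub_of_add (derive_trans_fst z sx)).
  apply: etrans (congr2 (fun a b => a + b)
    (congr2 (fun a b => a - b) (D2 x y z sy) (D2 y x z sx)) I1) _.
  apply: etrans _ (congr1 (fun t => _ + t) (esym (ipE2 _ _))).
  exact: (flat_pairing_alg _ _ _ _
    (congr1 (pairing (lrep c y u).2) (transD2C (lrep c' x u').1 z))
    (congr1 (pairing (lrep c x u).2) (transD2C (lrep c' y u').1 z))).
exact: tr_charac fst_eq snd_eq.
Qed.

End Equivariance.

(** * Smoothness of the Dorfman bracket *)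

Section DorfmanSmooth.
#[local] Opaque derive derivable.
Context {R : realType} {n : nat}.
Implicit Types (A : set 'rV[R]_n) (F G : 'rV[R]_n -> gfiber R n).
Let e (i : 'I_n) : 'rV[R]_n := delta_mx 0 i.

Lemma smooth_on_directional A F G : open A -> smooth_on A F -> smooth_on A G ->
  smooth_on A (fun u => 'D_((F u).1) G u).
Proof.
move=> oA sF sG.
have sF' j : smooth_on A (fun u => gco (true, j) (F u)).
  by move/(smooth_on_gfiber _ oA) : sF; apply.
have := smooth_on_sum (index_enum 'I_n) oA (fun j => smooth_onZ oA (sF' j) (smooth_on_partial j sG)).
apply: (smooth_on_ext oA) => u Au.
exact: esym (derive_sum_delta _ (smooth_on_gdifferentiable oA Au sG)).
Qed.

Lemma smooth_on_flat A F G : open A -> smooth_on A F -> smooth_on A G ->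
  smooth_on A (flat F G).
Proof.
move=> oA sF sG.
have s1 := smooth_on_directional oA sF sG.
have s2 := smooth_on_directional oA sG sF.
have s3 : smooth_on A (fun u => (0, \row_j (2 * ip ('D_(e j) F u) (G u))) : gfiber R n).
  apply/(smooth_on_gfiber _ oA) => -[[] j].
    have : smooth_on A (fun _ => 0 : R^o) by exact: smooth_on_cst.
    by apply: (smooth_on_ext oA) => u _; rewrite /gco /= mxE.
  have := smooth_onM oA (@smooth_on_cst _ _ A _ (2 : R^o))
    (smooth_on_ip oA (smooth_on_partial j sF) sG).
  by apply: (smooth_on_ext oA) => u _; rewrite /gco /= mxE.
have := smooth_onD oA (smooth_onD oA s1 (smooth_onZ oA (@smooth_on_cst _ _ A _ (-1 : R^o)) s2)) s3.
apply: (smooth_on_ext oA) => u _.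
by rewrite /flat scaleN1r.
Qed.

End DorfmanSmooth.

Section Dorfman.
#[local] Opaque derive derivable.
Context {R : realType} {n : nat} {M : manifold R n}.
Implicit Types (c : chart R n M) (p q : M) (x y : M -> gfiber R n).

(** The bracket is defined at q through the preferred chart of q, which varies with
    q without any regularity; by chart independence a single chart c computes it
    on the whole domain of c. *)
Lemma gcomponents_dorfman c q x y : atlas c -> chart_dom c q ->
  smooth_section setT x -> smooth_section setT y ->
  gcomponents c (dorfman x y) q = flat (lrep c x) (lrep c y) (chart_map c q).
Proof.
move=> ac dq sx sy; rewrite gcomponentsE (dorfman_flat q sx sy).
exact: esym (flat_trans (atlas_at q) ac (mem_at q) dq sx sy).
Qed.

Lemma dorfman_smooth x y : smooth_section setT x -> smooth_section setT y ->
  smooth_section setT (dorfman x y).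
Proof.
move=> sx sy c ac; have oI : open (chart_map c @` chart_dom c).
  exact: (@open_chart_img _ _ _ c).
rewrite setIT; have := smooth_on_flat oI (lrep_smooth ac sx) (lrep_smooth ac sy).
apply: (smooth_on_ext oI) => u [q dq <-].
by rewrite /= chart_mapK // (gcomponents_dorfman ac dq sx sy).
Qed.

End Dorfman.

(** * Inner products and derivatives in the preferred chart *)

Section Bilinear.
Context {K : fieldType} {n : nat}.
Implicit Types (u v w : gfiber K n) (a b X Y : 'rV[K]_n).

Lemma pairing_linl a b X k : pairing (k *: a + b) X = k * pairing a X + pairing b X.
Proof.
rewrite /pairing mulr_sumr -big_split; apply: eq_bigr => j _ /=.
by rewrite !mxE mulrDl mulrA.
Qed.
Lemma pairing_linr a X Y k : pairing a (k *: X + Y) = k * pairing a X + pairing a Y.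
Proof.
rewrite /pairing mulr_sumr -big_split; apply: eq_bigr => j _ /=.
by rewrite !mxE mulrDr mulrCA.
Qed.
Lemma ipC u v : ip u v = ip v u. Proof. by rewrite /ip addrC. Qed.
Lemma ip_linl u v w k : ip (k *: u + v) w = k * ip u w + ip v w.
Proof. by rewrite /ip /= pairing_linl pairing_linr; ring. Qed.
Lemma ip_linr u v w k : ip w (k *: u + v) = k * ip w u + ip w v.
Proof. by rewrite !(ipC w) ip_linl. Qed.
Lemma ipDl u v w : ip (u + v) w = ip u w + ip v w.
Proof. by have := ip_linl u v w 1; rewrite scale1r mul1r. Qed.
Lemma ip0l w : ip 0 w = 0.
Proof. by have := ip_linl 0 0 w (-1); rewrite scaler0 addr0 mulN1r addNr. Qed.
Lemma ipZl k u w : ip (k *: u) w = k * ip u w.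
Proof. by have := ip_linl u 0 w k; rewrite !addr0 ip0l addr0. Qed.
Lemma ipNl u w : ip (- u) w = - ip u w.
Proof. by rewrite -scaleN1r ipZl mulN1r. Qed.
Lemma ipBl u v w : ip (u - v) w = ip u w - ip v w.
Proof. by rewrite ipDl ipNl. Qed.
Lemma ipDr u v w : ip w (u + v) = ip w u + ip w v.
Proof. by rewrite !(ipC w) ipDl. Qed.
Lemma ip0r w : ip w 0 = 0. Proof. by rewrite ipC ip0l. Qed.
Lemma ipZr k u w : ip w (k *: u) = k * ip w u.
Proof. by rewrite !(ipC w) ipZl. Qed.
Lemma ipNr u w : ip w (- u) = - ip w u.
Proof. by rewrite !(ipC w) ipNl. Qed.

End Bilinear.

Section ExtendedBilinear.
Context {R : realType} {n : nat}.
Implicit Types (u v w : efiber R n).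

Lemma eipC u v : eip u v = eip v u.
Proof. by rewrite /eip ipC; congr (_ + _ * _); rewrite addrC. Qed.
Lemma eip_linl u v w k : eip (k *: u + v) w = k * eip u w + eip v w.
Proof.
rewrite /eip /= ip_linl.
have -> : (k *: u.2.1 : R^o) = k * u.2.1 by [].
have -> : (k *: u.2.2 : R^o) = k * u.2.2 by [].
ring.
Qed.
Lemma eipDl u v w : eip (u + v) w = eip u w + eip v w.
Proof. by have := eip_linl u v w 1; rewrite scale1r mul1r. Qed.
Lemma eip0l w : eip 0 w = 0.
Proof. by have := eip_linl 0 0 w (-1); rewrite scaler0 addr0 mulN1r addNr. Qed.
Lemma eipZl k u w : eip (k *: u) w = k * eip u w.
Proof. by have := eip_linl u 0 w k; rewrite !addr0 eip0l addr0. Qed.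
Lemma eipNl u w : eip (- u) w = - eip u w.
Proof. by rewrite -scaleN1r eipZl mulN1r. Qed.
Lemma eipBl u v w : eip (u - v) w = eip u w - eip v w.
Proof. by rewrite eipDl eipNl. Qed.
Lemma eipDr u v w : eip w (u + v) = eip w u + eip w v.
Proof. by rewrite !(eipC w) eipDl. Qed.
Lemma eipZr k u w : eip w (k *: u) = k * eip w u.
Proof. by rewrite !(eipC w) eipZl. Qed.
Lemma eipNr u w : eip w (- u) = - eip w u.
Proof. by rewrite !(eipC w) eipNl. Qed.

(** The inclusion of 1-forms of M. *)
Definition cofm (a : 'rV[R]_n) : efiber R n := ((0, a), (0, 0)).
Lemma cofmP k a b : cofm (k *: a + b) = k *: cofm a + cofm b.
Proof.
rewrite /cofm; congr ((_, _), (_, _)); rewrite /= ?scaler0 ?addr0 //.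
Qed.
Lemma eip_cofm a w : 2 * eip (cofm a) w = pairing a w.1.1.
Proof.
rewrite /eip /cofm /ip /= mul0r mulr0 addr0 mulr0 addr0 mulrA mulfV ?pnatr_eq0 //.
by rewrite mul1r /pairing [X in _ + X]big1 ?addr0 // => j _; rewrite mxE mulr0.
Qed.

End ExtendedBilinear.

Section Courant.
#[local] Opaque derive derivable.
Context {R : realType} {n : nat} {M : manifold R n}.
Implicit Types (p q : M) (X Y Z : M -> efiber R n) (f g : M -> R) (v w : 'rV[R]_n)
  (x y : M -> gfiber R n).
Let e (i : 'I_n) : 'rV[R]_n := delta_mx 0 i.

(** The derivative of f at p along the vector with components v in the preferred
    chart of p. *)
Definition dfun p f v : R :=
  'D_v (f \o chart_inv (chart_at p) : _ -> R^o) (chart_map (chart_at p) p).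
(** The derivative of the components of a section in the preferred chart of p: unlike
    [dfun], it depends on the chart. *)
Definition dsec p x v : gfiber R n :=
  'D_v (lrep (chart_at p) x) (chart_map (chart_at p) p).
Definition desec p X v : efiber R n :=
  (dsec p (gpart X) v, (dfun p (dt_vec X) v : R^o, dfun p (dt_form X) v : R^o)).

Lemma smooth_fun_differentiable p f : smooth_fun setT f ->
  differentiable (f \o chart_inv (chart_at p) : _ -> R^o) (chart_map (chart_at p) p).
Proof.
move=> /(_ _ (atlas_at p)) sf; apply: smooth_on_differentiable1 sf.
  exact: (chart_img_open _ openT).
by apply: chart_img_mem; [exact: mem_at|].
Qed.

Lemma dsec_differentiable p x : smooth_section setT x ->
  differentiable (lrep (chart_at p) x) (chart_map (chart_at p) p).
Proof. exact: (lrep_differentiable (atlas_at p) (mem_at p)). Qed.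

Lemma dfun_lin p f k v w : smooth_fun setT f ->
  dfun p f (k *: v + w) = k * dfun p f v + dfun p f w.
Proof.
by move=> /(smooth_fun_differentiable p) df; rewrite /dfun !(deriveE _ df) linearP.
Qed.

Lemma dsec_lin p x k v w : smooth_section setT x ->
  dsec p x (k *: v + w) = k *: dsec p x v + dsec p x w.
Proof.
by move=> /(dsec_differentiable p) df; rewrite /dsec !(deriveE _ df) linearP.
Qed.

Lemma dfunD p f g v : smooth_fun setT f -> smooth_fun setT g ->
  dfun p (fun q => f q + g q) v = dfun p f v + dfun p g v.
Proof.
move=> /(smooth_fun_differentiable p) df /(smooth_fun_differentiable p) dg.
exact: deriveD (diff_derivable df) (diff_derivable dg).
Qed.

Lemma dfunM p f g v : smooth_fun setT f -> smooth_fun setT g ->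
  dfun p (fun q => f q * g q) v = f p * dfun p g v + g p * dfun p f v.
Proof.
move=> /(smooth_fun_differentiable p) df /(smooth_fun_differentiable p) dg.
apply: etrans (deriveM (@diff_derivable _ _ _ _ _ v df) (@diff_derivable _ _ _ _ _ v dg)) _.
by rewrite /= (chart_mapK (mem_at p)).
Qed.

Lemma dfun_cst p k v : dfun p (fun _ => k) v = 0.
Proof. exact: derive_cst. Qed.

Lemma near_dfun p f g v : (\forall q \near p, f q = g q) -> dfun p f v = dfun p g v.
Proof.
move=> fg; apply: near_eq_derive.
by apply: filterS (near_chart (mem_at p) fg) => u [].
Qed.

Lemma dsecD p x y v : smooth_section setT x -> smooth_section setT y ->
  dsec p (fun q => x q + y q) v = dsec p x v + dsec p y v.
Proof.
move=> /(dsec_differentiable p) dx /(dsec_differentiable p) dy.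
apply: etrans _ (deriveD (@diff_derivable _ _ _ _ _ v dx) (@diff_derivable _ _ _ _ _ v dy)).
apply: near_eq_derive; apply: filterS (near_chart (mem_at p) (near_dom (mem_at p))) => u [_ du _].
have := @gcomponentsP _ _ _ _ _ 1 1 x y (fun q => x q + y q) (atlas_at p) du.
by rewrite !scale1r; apply.
Qed.

Lemma dsecZ p f x v : smooth_fun setT f -> smooth_section setT x ->
  dsec p (fun q => f q *: x q) v = f p *: dsec p x v + dfun p f v *: x p.
Proof.
move=> sf sx; have df := smooth_fun_differentiable p sf.
have dx := dsec_differentiable p sx.
set c := chart_at p; set u := chart_map c p.
apply: gco_inj => i.
have near_eq : \forall z \near u, (gco i \o lrep c (fun q => f q *: x q)) z =
   ((f \o chart_inv c : _ -> R^o) * (gco i \o lrep c x)) z.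
  apply: filterS (near_chart (mem_at p) (near_dom (mem_at p))) => z [_ dz _].
  have := @gcomponentsP _ _ _ _ _ (f (chart_inv c z)) 0 x x (fun q => f q *: x q) (atlas_at p) dz.
  rewrite !scale0r !addr0 => /(_ erefl) E.
  by apply: etrans (congr1 (gco i) E) _; rewrite linearZ.
have D1 : is_derive u v (gco i \o lrep c (fun q => f q *: x q))
    (f p * gco i (dsec p x v) + gco i (x p) * dfun p f v).
  apply: near_eq_is_derive (_ : is_derive u v ((f \o chart_inv c : _ -> R^o) * (gco i \o lrep c x)) _).
    by apply: filterS near_eq => z ->.
  apply: is_derive_eq.
    apply: is_deriveM; last exact: is_derive_gco.
    exact: derivableP (@diff_derivable _ _ _ _ _ v df).
  by rewrite /= (chart_mapK (mem_at p)) lrep_at.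
have sfx := smooth_sectionZ openT sf sx.
have D2 := is_derive_gco i v (dsec_differentiable p sfx).
apply: etrans (etrans (esym (@derive_val _ _ _ _ _ _ _ D2)) (@derive_val _ _ _ _ _ _ _ D1)) _.
rewrite linearD !linearZ; congr (_ + _); exact: mulrC.
Qed.

Lemma dfun_ip p x y v : smooth_section setT x -> smooth_section setT y ->
  dfun p (fun q => ip (x q) (y q)) v = ip (dsec p x v) (y p) + ip (x p) (dsec p y v).
Proof.
move=> /(dsec_differentiable p) dx /(dsec_differentiable p) dy.
apply: etrans _ (etrans (@derive_val _ _ _ _ _ _ _ (is_derive_ip v dx dy)) _).
  apply: near_eq_derive; apply: filterS (near_chart (mem_at p) (near_dom (mem_at p))) => u [_ du _].
  exact: esym (gcomponents_ip _ _ (atlas_at p) du).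
by rewrite !lrep_at addrC.
Qed.

Lemma dfun_lie_act p (X : M -> 'rV[R]_n) f : lie_act X (f : M -> R^o) p = dfun p f (X p).
Proof. by []. Qed.

Lemma coord_field_at p j : coord_field (chart_at p) j p = e j.
Proof. by rewrite coord_fieldE; apply: tv_id; exact: mem_at. Qed.

Lemma d_funE p f : d_fun f p = \row_j dfun p f (e j).
Proof. by apply/rowP => j; rewrite !mxE dfun_lie_act coord_field_at. Qed.

Lemma dfun_sum p f v : smooth_fun setT f ->
  dfun p f v = \sum_j v 0 j * dfun p f (e j).
Proof. by move=> /(smooth_fun_differentiable p) df; exact: derive_sum_delta df. Qed.

Lemma pairing_d_fun p f v : smooth_fun setT f -> pairing (d_fun f p) v = dfun p f v.
Proof.
move=> sf; rewrite d_funE (dfun_sum p v sf); apply: eq_bigr => j _.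
by rewrite mxE mulrC.
Qed.

Lemma desec_lin p X k v w : smooth_esection setT X ->
  desec p X (k *: v + w) = k *: desec p X v + desec p X w.
Proof.
by case=> s1 s2 s3; rewrite /desec (dsec_lin p k v w s1) (dfun_lin p k v w s2) (dfun_lin p k v w s3).
Qed.

Lemma desecD p X Y v : smooth_esection setT X -> smooth_esection setT Y ->
  desec p (fun q => X q + Y q) v = desec p X v + desec p Y v.
Proof.
case=> s1 s2 s3 [t1 t2 t3].
exact: (congr2 pair (dsecD p v s1 t1) (congr2 pair (dfunD p v s2 t2) (dfunD p v s3 t3))).
Qed.

Lemma desecZ p f X v : smooth_fun setT f -> smooth_esection setT X ->
  desec p (fun q => f q *: X q) v = f p *: desec p X v + dfun p f v *: X p.
Proof.
move=> sf [s1 s2 s3].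
have C g : smooth_fun setT g ->
    dfun p (fun q => f q * g q) v = f p * dfun p g v + dfun p f v * g p.
  by move=> sg; rewrite (dfunM p v sf sg) [X in _ + X]mulrC.
exact: (congr2 pair (dsecZ p v sf s1) (congr2 pair (C _ s2) (C _ s3))).
Qed.

Lemma smooth_fun_eip X Y : smooth_esection setT X -> smooth_esection setT Y ->
  smooth_fun setT (fun q => eip (X q) (Y q)).
Proof.
case=> s1 s2 s3 [t1 t2 t3]; have h := @smooth_fun_cst _ _ M setT 2^-1.
have a := smooth_funM openT s2 t3; have b := smooth_funM openT t2 s3.
exact: (smooth_funD openT (smooth_fun_ip openT s1 t1)
  (smooth_funM openT h (smooth_funD openT a b))).
Qed.

Lemma dfun_eip p X Y v : smooth_esection setT X -> smooth_esection setT Y ->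
  dfun p (fun q => eip (X q) (Y q)) v = eip (desec p X v) (Y p) + eip (X p) (desec p Y v).
Proof.
case=> s1 s2 s3 [t1 t2 t3]; have h := @smooth_fun_cst _ _ M setT 2^-1.
have a := smooth_funM openT s2 t3; have b := smooth_funM openT t2 s3.
apply: etrans (dfunD p v (smooth_fun_ip openT s1 t1)
  (smooth_funM openT h (smooth_funD openT a b))) _.
rewrite (dfun_ip p v s1 t1) (dfunM p v h (smooth_funD openT a b)) dfun_cst.
rewrite (dfunD p v a b) (dfunM p v s2 t3) (dfunM p v t2 s3).
by rewrite /eip /desec /gpart /dt_vec /dt_form /=; ring.
Qed.

(** All terms of the bracket are derivatives of components in one chart; the
    Courant algebroid identities then only use bilinearity and the Leibniz rule. *)
Lemma ebracketE p X Y : smooth_esection setT X -> smooth_esection setT Y ->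
  ebracket X Y p = desec p Y (X p).1.1 - desec p X (Y p).1.1 +
    cofm (\row_j (2 * eip (desec p X (e j)) (Y p))).
Proof.
case=> s1 s2 s3 [t1 t2 t3]; rewrite /ebracket (dorfman_flat p s1 t1) /flat !lrep_at.
rewrite [RHS]surjective_pairing; congr (_, _); last first.
  by rewrite !dfun_lie_act [RHS]surjective_pairing /= !addr0.
rewrite /= -addrA; congr (_ + _).
rewrite [LHS]surjective_pairing /= addr0; congr (_, _); apply/rowP => j.
rewrite !mxE !dfun_lie_act coord_field_at /eip /desec /= mulrDr; congr (_ + _).
by rewrite mulrA mulfV ?pnatr_eq0 // mul1r; congr (_ + _); exact: mulrC.
Qed.

End Courant.

(** * Courant algebroid identities on the restricted cone *)

Section ModuleIdentities.
Context {R : pzRingType} {V : lmodType R}.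
Implicit Types a b c d k l t s : V.
Lemma algD a b c d k l : a + b - (c + d) + (k + l) = a - c + k + (b - d + l).
Proof. by rewrite opprD (AC ((2*2)*2) ((1*3*5)*(2*4*6))). Qed.
Lemma algZr (f : R) a c k t : f *: a + t - f *: c + f *: k = f *: (a - c + k) + t.
Proof. by rewrite !scalerDr scalerN (AC (((2*1)*1)) ((1*3*4)*2)). Qed.
Lemma algZl (f : R) a c k t s :
  f *: a - (f *: c + t) + (f *: k + s) = f *: (a - c + k) - t + s.
Proof. by rewrite !scalerDr scalerN opprD (AC ((1*2)*2) ((1*2*4)*3*5)). Qed.
Lemma algsym a c k l t : l + k = t -> c - a + k = - (a - c + l) + t.
Proof.
move=> <-; rewrite !opprD opprK.
by rewrite [RHS](AC (3*2) (2*1*5*(3*4))) /= addNr addr0.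
Qed.
End ModuleIdentities.

Lemma alginv (R : comRingType) (a b c d b' : R) : b = b' ->
  a + b = a - c + d + (b' - d + c).
Proof. by move=> ->; ring. Qed.

Section CourantIdentities.
Context {R : realType} {n : nat} {M : manifold R n}.
Implicit Types (p q : M) (X Y Z : M -> efiber R n) (f g : M -> R) (v w : 'rV[R]_n).
Let e (i : 'I_n) : 'rV[R]_n := delta_mx 0 i.
Local Notation smooth := (smooth_esection setT).
#[local] Opaque desec dfun ebracket d_fun.

Lemma smooth_esectionD X Y : smooth X -> smooth Y -> smooth (fun q => X q + Y q).
Proof.
case=> s1 s2 s3 [t1 t2 t3]; split.
- exact: (smooth_sectionD openT s1 t1).
- exact: (smooth_funD openT s2 t2).
- exact: (smooth_funD openT s3 t3).
Qed.

Lemma smooth_esectionZ f X : smooth_fun setT f -> smooth X -> smooth (fun q => f q *: X q).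
Proof.
move=> sf [s1 s2 s3]; split.
- exact: (smooth_sectionZ openT sf s1).
- exact: (smooth_funM openT sf s2).
- exact: (smooth_funM openT sf s3).
Qed.

Lemma cofmD (a b : 'rV[R]_n) : cofm (a + b) = cofm a + cofm b.
Proof. by have := cofmP 1 a b; rewrite !scale1r. Qed.
Lemma cofm0 : cofm (0 : 'rV[R]_n) = 0. Proof. by []. Qed.
Lemma cofmZ k (a : 'rV[R]_n) : cofm (k *: a) = k *: cofm a.
Proof. by have := cofmP k a 0; rewrite cofm0 !addr0. Qed.

Lemma desec0v p X : smooth X -> desec p X 0 = 0.
Proof.
by move=> sX; have := desec_lin p (-1) 0 0 sX; rewrite scaler0 addr0 scaleN1r addNr.
Qed.
Lemma desecDv p X v w : smooth X -> desec p X (v + w) = desec p X v + desec p X w.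
Proof. by move=> sX; have := desec_lin p 1 v w sX; rewrite !scale1r. Qed.
Lemma desecZv p X k v : smooth X -> desec p X (k *: v) = k *: desec p X v.
Proof. by move=> sX; have := desec_lin p k v 0 sX; rewrite desec0v // !addr0. Qed.

Let K p X (w : efiber R n) := \row_j (2 * eip (desec p X (e j)) w).

Let KDr p X (w1 w2 : efiber R n) : K p X (w1 + w2) = K p X w1 + K p X w2.
Proof. by apply/rowP => j; rewrite !mxE eipDr mulrDr. Qed.
Let KZr p X k (w : efiber R n) : K p X (k *: w) = k *: K p X w.
Proof. by apply/rowP => j; rewrite !mxE eipZr mulrCA. Qed.
Let KDl p X Y (w : efiber R n) : smooth X -> smooth Y ->
  K p (fun q => X q + Y q) w = K p X w + K p Y w.
Proof.
move=> sX sY; apply/rowP => j; rewrite !mxE (desecD p (e j) sX sY) eipDl; exact: mulrDr.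
Qed.
Let KZl p f X (w : efiber R n) : smooth_fun setT f -> smooth X ->
  K p (fun q => f q *: X q) w = f p *: K p X w + (2 * eip (X p) w) *: d_fun f p.
Proof.
move=> sf sX; rewrite d_funE; apply/rowP => j.
rewrite !mxE (desecZ p (e j) sf sX) eip_linl eipZl.
by ring.
Qed.

Let ebrE p X Y : smooth X -> smooth Y -> ebracket X Y p =
  desec p Y (X p).1.1 - desec p X (Y p).1.1 + cofm (K p X (Y p)).
Proof. exact: ebracketE. Qed.

Lemma ebrDr p X Y Z : smooth X -> smooth Y -> smooth Z ->
  ebracket X (fun q => Y q + Z q) p = ebracket X Y p + ebracket X Z p.
Proof.
move=> sX sY sZ; have sYZ := smooth_esectionD sY sZ.
rewrite (ebrE p sX sYZ) (ebrE p sX sY) (ebrE p sX sZ) (desecD p _ sY sZ) /=.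
by rewrite (desecDv p _ _ sX) KDr cofmD; exact: algD.
Qed.

Lemma ebrDl p X Y Z : smooth X -> smooth Y -> smooth Z ->
  ebracket (fun q => X q + Y q) Z p = ebracket X Z p + ebracket Y Z p.
Proof.
move=> sX sY sZ; have sXY := smooth_esectionD sX sY.
rewrite (ebrE p sXY sZ) (ebrE p sX sZ) (ebrE p sY sZ) (desecD p _ sX sY) /=.
by rewrite (desecDv p _ _ sZ) (KDl p _ sX sY) cofmD; exact: algD.
Qed.

Lemma ebrZr p f X Y : smooth_fun setT f -> smooth X -> smooth Y ->
  ebracket X (fun q => f q *: Y q) p =
  f p *: ebracket X Y p + dfun p f (X p).1.1 *: Y p.
Proof.
move=> sf sX sY; have sfY := smooth_esectionZ sf sY.
rewrite (ebrE p sX sfY) (ebrE p sX sY) (desecZ p _ sf sY) /=.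
by rewrite (desecZv p _ _ sX) KZr cofmZ; exact: algZr.
Qed.

Lemma ebrZl p f X Y : smooth_fun setT f -> smooth X -> smooth Y ->
  ebracket (fun q => f q *: X q) Y p =
  f p *: ebracket X Y p - dfun p f (Y p).1.1 *: X p +
  (2 * eip (X p) (Y p)) *: cofm (d_fun f p).
Proof.
move=> sf sX sY; have sfX := smooth_esectionZ sf sX.
rewrite (ebrE p sfX sY) (ebrE p sX sY) (desecZ p _ sf sX) /=.
by rewrite (desecZv p _ _ sY) (KZl p _ sf sX) cofmD !cofmZ; exact: algZl.
Qed.

Lemma ebr_sym p X Y : smooth X -> smooth Y ->
  ebracket Y X p = - ebracket X Y p +
    2 *: cofm (d_fun (fun q => eip (X q) (Y q)) p).
Proof.
move=> sX sY; rewrite (ebrE p sX sY) (ebrE p sY sX).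
apply: algsym; rewrite -cofmD -cofmZ; congr cofm.
rewrite d_funE; apply/rowP => j; rewrite !mxE (dfun_eip p _ sX sY).
rewrite [eip (X p) _]eipC; exact: esym (mulrDr _ _ _).
Qed.

Let K_pair p X (w : efiber R n) v : smooth X -> pairing (K p X w) v = 2 * eip (desec p X v) w.
Proof.
move=> sX; have E m (r : seq 'I_m) (k : 'I_m -> R) (F : 'I_m -> 'rV[R]_n) :
    desec p X (\sum_(j <- r) k j *: F j) = \sum_(j <- r) k j *: desec p X (F j).
  elim: r => [|j r IH]; first by rewrite !big_nil desec0v.
  by rewrite !big_cons -IH (desec_lin p _ _ _ sX).
rewrite [v in RHS](row_sum_delta v) E /pairing.
have F m (r : seq 'I_m) (k : 'I_m -> R) (G : 'I_m -> efiber R n) :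
    eip (\sum_(j <- r) k j *: G j) w = \sum_(j <- r) k j * eip (G j) w.
  elim: r => [|j r IH]; first by rewrite !big_nil eip0l.
  by rewrite !big_cons -IH eip_linl.
rewrite F mulr_sumr; apply: eq_bigr => j _.
by rewrite mxE; ring.
Qed.

Lemma ebr_inv p X Y Z : smooth X -> smooth Y -> smooth Z ->
  dfun p (fun q => eip (Y q) (Z q)) (X p).1.1 =
  eip (ebracket X Y p) (Z p) + eip (Y p) (ebracket X Z p).
Proof.
move=> sX sY sZ; rewrite (dfun_eip p _ sY sZ) (ebrE p sX sY) (ebrE p sX sZ).
rewrite [eip (Y p) (_ + cofm _)]eipC !(eipDl _ (cofm _)).
have two : (2 : R) != 0 by rewrite pnatr_eq0.
have C (w W : efiber R n) : eip (cofm (K p X w)) W = eip (desec p X W.1.1) w.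
  by apply: (mulfI two); rewrite eip_cofm (K_pair p _ _ sX).
rewrite !C !eipBl.
exact: (alginv _ _ _ (eipC _ _)).
Qed.

End CourantIdentities.

(** * Courant algebroid identities for the Dorfman bracket *)

Section DorfmanIdentities.
Context {R : realType} {n : nat} {M : manifold R n}.
Implicit Types (p q : M) (X Y Z : M -> efiber R n) (f g : M -> R)
  (x y z : M -> gfiber R n).
Local Notation esmooth := (smooth_esection setT).
Local Notation smooth := (smooth_section setT).
#[local] Opaque dfun d_fun.

(** Embedding sections of TM + T^*M in E'(M) turns the identities of the cone bracket
    into those of the Dorfman bracket. *)
Definition emb x : M -> efiber R n := fun q => (x q, (0, 0)).

Lemma emb_smooth x : smooth x -> esmooth (emb x).
Proof. by move=> sx; split; [exact: sx|exact: smooth_fun_cst|exact: smooth_fun_cst]. Qed.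

Lemma const_smooth (r : R^o * R^o) : esmooth (fun _ : M => (0, r) : efiber R n).
Proof.
by split; [exact: (smooth_section0 openT)|exact: smooth_fun_cst|exact: smooth_fun_cst].
Qed.

Lemma ebracket_emb x y p : ebracket (emb x) (emb y) p = (dorfman x y p, (0, 0)).
Proof.
rewrite /ebracket !dfun_lie_act [LHS]surjective_pairing /= !dfun_cst subr0.
congr (_, _); rewrite /emb /dt_form /dt_vec /= !scale0r addr0.
exact: addr0.
Qed.

Lemma dorfmanE x y p : dorfman x y p = (ebracket (emb x) (emb y) p).1.
Proof. by rewrite ebracket_emb. Qed.

Lemma embD x y : emb (fun q => x q + y q) = (fun q => emb x q + emb y q).
Proof.
apply/funext => q; transitivity (x q + y q, ((0 + 0 : R^o), (0 + 0 : R^o))) => //.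
by rewrite addr0.
Qed.

Lemma embZ f x : emb (fun q => f q *: x q) = (fun q => f q *: emb x q).
Proof.
apply/funext => q; transitivity (f q *: x q, (f q *: (0 : R^o), f q *: (0 : R^o))) => //.
by rewrite scaler0.
Qed.

Lemma eip_pair (a b : gfiber R n) : eip (a, (0, 0)) (b, (0, 0)) = ip a b.
Proof. by rewrite /eip /= !mul0r addr0 mulr0 addr0. Qed.

Lemma eip_emb x y p : eip (emb x p) (emb y p) = ip (x p) (y p).
Proof. by rewrite /eip /= !mul0r addr0 mulr0 addr0. Qed.

Lemma dorDr p x y z : smooth x -> smooth y -> smooth z ->
  dorfman x (fun q => y q + z q) p = dorfman x y p + dorfman x z p.
Proof.
move=> sx sy sz; rewrite !dorfmanE embD.
by rewrite (ebrDr p (emb_smooth sx) (emb_smooth sy) (emb_smooth sz)).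
Qed.

Lemma dorDl p x y z : smooth x -> smooth y -> smooth z ->
  dorfman (fun q => x q + y q) z p = dorfman x z p + dorfman y z p.
Proof.
move=> sx sy sz; rewrite !dorfmanE embD.
by rewrite (ebrDl p (emb_smooth sx) (emb_smooth sy) (emb_smooth sz)).
Qed.

Lemma dorZr p f x y : smooth_fun setT f -> smooth x -> smooth y ->
  dorfman x (fun q => f q *: y q) p = f p *: dorfman x y p + dfun p f (x p).1 *: y p.
Proof.
move=> sf sx sy; rewrite !dorfmanE embZ.
by rewrite (ebrZr p sf (emb_smooth sx) (emb_smooth sy)).
Qed.

Lemma dorZl p f x y : smooth_fun setT f -> smooth x -> smooth y ->
  dorfman (fun q => f q *: x q) y p =
  f p *: dorfman x y p - dfun p f (y p).1 *: x p + (2 * ip (x p) (y p)) *: gdiff f p.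
Proof.
move=> sf sx sy; rewrite !dorfmanE embZ.
by rewrite (ebrZl p sf (emb_smooth sx) (emb_smooth sy)) eip_emb.
Qed.

Lemma dor_sym p x y : smooth x -> smooth y ->
  dorfman y x p = - dorfman x y p + 2 *: gdiff (fun q => ip (x q) (y q)) p.
Proof.
move=> sx sy; rewrite !dorfmanE (ebr_sym p (emb_smooth sx) (emb_smooth sy)).
by rewrite (_ : (fun q => eip _ _) = fun q => ip (x q) (y q)) //; apply/funext => q; exact: eip_emb.
Qed.

Lemma dor_inv p x y z : smooth x -> smooth y -> smooth z ->
  dfun p (fun q => ip (y q) (z q)) (x p).1 =
  ip (dorfman x y p) (z p) + ip (y p) (dorfman x z p).
Proof.
move=> sx sy sz.
have := ebr_inv p (emb_smooth sx) (emb_smooth sy) (emb_smooth sz).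
rewrite (_ : (fun q => eip _ _) = fun q => ip (y q) (z q)); last first.
  by apply/funext => q; exact: eip_emb.
by move=> ->; rewrite !ebracket_emb !eip_pair.
Qed.

Lemma gdiff_cst k p : gdiff (fun _ : M => k) p = 0.
Proof.
by rewrite /gdiff d_funE; congr (_, _); apply/rowP => j; rewrite !mxE dfun_cst.
Qed.

Let opp_scale x : (fun q => - x q) = fun q => (fun=> -1 : R) q *: x q.
Proof. by apply/funext => q; rewrite scaleN1r. Qed.

Lemma dorNr p x y : smooth x -> smooth y ->
  dorfman x (fun q => - y q) p = - dorfman x y p.
Proof.
move=> sx sy; rewrite opp_scale (dorZr p (@smooth_fun_cst _ _ M setT (-1)) sx sy).
by rewrite dfun_cst scale0r addr0 scaleN1r.
Qed.

Lemma dorNl p x y : smooth x -> smooth y ->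
  dorfman (fun q => - x q) y p = - dorfman x y p.
Proof.
move=> sx sy; rewrite opp_scale (dorZl p (@smooth_fun_cst _ _ M setT (-1)) sx sy).
by rewrite dfun_cst scale0r subr0 scaleN1r gdiff_cst scaler0 addr0.
Qed.

Lemma ip_gdiff f p (v : gfiber R n) : smooth_fun setT f ->
  2 * ip (gdiff f p) v = dfun p f v.1.
Proof.
move=> sf; rewrite /ip /gdiff /= mulrA mulfV ?pnatr_eq0 // mul1r.
rewrite (pairing_d_fun p v.1 sf) [pairing v.2 0]big1 ?addr0 // => j _.
by rewrite mxE mulr0.
Qed.

Lemma desec_const p (r : R^o * R^o) v : desec p (fun _ : M => (0, r) : efiber R n) v = 0.
Proof.
pose z0 : M -> gfiber R n := fun _ => 0.
have E : z0 = (fun q => (fun=> 0 : R) q *: z0 q).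
  by apply/funext => q; rewrite scale0r.
have D0 : dsec p z0 v = 0.
  apply: etrans (congr1 (fun z => dsec p z v) E) _.
  apply: etrans (dsecZ p v (@smooth_fun_cst _ _ M setT 0) (smooth_section0 (M := M) openT)) _.
  by rewrite dfun_cst !scale0r addr0.
exact: (congr2 pair D0 (congr2 pair (dfun_cst p _ v) (dfun_cst p _ v))).
Qed.

(** Sections with constant coefficients over d/dt and dt bracket trivially with
    those of M: this is why e1 = J(d/dt) and e2 = J(dt) satisfy simple identities. *)
Lemma ebr_const_r p x (r : R^o * R^o) : smooth x ->
  ebracket (emb x) (fun _ => (0, r)) p = 0.
Proof.
move=> sx; have sX := emb_smooth sx; rewrite (ebracketE p sX (const_smooth r)).
rewrite desec_const (desec0v p sX) subr0 add0r.
rewrite (_ : (\row__ _) = 0) ?cofm0 //; apply/rowP => j; rewrite !mxE.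
have E : eip (desec p (emb x) (delta_mx 0 j)) (0, r) = 0.
  rewrite /eip /= ip0r /desec /= add0r.
  have -> : dfun p (dt_vec (emb x)) (delta_mx 0 j) = 0 by exact: dfun_cst.
  by rewrite mul0r mulr0 addr0 mulr0.
by rewrite E mulr0.
Qed.

Lemma ebr_const_l p X (r : R^o * R^o) : esmooth X ->
  ebracket (fun _ => (0, r)) X p = - ebracket X (fun _ => (0, r)) p +
     2 *: cofm (d_fun (fun q => eip (X q) (0, r)) p).
Proof. by move=> sX; rewrite (ebr_sym p sX (const_smooth r)). Qed.

Lemma ebr_const_const p (r s : R^o * R^o) :
  ebracket (fun _ : M => (0, r) : efiber R n) (fun _ => (0, s)) p = 0.
Proof.
rewrite (ebracketE p (const_smooth r) (const_smooth s)) !desec_const subr0 add0r.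
rewrite (_ : (\row__ _) = 0) ?cofm0 //; apply/rowP => j; rewrite !mxE.
by rewrite desec_const eip0l mulr0.
Qed.

Lemma ebr_const_emb p x (r : R^o * R^o) : smooth x ->
  ebracket (fun _ => (0, r)) (emb x) p = 0.
Proof.
move=> sx; rewrite (ebr_const_l p r (emb_smooth sx)) (ebr_const_r p r sx) oppr0 add0r.
rewrite (_ : (fun q => _) = fun=> 0); last first.
  by apply/funext => q; rewrite /eip /= ip0r !mul0r mulr0 addr0 mulr0 addr0.
rewrite d_funE (_ : (\row__ _) = 0) ?cofm0 ?scaler0 //.
by apply/rowP => j; rewrite !mxE dfun_cst.
Qed.

End DorfmanIdentities.

(** * The complexified fibre *)

Section Complexification.
Context {R : realType} {n : nat}.
Implicit Types (a b c d : gfiber R n) (u v w : gfiber R[i] n) (z : R[i]) (k : R).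

Lemma complex_eq (x y : R[i]) : complex.Re x = complex.Re y ->
  complex.Im x = complex.Im y -> x = y.
Proof. by case: x => x1 x2; case: y => y1 y2 /= -> ->. Qed.

Lemma gfiber_eq (K : Type) (u v : gfiber K n) :
  (forall j, u.1 0 j = v.1 0 j) -> (forall j, u.2 0 j = v.2 0 j) -> u = v.
Proof.
by case: u v => [u1 u2] [v1 v2] /= h1 h2; congr (_, _); apply/rowP.
Qed.

Lemma ReD (x y : R[i]) : complex.Re (x + y) = complex.Re x + complex.Re y.
Proof. by case: x; case: y. Qed.
Lemma ImD (x y : R[i]) : complex.Im (x + y) = complex.Im x + complex.Im y.
Proof. by case: x; case: y. Qed.
Lemma ReM (x y : R[i]) : complex.Re (x * y) =
  complex.Re x * complex.Re y - complex.Im x * complex.Im y.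
Proof. by case: x; case: y. Qed.
Lemma ImM (x y : R[i]) : complex.Im (x * y) =
  complex.Re x * complex.Im y + complex.Im x * complex.Re y.
Proof. by case: x; case: y. Qed.

Lemma gRe_gcplx a b : gRe (gcplx a b) = a.
Proof. by apply: gfiber_eq => j; rewrite !mxE. Qed.
Lemma gIm_gcplx a b : gIm (gcplx a b) = b.
Proof. by apply: gfiber_eq => j; rewrite !mxE. Qed.
Lemma gcplxK u : gcplx (gRe u) (gIm u) = u.
Proof. by apply: gfiber_eq => j; rewrite !mxE; apply: complex_eq. Qed.
Lemma gcplx_inj u v : gRe u = gRe v -> gIm u = gIm v -> u = v.
Proof. by move=> h1 h2; rewrite -(gcplxK u) -(gcplxK v) h1 h2. Qed.

Lemma gReD u v : gRe (u + v) = gRe u + gRe v.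
Proof. by apply: gfiber_eq => j; rewrite !mxE ReD. Qed.
Lemma gImD u v : gIm (u + v) = gIm u + gIm v.
Proof. by apply: gfiber_eq => j; rewrite !mxE ImD. Qed.
Lemma gReZ z u : gRe (z *: u) = complex.Re z *: gRe u - complex.Im z *: gIm u.
Proof. by apply: gfiber_eq => j; rewrite !mxE ReM. Qed.
Lemma gImZ z u : gIm (z *: u) = complex.Re z *: gIm u + complex.Im z *: gRe u.
Proof. by apply: gfiber_eq => j; rewrite !mxE ImM. Qed.
Lemma gRe0 : gRe (0 : gfiber R[i] n) = 0.
Proof. by apply: gfiber_eq => j; rewrite !mxE. Qed.
Lemma gIm0 : gIm (0 : gfiber R[i] n) = 0.
Proof. by apply: gfiber_eq => j; rewrite !mxE. Qed.
Lemma gReN u : gRe (- u) = - gRe u.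
Proof. by apply/eqP; rewrite -addr_eq0 -gReD addNr gRe0. Qed.
Lemma gImN u : gIm (- u) = - gIm u.
Proof. by apply/eqP; rewrite -addr_eq0 -gImD addNr gIm0. Qed.
Lemma gReB u v : gRe (u - v) = gRe u - gRe v. Proof. by rewrite gReD gReN. Qed.
Lemma gImB u v : gIm (u - v) = gIm u - gIm v. Proof. by rewrite gImD gImN. Qed.
Lemma gIm_sum (I : Type) (r : seq I) (F : I -> gfiber R[i] n) :
  gIm (\sum_(i <- r) F i) = \sum_(i <- r) gIm (F i).
Proof. by elim: r => [|i r IH]; rewrite ?big_nil ?gIm0 // !big_cons gImD IH. Qed.

Lemma gcplxD a b c d : gcplx a b + gcplx c d = gcplx (a + c) (b + d).
Proof. by apply: gcplx_inj; rewrite ?gReD ?gImD !(gRe_gcplx, gIm_gcplx). Qed.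
Lemma gcplxN a b : - gcplx a b = gcplx (- a) (- b).
Proof. by apply: gcplx_inj; rewrite ?gReN ?gImN !(gRe_gcplx, gIm_gcplx). Qed.
Lemma gcplxB a b c d : gcplx a b - gcplx c d = gcplx (a - c) (b - d).
Proof. by rewrite gcplxN gcplxD. Qed.
Lemma gcplxZi a b : 'i%C *: gcplx a b = gcplx (- b) a.
Proof.
apply: gcplx_inj; rewrite ?gReZ ?gImZ !(gRe_gcplx, gIm_gcplx) /= scale0r scale1r.
  by rewrite sub0r.
by rewrite add0r.
Qed.
Lemma gcplxZ k a b : (k%:C)%C *: gcplx a b = gcplx (k *: a) (k *: b).
Proof.
apply: gcplx_inj; rewrite ?gReZ ?gImZ !(gRe_gcplx, gIm_gcplx) /= scale0r.
  by rewrite subr0.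
by rewrite addr0.
Qed.
Lemma gcplx0 : gcplx 0 0 = 0 :> gfiber R[i] n.
Proof. by apply: gcplx_inj; rewrite ?gRe0 ?gIm0 !(gRe_gcplx, gIm_gcplx). Qed.

Lemma pairing_gcplx (a b c d : gfiber R n) :
  pairing (gcplx a b).2 (gcplx c d).1 =
  ((pairing a.2 c.1 - pairing b.2 d.1) +i* (pairing a.2 d.1 + pairing b.2 c.1))%C.
Proof.
rewrite /pairing; elim: (index_enum _) => [|j r IH].
  by rewrite !big_nil subr0 addr0.
rewrite !big_cons IH !mxE.
by apply: complex_eq; rewrite ?ReD ?ImD ?ReM ?ImM /=; ring.
Qed.

Lemma ip_gcplx a b c d : ip (gcplx a b) (gcplx c d) =
  ((ip a c - ip b d) +i* (ip a d + ip b c))%C.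
Proof.
have two : (2 : R[i]) != 0 by rewrite pnatr_eq0.
apply: (mulfI two); rewrite {1}/ip mulrA mulfV // mul1r !pairing_gcplx.
have -> : (2 : R[i]) = (2 +i* 0)%C by rewrite -[2 in RHS]natr1; apply: complex_eq; rewrite ?ReD ?ImD /= ?addr0.
apply: complex_eq; rewrite ?ReD ?ImD ?ReM ?ImM /= /ip; field; exact: isT.
Qed.

Lemma ip_cplx u v : ip u v = ((ip (gRe u) (gRe v) - ip (gIm u) (gIm v)) +i*
   (ip (gRe u) (gIm v) + ip (gIm u) (gRe v)))%C.
Proof. by rewrite -{1}(gcplxK u) -{1}(gcplxK v) ip_gcplx. Qed.

Lemma gRe_gconj u : gRe (gconj u) = gRe u.
Proof. by rewrite /gconj gRe_gcplx. Qed.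
Lemma gIm_gconj u : gIm (gconj u) = - gIm u.
Proof. by rewrite /gconj gIm_gcplx. Qed.
Lemma gconjK : involutive (@gconj R n).
Proof. by move=> u; apply: gcplx_inj; rewrite !(gRe_gconj, gIm_gconj) ?opprK. Qed.
Lemma gconjP z u v : gconj (z *: u + v) = (z^*)%C *: gconj u + gconj v.
Proof.
case: z => z1 z2; apply: gcplx_inj;
 rewrite !(gRe_gconj, gIm_gconj, gReD, gImD, gReZ, gImZ) /=.
  by rewrite !(scaleNr, scalerN) !opprK.
by rewrite scaleNr scalerN !opprD.
Qed.
Lemma ip_gconj u v : ip (gconj u) (gconj v) = ((ip u v)^*)%C.
Proof.
rewrite !ip_cplx !(gRe_gconj, gIm_gconj); apply: complex_eq => /=.
  by rewrite ipNl ipNr opprK.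
by rewrite ipNl ipNr opprD.
Qed.

End Complexification.

(** * Orthogonals and isotropic subspaces *)

Section OrthogonalSpace.
Context {K : fieldType} {n : nat}.
Implicit Types (u v w : gfiber K n) (U V W : {vspace gfiber K n}).

Lemma ip_is_linear u : linear (ip u : gfiber K n -> K^o).
Proof. by move=> k v w; exact: ip_linr. Qed.
HB.instance Definition _ u :=
  GRing.isLinear.Build K (gfiber K n) K^o *:%R (ip u : gfiber K n -> K^o) (ip_is_linear u).

Lemma mem_orthv U v : v \in orthv U <-> (forall u, u \in U -> ip u v = 0).
Proof.
have H (s : seq (gfiber K n)) :
    v \in (\bigcap_(e <- s) lker (linfun (ip e : _ -> K^o)))%VS <->
    (forall u, u \in s -> ip u v = 0).
  elim: s => [|e s IH]; first by rewrite big_nil memvf; split.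
  rewrite big_cons memv_cap memv_ker lfunE /=; split.
    case/andP=> /eqP e0 /IH h u; rewrite inE => /orP[/eqP -> //|]; exact: h.
  move=> h; rewrite h ?mem_head // eqxx /=; apply/IH => u us.
  by apply: h; rewrite inE us orbT.
apply: (iff_trans (H _)); split=> h u uU; last by apply: h; exact: vbasis_mem.
rewrite (coord_vbasis uU) ipC linear_sum /= big1 // => i _.
by rewrite linearZ /= ipC h ?scaler0 // mem_nth // size_tuple.
Qed.

Lemma dim_cap_lker U (f : 'Hom(gfiber K n, K^o)) : (\dim U <= \dim (U :&: lker f) + 1)%N.
Proof.
rewrite -(limg_ker_dim f U) leq_add2l; apply: leq_trans (dimvS (subvf _)) _.
by rewrite dimvf.
Qed.

Lemma dim_gfiber : \dim {:gfiber K n} = (n + n)%N.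
Proof. by rewrite dimvf; apply: (congr2 addn); exact: etrans (dim_matrix _ _ _) (mul1n n). Qed.

(** Each basis vector of U imposes one linear condition. *)
Lemma dim_orthv U : (n + n <= \dim (orthv U) + \dim U)%N.
Proof.
have H (s : seq (gfiber K n)) :
    (n + n <= \dim (\bigcap_(e <- s) lker (linfun (ip e : _ -> K^o)))%VS + size s)%N.
  elim: s => [|e s IH]; first by rewrite big_nil addn0 dim_gfiber.
  rewrite big_cons /= capvC addnS -addSn; apply: leq_trans IH _.
  rewrite leq_add2r; apply: leq_trans (dim_cap_lker _ _) _.
  by rewrite addn1.
by have := H (vbasis U); rewrite size_tuple.
Qed.

Lemma isotropic_vline u : ip u u = 0 -> isotropic <[u]>%VS.
Proof.
move=> uu x y /vlineP[a ->] /vlineP[b ->].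
by rewrite ipZl ipZr uu !mulr0.
Qed.

Lemma isotropic_addv U V : isotropic U -> isotropic V ->
  (forall u v, u \in U -> v \in V -> ip u v = 0) -> isotropic (U + V)%VS.
Proof.
move=> iU iV UV x y /memv_addP[x1 x1U [x2 x2V ->]] /memv_addP[y1 y1U [y2 y2V ->]].
by rewrite !ipDl !ipDr (iU x1 y1) // (UV x1 y2) // (ipC x2 y1) (UV y1 x2) // (iV x2 y2) // !addr0.
Qed.

End OrthogonalSpace.

Section ComplexSpaces.
Context {R : realType} {n : nat}.
Implicit Types (U : {vspace gfiber R n}) (V W : {vspace gfiber R[i] n}).

Lemma mem_cplx_span (s : seq (gfiber R n)) (u : gfiber R[i] n) :
  u \in <<[seq gcplx x 0%R | x <- s]>>%VS <-> gRe u \in << s >>%VS /\ gIm u \in << s >>%VS.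
Proof.
split.
  elim: s u => [|x s IH] u /=.
    by rewrite !span_nil memv0 => /eqP ->; rewrite gRe0 gIm0 !mem0v.
  rewrite !span_cons => /memv_addP[y /vlineP[k ->] [w /IH[w1 w2] ->]].
  rewrite gReD gImD gReZ gImZ gRe_gcplx gIm_gcplx !scaler0 subr0 add0r.
  by split; apply: memv_add => //; apply: memvZ; exact: memv_line.
have main (x : gfiber R n) : x \in << s >>%VS -> gcplx x 0 \in <<[seq gcplx x 0%R | x <- s]>>%VS.
  elim: s x => [|y s IH] x /=.
    by rewrite !span_nil memv0 => /eqP ->; rewrite gcplx0 mem0v.
  rewrite !span_cons => /memv_addP[_ /vlineP[k ->] [w /IH wS ->]].
  have -> : gcplx (k *: y + w) 0 = (k%:C)%C *: gcplx y 0 + gcplx w 0 :> gfiber R[i] n.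
    by rewrite gcplxZ scaler0 gcplxD addr0.
  by apply: memv_add => //; apply: memvZ; exact: memv_line.
case=> h1 h2; have -> : u = gcplx (gRe u) 0 + 'i%C *: gcplx (gIm u) 0.
  by rewrite gcplxZi gcplxD oppr0 addr0 add0r gcplxK.
by apply: memvD; [exact: main|apply: memvZ; exact: main].
Qed.

Lemma mem_cplxv U u : u \in cplxv U <-> gRe u \in U /\ gIm u \in U.
Proof. by rewrite -{2 3}(span_basis (vbasisP U)); exact: mem_cplx_span. Qed.

Lemma gconj0 : gconj 0 = 0 :> gfiber R[i] n.
Proof. by apply: gcplx_inj; rewrite ?gRe_gconj ?gIm_gconj ?gRe0 ?gIm0 ?oppr0. Qed.

Lemma mem_conj_span (s : seq (gfiber R[i] n)) u :
  u \in << s >>%VS -> gconj u \in <<[seq gconj x | x <- s]>>%VS.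
Proof.
elim: s u => [|x s IH] u /=.
  rewrite !span_nil memv0 => /eqP ->.
  by rewrite gconj0 mem0v.
rewrite !span_cons => /memv_addP[_ /vlineP[k ->] [w /IH wS ->]].
by rewrite gconjP; apply: memv_add => //; apply: memvZ; exact: memv_line.
Qed.

Lemma mem_conjv V u : u \in conjv V <-> gconj u \in V.
Proof.
split=> [/mem_conj_span|uV].
  by rewrite -map_comp (eq_map (@gconjK R n)) map_id (span_basis (vbasisP V)).
by rewrite -[u]gconjK; apply: mem_conj_span; rewrite (span_basis (vbasisP V)).
Qed.

Lemma conjvK V : conjv (conjv V) = V.
Proof.
by apply/vspaceP => u; apply/idP/idP => [/mem_conjv/mem_conjv|h];
  [|apply/mem_conjv/mem_conjv]; rewrite gconjK.
Qed.

Lemma dim_conjv V : \dim (conjv V) = \dim V.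
Proof.
have le W : (\dim (conjv W) <= \dim W)%N.
  by apply: leq_trans (dim_span _) _; rewrite size_map size_tuple.
by apply/eqP; rewrite eqn_leq le -{1}(conjvK V) le.
Qed.

(** Every complex quadratic form in two variables has a nontrivial zero: solve a
    quadratic equation. *)
Lemma isotropic_combination (v1 v2 : gfiber R[i] n) :
  exists2 k : R[i] * R[i], k <> (0, 0) &
    ip (k.1 *: v1 + k.2 *: v2) (k.1 *: v1 + k.2 *: v2) = 0.
Proof.
have [v11|v11] := eqVneq (ip v1 v1) 0.
  exists (1, 0) => [[/eqP]|]; first by rewrite oner_eq0.
  by rewrite /= scale1r scale0r addr0.
set A := ip v1 v1 in v11 *; set B := ip v1 v2; set D := ip v2 v2.
pose k := (- B + sqrtc (B ^+ 2 - A * D)) / A.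
exists (k, 1) => [[_ /eqP]|]; first by rewrite oner_eq0.
rewrite /= scale1r !ipDl !ipDr !ipZl !ipZr (ipC v2) -/A -/B -/D.
have := sqr_sqrtc (B ^+ 2 - A * D); rewrite /k; set S := sqrtc _ => hS.
have -> : (- B + S) / A * ((- B + S) / A * A) + (- B + S) / A * B + ((- B + S) / A * B + D)
   = (S ^+ 2 - B ^+ 2 + A * D) / A by field; exact: v11.
rewrite hS (_ : _ + _ = 0) ?mul0r //; ring.
Qed.

End ComplexSpaces.

(** * The decomposition of the complexified fibre *)

Section Splitting.
Context {R : realType} {n : nat}.
Variables (E : {vspace gfiber R n}) (L : {vspace gfiber R[i] n}) (e1 e2 : gfiber R n).
Hypothesis E_span : E = <<[:: e1; e2]>>%VS.
Hypotheses (e11 : ip e1 e1 = 0) (e22 : ip e2 e2 = 0) (e12 : ip e1 e2 = 2^-1).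
Hypothesis Lmax : maximal_isotropic (cplxv (orthv E)) L.
Hypothesis Lconj : (L :&: conjv L = 0)%VS.

Let V := cplxv (orthv E).
Let E1 : gfiber R[i] n := gcplx e1 0.
Let E2 : gfiber R[i] n := gcplx e2 0.
Let EC : {vspace gfiber R[i] n} := (<[E1]> + <[E2]>)%VS.

Lemma mem_orthE v : v \in orthv E <-> ip e1 v = 0 /\ ip e2 v = 0.
Proof.
rewrite mem_orthv E_span span_cons span_seq1; split=> [h|[h1 h2] u].
  split; apply: h.
    exact: (subvP (addvSl _ _) _ (memv_line _)).
  exact: (subvP (addvSr _ _) _ (memv_line _)).
case/memv_addP=> _ /vlineP[a ->] [_ /vlineP[b ->] ->].
by rewrite ipDl !ipZl h1 h2 !mulr0 addr0.
Qed.

Let ipE1 u : ip E1 u = ((ip e1 (gRe u)) +i* (ip e1 (gIm u)))%C.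
Proof. by rewrite ip_cplx gRe_gcplx gIm_gcplx !ip0l subr0 addr0. Qed.
Let ipE2 u : ip E2 u = ((ip e2 (gRe u)) +i* (ip e2 (gIm u)))%C.
Proof. by rewrite ip_cplx gRe_gcplx gIm_gcplx !ip0l subr0 addr0. Qed.

Lemma mem_cplx_orthE u : u \in V <-> ip E1 u = 0 /\ ip E2 u = 0.
Proof.
rewrite mem_cplxv !mem_orthE ipE1 ipE2; split; first by case=> -[-> ->] [-> ->].
by case=> -[-> ->] [-> ->].
Qed.

Let two0 : (2 : R[i]) != 0. Proof. by rewrite pnatr_eq0. Qed.
Let half0 : (2^-1 : R) != 0. Proof. by rewrite invr_eq0 pnatr_eq0. Qed.

Let E11 : ip E1 E1 = 0. Proof. by rewrite ip_gcplx e11 !ip0l !ip0r subr0 addr0. Qed.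
Let E22 : ip E2 E2 = 0. Proof. by rewrite ip_gcplx e22 !ip0l !ip0r subr0 addr0. Qed.
Let E12 : ip E1 E2 != 0.
Proof.
rewrite ip_gcplx e12 !ip0l !ip0r subr0 addr0; apply/eqP => -[/eqP].
exact/negP.
Qed.

Let EC_V u : u \in EC -> u \in V -> u = 0.
Proof.
case/memv_addP=> _ /vlineP[a ->] [_ /vlineP[b ->] ->] /mem_cplx_orthE [].
rewrite !ipDr !ipZr E11 E22 (ipC E2 E1) !mulr0 add0r addr0 => /eqP.
rewrite mulf_eq0 (negbTE E12) orbF => /eqP ->.
move=> /eqP; rewrite mulf_eq0 (negbTE E12) orbF => /eqP ->.
by rewrite !scale0r addr0.
Qed.

Let conj_V u : u \in conjv L -> u \in V.
Proof.
have [LV _ _] := Lmax => /mem_conjv /(subvP LV) /mem_cplx_orthE [].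
rewrite ipE1 ipE2 !gRe_gconj !gIm_gconj !ipNr => -[a /eqP b] [c /eqP d].
move: b d; rewrite !oppr_eq0 => /eqP b /eqP d.
by apply/mem_cplx_orthE; rewrite ipE1 ipE2 a b c d.
Qed.

Let dimEC : \dim EC = 2%N.
Proof.
have nz : E1 != 0 by apply/eqP => h; move: E12; rewrite h ip0l eqxx.
have nz' : E2 != 0 by apply/eqP => h; move: E12; rewrite h ip0r eqxx.
rewrite dimv_disjoint_sum ?dim_vline ?nz ?nz' //.
apply/eqP; rewrite -subv0; apply/subvP => u; rewrite memv_cap memv0.
case/andP=> /vlineP[a ->] /vlineP[b h].
have : ip E1 (a *: E1) = 0 by rewrite ipZr E11 mulr0.
rewrite h ipZr => /eqP; rewrite mulf_eq0 (negbTE E12) orbF => /eqP ->.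
by rewrite scale0r.
Qed.

(** A dimension count.  The vectors of the orthogonal W of L + E that are isotropic
    lie in L, by maximality; a complement of L in W of dimension 2 would contain
    such a vector, so dim W <= dim L + 1.  As dim W is at least 2n - dim L - 2,
    this leaves dim L >= n - 1 by parity, and L, its conjugate and the complexified
    E fill the fibre. *)
Lemma splitting : (L + conjv L + EC = fullv)%VS.
Proof.
have [LV Liso Lm] := Lmax.
pose W := orthv (L + EC)%VS.
have inL u : u \in L -> u \in (L + EC)%VS by exact: (subvP (addvSl _ _) u).
have inEC u : u \in EC -> u \in (L + EC)%VS by exact: (subvP (addvSr _ _) u).
have E1C : E1 \in EC by exact: (subvP (addvSl _ _) _ (memv_line _)).
have E2C : E2 \in EC by exact: (subvP (addvSr _ _) _ (memv_line _)).
have WV v : v \in W -> v \in V.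
  by move/mem_orthv => h; apply/mem_cplx_orthE; split; apply/h/inEC.
have LW : (L <= W)%VS.
  apply/subvP => u uL; apply/mem_orthv => _ /memv_addP[l lL [_ /memv_addP[_ /vlineP[a ->] [_ /vlineP[b ->] ->]] ->]].
  have /mem_cplx_orthE[h1 h2] := subvP LV _ uL.
  by rewrite !ipDl !ipZl Liso // h1 h2 !mulr0 !addr0.
(* maximality of L, applied to L + <v> *)
have WL v : v \in W -> ip v v = 0 -> v \in L.
  move=> vW vv; have LvL : (L + <[v]>)%VS = L.
    apply: Lm; first exact: addvSl.
      rewrite subv_add LV /=; apply/subvP => _ /vlineP[a ->].
      by apply: memvZ; exact: WV.
    apply: isotropic_addv => //; first exact: isotropic_vline.
    move=> u _ uL /vlineP[a ->]; move/mem_orthv : vW => /(_ u (inL _ uL)) h.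
    by rewrite ipZr h mulr0.
  by rewrite -LvL; exact: (subvP (addvSr _ _) _ (memv_line _)).
(* a plane has an isotropic vector, and those of W are in L *)
have dW : (\dim W <= \dim L + 1)%N.
  rewrite leqNgt; apply/negP => big.
  pose C := (W :\: L)%VS.
  have dC : (2 <= \dim C)%N.
    have := dimv_cap_compl W L; rewrite (capv_idPr LW) -/C => h.
    by move: big; rewrite -h -addnS leq_add2l.
  have CL u : u \in C -> u \in L -> u = 0.
    move=> uC uL; apply/eqP; rewrite -memv0 -(capv_diff W L) memv_cap uL andbT; exact: uC.
  have CW u : u \in C -> u \in W by exact: (subvP (diffvSl _ _) u).
  pose v1 := vpick C.
  have v1C : v1 \in C by exact: memv_pick.
  have v10 : v1 != 0 by rewrite vpick0 -dimv_eq0 -lt0n; exact: ltnW dC.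
  pose C' := (C :\: <[v1]>)%VS.
  have dC' : (1 <= \dim C')%N.
    have := dimv_cap_compl C <[v1]>; rewrite -/C' => h.
    have h2 : (\dim (C :&: <[v1]>) <= 1)%N.
      by apply: leq_trans (dimvS (capvSr _ _)) _; rewrite dim_vline; case: (_ != _).
    by have := leq_trans dC (eq_leq (esym h)); move: h2; case: (\dim (C :&: _)) => [_ /ltnW|[|]].
  pose v2 := vpick C'.
  have v2C' : v2 \in C' by exact: memv_pick.
  have v20 : v2 != 0 by rewrite vpick0 -dimv_eq0 -lt0n.
  have v2C : v2 \in C by exact: (subvP (diffvSl _ _) _ v2C').
  have [[k1 k2] k0 /= kk] := isotropic_combination v1 v2.
  have vC : k1 *: v1 + k2 *: v2 \in C by apply: memvD; apply: memvZ.
  have v0 := CL _ vC (WL _ (CW _ vC) kk).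
  have k20 : k2 *: v2 = 0.
    apply/eqP; rewrite -memv0 -(capv_diff C <[v1]>) memv_cap -/C' memvZ //=.
    have -> : k2 *: v2 = - (k1 *: v1) by apply/eqP; rewrite -addr_eq0 addrC v0.
    by rewrite memvN memvZ // memv_line.
  apply: k0; congr (_, _); last first.
    by move/eqP: k20; rewrite scaler_eq0 (negbTE v20) orbF => /eqP.
  move/eqP: v0; rewrite k20 addr0 scaler_eq0 (negbTE v10) orbF => /eqP.
  done.
have d1 := dim_orthv (L + EC)%VS.
have d2 : (\dim (L + EC) <= \dim L + 2)%N.
  by apply: leq_trans (dimv_add_leqif _ _).1 _; rewrite dimEC.
have d3 : \dim (L + conjv L)%VS = (\dim L + \dim L)%N.
  by rewrite dimv_disjoint_sum // dim_conjv.
have d4 : \dim (L + conjv L + EC)%VS = (\dim L + \dim L + 2)%N.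
  rewrite dimv_disjoint_sum ?d3 ?dimEC //.
  apply/eqP; rewrite -subv0; apply/subvP => u; rewrite memv_cap memv0.
  case/andP=> /memv_addP[x xL [y yL ->]] uE; apply/eqP/EC_V => //.
  by apply: memvD; [exact: (subvP LV)|exact: conj_V].
apply/eqP; rewrite -(geq_leqif (dimv_leqif_eq (subvf _))) dim_gfiber d4.
rewrite -/W in d1; move: d1 d2 dW d4.
rewrite -/W; move: (\dim W) (\dim L) (\dim (L + EC)) => a b c; lia.
Qed.

End Splitting.

(** * The endomorphism attached to L and a frame of E *)

Section ContactEndo.
Context {R : realType} {n : nat}.
Implicit Types (L : {vspace gfiber R[i] n}) (x y : gfiber R n).

(** The component in L of a real vector x.  Its real part is half of the projection
    of x to the orthogonal of E. *)
Definition Lproj L (e1 e2 : gfiber R n) x : gfiber R[i] n :=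
  daddv_pi L (conjv L + (<[gcplx e1 0%R]> + <[gcplx e2 0%R]>)) (gcplx x 0).

(** For x orthogonal to E, the component of x in L is (x - i Phi x)/2; this reads
    Phi x off it, and gives 0 on E. *)
Definition contact_fun L (e1 e2 : gfiber R n) x : gfiber R n := (-2) *: gIm (Lproj L e1 e2 x).

Lemma contact_fun_linear L (e1 e2 : gfiber R n) : linear (contact_fun L e1 e2).
Proof.
move=> k x y; rewrite /contact_fun /Lproj.
have -> : gcplx (k *: x + y) 0 = (k%:C)%C *: gcplx x 0 + gcplx y 0 :> gfiber R[i] n.
  by rewrite gcplxZ scaler0 gcplxD addr0.
rewrite linearP gImD gImZ /= scale0r addr0 scalerDr; congr (_ + _).
by rewrite !scalerA mulrC.
Qed.
HB.instance Definition _ L (e1 e2 : gfiber R n) :=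
  GRing.isLinear.Build R (gfiber R n) (gfiber R n) *:%R (contact_fun L e1 e2)
    (contact_fun_linear L e1 e2).

Definition contact_endo L (e1 e2 : gfiber R n) : 'End(gfiber R n) := linfun (contact_fun L e1 e2).

(** The projection to the orthogonal of the span of a frame e1, e2 with
    <e1, e2> = 1/2. *)
Definition perp (e1 e2 : gfiber R n) x : gfiber R n := x - (2 * ip x e2) *: e1 - (2 * ip x e1) *: e2.

Lemma perp_linear (e1 e2 : gfiber R n) : linear (perp e1 e2).
Proof.
move=> k x y; rewrite /perp !ip_linl.
have E (r s : R) (v : gfiber R n) : (2 * (k * r + s)) *: v = k *: ((2 * r) *: v) + (2 * s) *: v.
  by rewrite mulrDr scalerDl scalerA mulrCA.
rewrite !E; set p := _ *: e1; set q := _ *: e1; set r := _ *: e2; set s := _ *: e2.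
by rewrite !scalerDr !scalerN !opprD (AC ((2*2)*2) ((1*3*5)*(2*4*6))).
Qed.

Section Properties.
Variables (E : {vspace gfiber R n}) (L : {vspace gfiber R[i] n}) (e1 e2 : gfiber R n).
Hypothesis E_span : E = <<[:: e1; e2]>>%VS.
Hypotheses (e11 : ip e1 e1 = 0) (e22 : ip e2 e2 = 0) (e12 : ip e1 e2 = 2^-1).

Let two0 : (2 : R) != 0. Proof. by rewrite pnatr_eq0. Qed.

Lemma perpP x : ip (perp e1 e2 x) e1 = 0 /\ ip (perp e1 e2 x) e2 = 0.
Proof.
rewrite /perp !ipBl !ipZl e11 e22 e12 (ipC e2 e1) e12 !mulr0 !subr0.
have D (a : R) : 2 * a * 2^-1 = a by rewrite mulrAC divff // mul1r.
by rewrite !D !subrr.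
Qed.

Lemma perp_id x : ip x e1 = 0 -> ip x e2 = 0 -> perp e1 e2 x = x.
Proof. by move=> h1 h2; rewrite /perp h1 h2 !mulr0 !scale0r !subr0. Qed.

Lemma perp_e1 : perp e1 e2 e1 = 0.
Proof. by rewrite /perp e11 e12 mulr0 scale0r subr0 divff // scale1r subrr. Qed.
Lemma perp_e2 : perp e1 e2 e2 = 0.
Proof. by rewrite /perp e22 ipC e12 mulr0 scale0r subr0 divff // scale1r subrr. Qed.

Lemma ip_perp x y : ip y e1 = 0 -> ip y e2 = 0 -> ip (perp e1 e2 x) y = ip x y.
Proof.
by move=> h1 h2; rewrite /perp !ipBl !ipZl (ipC e1) (ipC e2) h1 h2 !mulr0 !subr0.
Qed.

Lemma perp_combination a b x : ip x e1 = 0 -> ip x e2 = 0 ->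
  perp e1 e2 (x + (a *: e1 + b *: e2)) = x.
Proof.
move=> h1 h2; have P := perp_linear e1 e2.
have P0 : perp e1 e2 0 = 0 by rewrite perp_id ?ip0l.
have -> : x + (a *: e1 + b *: e2) = a *: e1 + (b *: e2 + x) by rewrite [RHS]addrA addrC.
by rewrite !P perp_e1 perp_e2 !scaler0 !add0r perp_id.
Qed.

Hypothesis Lmax : maximal_isotropic (cplxv (orthv E)) L.
Hypothesis Lconj : (L :&: conjv L = 0)%VS.

Lemma L_orth u : u \in L ->
  [/\ ip (gRe u) e1 = 0, ip (gRe u) e2 = 0, ip (gIm u) e1 = 0 & ip (gIm u) e2 = 0].
Proof.
have [LV _ _] := Lmax => /(subvP LV) /mem_cplxv [].
by move=> /(mem_orthE E_span) [h1 h2] /(mem_orthE E_span) [h3 h4]; rewrite !(ipC _ e1) !(ipC _ e2).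
Qed.

(** A purely imaginary vector of L also lies in the conjugate of L. *)
Lemma L_real_part0 u : u \in L -> gRe u = 0 -> u = 0.
Proof.
move=> uL u0; apply/eqP; rewrite -memv0 -Lconj memv_cap uL; apply/mem_conjv.
have -> : gconj u = - u.
  by apply: gcplx_inj; rewrite ?gRe_gconj ?gIm_gconj ?gReN ?gImN // u0 oppr0.
by rewrite memvN.
Qed.

Lemma Lproj_mem x : Lproj L e1 e2 x \in L.
Proof. exact: memv_pi. Qed.

(** In the decomposition x = u + v + w of a real vector along L, its conjugate and the
    complexified E, uniqueness makes v the conjugate of u, and w is real. *)
Lemma Lproj_re x : 2 *: gRe (Lproj L e1 e2 x) = perp e1 e2 x.
Proof.
set EC := (<[gcplx e1 0%R]> + <[gcplx e2 0%R]>)%VS : {vspace gfiber R[i] n}.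
have full := splitting E_span e11 e22 e12 Lmax Lconj.
have ECP e : e \in EC -> exists a b : R * R,
   gRe e = a.1 *: e1 + b.1 *: e2 /\ gIm e = a.2 *: e1 + b.2 *: e2.
  case/memv_addP=> _ /vlineP[[a1 a2] ->] [_ /vlineP[[b1 b2] ->] ->].
  exists (a1, a2), (b1, b2); rewrite gReD gImD !gReZ !gImZ !gRe_gcplx !gIm_gcplx /=.
  by rewrite !scaler0 !subr0 !add0r.
have disj : (L :&: (conjv L + EC))%VS = 0%VS :> {vspace gfiber R[i] n}.
  apply/eqP; rewrite -subv0; apply/subvP => u; rewrite memv_cap memv0.
  case/andP=> uL /memv_addP[y /mem_conjv yL [e /ECP[a [b [eR eI]]] uE]].
  have [r1 r2 r3 r4] := L_orth uL; have := L_orth yL.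
  rewrite gRe_gconj gIm_gconj !ipNl => -[s1 s2 /eqP s3 /eqP s4].
  move: s3 s4; rewrite !oppr_eq0 => /eqP s3 /eqP s4.
  have eE : e = u - y by rewrite uE addrAC subrr add0r.
  have q1 : perp e1 e2 (gRe e) = gRe e.
    by rewrite eE gReB perp_id // ipBl ?r1 ?r2 ?s1 ?s2 subrr.
  have q2 : perp e1 e2 (gIm e) = gIm e.
    by rewrite eE gImB perp_id // ipBl ?r3 ?r4 ?s3 ?s4 subrr.
  have z a' b' : perp e1 e2 (a' *: e1 + b' *: e2) = 0.
    by rewrite -[X in perp e1 e2 X]add0r perp_combination ?ip0l.
  have e0 : e = 0.
    apply: gcplx_inj.
      by rewrite gRe0; exact: etrans (esym q1) (etrans (congr1 (perp e1 e2) eR) (z _ _)).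
    by rewrite gIm0; exact: etrans (esym q2) (etrans (congr1 (perp e1 e2) eI) (z _ _)).
  have uy : u = y by apply/eqP; rewrite -subr_eq0 -eE e0.
  by rewrite -memv0 -Lconj memv_cap uL /=; apply/mem_conjv; rewrite uy.
have xin : gcplx x 0 \in (L + (conjv L + EC))%VS by rewrite addvA full memvf.
have := daddv_pi_add disj xin; rewrite -/EC.
set u := daddv_pi L _ _; set w := daddv_pi _ L _ => uw.
have uL : u \in L by exact: memv_pi.
have : w \in (conjv L + EC)%VS by exact: memv_pi.
case/memv_addP=> y /mem_conjv yL [e /ECP[a [b [eR eI]]] wE].
have E1 : x = gRe u + gRe (gconj y) + gRe e.
  by rewrite gRe_gconj -addrA -gReD -wE -gReD uw gRe_gcplx.
have E2 : 0 = gIm u - gIm (gconj y) + gIm e.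
  by rewrite gIm_gconj opprK -addrA -gImD -wE -gImD uw gIm_gcplx.
have [r1 r2 r3 r4] := L_orth uL; have [s1 s2 s3 s4] := L_orth yL.
have imE : gIm u = gIm (gconj y).
  apply/eqP; rewrite -subr_eq0; apply/eqP.
  have i1 : ip (gIm u - gIm (gconj y)) e1 = 0 by rewrite ipBl r3 s3 subrr.
  have i2 : ip (gIm u - gIm (gconj y)) e2 = 0 by rewrite ipBl r4 s4 subrr.
  apply: etrans (esym (perp_combination a.2 b.2 i1 i2)) _.
  by rewrite -eI -E2 perp_id // ip0l.
have yu : gconj y = u.
  have d0 : 'i%C *: (u - gconj y) = 0.
    apply: L_real_part0; first by rewrite memvZ // memvB.
    by rewrite gReZ /= scale0r scale1r gImB imE subrr subr0.
  have : u - gconj y = 0.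
    move/eqP: d0; rewrite scaler_eq0 => /orP[|/eqP //].
    by rewrite eq_complex /= oner_eq0 andbF.
  by move/eqP; rewrite subr_eq0 => /eqP.
rewrite /Lproj -/EC -/u E1 yu eR.
rewrite perp_combination ?ipDl ?r1 ?r2 ?addr0 //.
by rewrite -[2]natr1 scalerDl scale1r.
Qed.

Lemma contact_fun_mem x :
  gcplx (perp e1 e2 x) (- contact_fun L e1 e2 x) \in L.
Proof.
rewrite -Lproj_re /contact_fun scaleNr opprK.
have := memvZ ((2 : R)%:C)%C (Lproj_mem x).
by rewrite -{1}(gcplxK (Lproj L e1 e2 x)) gcplxZ.
Qed.

(** The element x - i y of L is determined by its real part, so it defines Phi x. *)
Lemma contact_fun_charac x y :
  gcplx (perp e1 e2 x) (- y) \in L -> contact_fun L e1 e2 x = y.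
Proof.
move=> h; have := memvB (contact_fun_mem x) h; rewrite gcplxB subrr.
move=> /L_real_part0; rewrite gRe_gcplx => /(_ erefl) /(congr1 (@gIm R n)).
by rewrite gIm_gcplx gIm0 opprK => /eqP; rewrite addrC subr_eq0 => /eqP.
Qed.

Lemma contact_fun_orth x : ip (contact_fun L e1 e2 x) e1 = 0 /\ ip (contact_fun L e1 e2 x) e2 = 0.
Proof.
have [_ _] := L_orth (contact_fun_mem x); rewrite gIm_gcplx !ipNl.
by move=> /eqP; rewrite oppr_eq0 => /eqP -> /eqP; rewrite oppr_eq0 => /eqP ->.
Qed.

Lemma contact_fun_e1 : contact_fun L e1 e2 e1 = 0.
Proof. by apply: contact_fun_charac; rewrite perp_e1 oppr0 gcplx0 mem0v. Qed.
Lemma contact_fun_e2 : contact_fun L e1 e2 e2 = 0.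
Proof. by apply: contact_fun_charac; rewrite perp_e2 oppr0 gcplx0 mem0v. Qed.

Lemma contact_fun_square x :
  contact_fun L e1 e2 (contact_fun L e1 e2 x) = - perp e1 e2 x.
Proof.
apply: contact_fun_charac; have [h1 h2] := contact_fun_orth x.
rewrite opprK (perp_id h1 h2).
by have := memvZ 'i%C (contact_fun_mem x); rewrite gcplxZi opprK.
Qed.

Lemma contact_fun_skew x y :
  ip (contact_fun L e1 e2 x) y = - ip x (contact_fun L e1 e2 y).
Proof.
have [_ Liso _] := Lmax; have := Liso _ _ (contact_fun_mem x) (contact_fun_mem y).
rewrite ip_gcplx => -[_]; rewrite ipNr ipNl => /eqP.
have [h1 h2] := contact_fun_orth y; have [h3 h4] := contact_fun_orth x.
rewrite (ip_perp _ h1 h2) (ipC _ (perp _ _ _)) (ip_perp _ h3 h4) (ipC y).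
by rewrite addrC subr_eq0 eqr_oppLR => /eqP.
Qed.

Lemma contact_fun_eigen u : u \in L <->
  gcplx (contact_fun L e1 e2 (gRe u)) (contact_fun L e1 e2 (gIm u)) = 'i%C *: u.
Proof.
have L0 := contact_fun_linear L e1 e2.
split=> [uL|].
  have [h1 h2 h3 h4] := L_orth uL.
  have E1 : contact_fun L e1 e2 (gRe u) = - gIm u.
    by apply: contact_fun_charac; rewrite opprK (perp_id h1 h2) gcplxK.
  have E2 : contact_fun L e1 e2 (gIm u) = gRe u.
    apply: contact_fun_charac; rewrite (perp_id h3 h4).
    have := memvZ (- 'i%C) uL; rewrite scaleNr -{1}(gcplxK u) gcplxZi gcplxN.
    by rewrite opprK.
  by rewrite E1 E2 -{3}(gcplxK u) gcplxZi.
rewrite -{3}(gcplxK u) gcplxZi => h.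
have E1 : contact_fun L e1 e2 (gRe u) = - gIm u.
  by have := congr1 (@gRe R n) h; rewrite !gRe_gcplx.
have E2 : contact_fun L e1 e2 (gIm u) = gRe u.
  by have := congr1 (@gIm R n) h; rewrite !gIm_gcplx.
have := contact_fun_mem (gRe u); rewrite E1 opprK.
have [h1 h2] := contact_fun_orth (gIm u); rewrite E2 in h1 h2.
by rewrite (perp_id h1 h2) gcplxK.
Qed.

End Properties.
End ContactEndo.

(** * Smoothness of the attached endomorphism *)

Section ComplexSmooth.
Context {R : realType} {n : nat} {M : manifold R n}.
Variable (U : set M).
Hypothesis oU : open U.
Implicit Types (f g : M -> R[i]).

Definition csmooth_fun f := smooth_fun U (fun q => complex.Re (f q)) /\
  smooth_fun U (fun q => complex.Im (f q)).

Lemma csmooth_fun_ext f g : (forall q, f q = g q) -> csmooth_fun f -> csmooth_fun g.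
Proof. by move=> /funext ->. Qed.

Lemma csmooth_fun_cst (z : R[i]) : csmooth_fun (fun=> z).
Proof. by split; exact: smooth_fun_cst. Qed.

Lemma csmooth_funD f g : csmooth_fun f -> csmooth_fun g ->
  csmooth_fun (fun q => f q + g q).
Proof.
case=> f1 f2 [g1 g2]; split.
  by apply: (smooth_fun_ext oU) (smooth_funD oU f1 g1) => q _; rewrite ReD.
by apply: (smooth_fun_ext oU) (smooth_funD oU f2 g2) => q _; rewrite ImD.
Qed.

Lemma csmooth_funM f g : csmooth_fun f -> csmooth_fun g ->
  csmooth_fun (fun q => f q * g q).
Proof.
case=> f1 f2 [g1 g2]; split.
  have := smooth_funB oU (smooth_funM oU f1 g1) (smooth_funM oU f2 g2).
  by apply: (smooth_fun_ext oU) => q _; rewrite ReM.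
have := smooth_funD oU (smooth_funM oU f1 g2) (smooth_funM oU f2 g1).
by apply: (smooth_fun_ext oU) => q _; rewrite ImM.
Qed.

Lemma csmooth_fun_sum (I : Type) (r : seq I) (F : I -> M -> R[i]) :
  (forall i, csmooth_fun (F i)) -> csmooth_fun (fun q => \sum_(i <- r) F i q).
Proof.
move=> sF; elim: r => [|i r IH].
  by apply: csmooth_fun_ext (csmooth_fun_cst 0) => q; rewrite big_nil.
by apply: csmooth_fun_ext (csmooth_funD (sF i) IH) => q; rewrite big_cons.
Qed.

Lemma csmooth_fun_prod (I : Type) (r : seq I) (F : I -> M -> R[i]) :
  (forall i, csmooth_fun (F i)) -> csmooth_fun (fun q => \prod_(i <- r) F i q).
Proof.
move=> sF; elim: r => [|i r IH].
  by apply: csmooth_fun_ext (csmooth_fun_cst 1) => q; rewrite big_nil.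
by apply: csmooth_fun_ext (csmooth_funM (sF i) IH) => q; rewrite big_cons.
Qed.

Lemma csmooth_funV f : (forall q, U q -> f q != 0) -> csmooth_fun f ->
  csmooth_fun (fun q => (f q)^-1).
Proof.
move=> f0 [f1 f2].
have sN := smooth_funD oU (smooth_funM oU f1 f1) (smooth_funM oU f2 f2).
have N0 q : U q -> complex.Re (f q) * complex.Re (f q) + complex.Im (f q) * complex.Im (f q) != 0.
  move=> /f0; apply: contraNneq => /eqP; rewrite -!expr2 paddr_eq0 ?sqr_ge0 // !sqrf_eq0.
  by case/andP=> /eqP a /eqP b; apply/eqP/complex_eq.
have sV := smooth_funV oU N0 sN.
split.
  apply: (smooth_fun_ext oU) (smooth_funM oU f1 sV) => q _.
  by case: (f q) => a b /=; rewrite !expr2.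
apply: (smooth_fun_ext oU) (smooth_funN oU (smooth_funM oU f2 sV)) => q _.
by case: (f q) => a b /=; rewrite !expr2.
Qed.

Lemma csmooth_fun_det m (A : M -> 'M[R[i]]_m) :
  (forall i j, csmooth_fun (fun q => A q i j)) -> csmooth_fun (fun q => \det (A q)).
Proof.
move=> sA; apply: csmooth_fun_sum => s; apply: csmooth_funM; first exact: csmooth_fun_cst.
by apply: csmooth_fun_prod => i; exact: sA.
Qed.

(** The entries of the inverse matrix by Cramer's rule. *)
Lemma csmooth_fun_invmx m (A : M -> 'M[R[i]]_m) :
  (forall i j, csmooth_fun (fun q => A q i j)) ->
  (forall q, U q -> \det (A q) != 0) ->
  forall i j, csmooth_fun (fun q => (\det (A q))^-1 * \adj (A q) i j).
Proof.
move=> sA A0 i j; apply: csmooth_funM; first exact/csmooth_funV/csmooth_fun_det.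
apply: (@csmooth_fun_ext (fun q => cofactor (A q) j i)) => [q|]; first by rewrite mxE.
apply: csmooth_funM; first exact: csmooth_fun_cst.
apply: csmooth_fun_det => k l.
by apply: csmooth_fun_ext (sA (lift j k) (lift i l)) => q; rewrite !mxE.
Qed.

Lemma csmooth_fun_ip (x y : M -> gfiber R[i] n) : csmooth_section U x ->
  csmooth_section U y -> csmooth_fun (fun q => ip (x q) (y q)).
Proof.
case=> x1 x2 [y1 y2]; split.
  have := smooth_funB oU (smooth_fun_ip oU x1 y1) (smooth_fun_ip oU x2 y2).
  by apply: (smooth_fun_ext oU) => q _; rewrite [in RHS]ip_cplx.
have := smooth_funD oU (smooth_fun_ip oU x1 y2) (smooth_fun_ip oU x2 y1).
by apply: (smooth_fun_ext oU) => q _; rewrite [in RHS]ip_cplx.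
Qed.

Lemma csmooth_section_conj (x : M -> gfiber R[i] n) : csmooth_section U x ->
  csmooth_section U (fun q => gconj (x q)).
Proof.
case=> x1 x2; split.
  by apply: (smooth_section_ext oU) x1 => q _; rewrite /= gRe_gconj.
by apply: (smooth_section_ext oU) (smooth_sectionN oU x2) => q _; rewrite /= gIm_gconj.
Qed.

Lemma csmooth_section_real (x : M -> gfiber R n) : smooth_section U x ->
  csmooth_section U (fun q => gcplx (x q) 0).
Proof.
move=> sx; split.
  by apply: (smooth_section_ext oU) sx => q _; rewrite /= gRe_gcplx.
by apply: (smooth_section_ext oU) (smooth_section0 oU) => q _; rewrite /= gIm_gcplx.
Qed.

End ComplexSmooth.

(** The pairing of u with the standard basis gives all its components. *)
Lemma ip_nondeg (K : fieldType) n (u : gfiber K n) : (2 : K) != 0 ->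
  (forall w, ip u w = 0) -> u = 0.
Proof.
case: u => u1 u2 two H.
have H' w : pairing u2 w.1 + pairing w.2 u1 = 0.
  by have /eqP := H w; rewrite mulf_eq0 invr_eq0 (negbTE two) => /eqP.
have D (a : 'rV[K]_n) j : \sum_k a 0 k * (delta_mx 0 j : 'rV_n) 0 k = a 0 j.
  rewrite (bigD1 j) //= big1 => [|k kj]; first by rewrite mxE !eqxx mulr1 addr0.
  by rewrite mxE eqxx (negbTE kj) mulr0.
congr (_, _); apply/rowP => j; rewrite mxE.
  have := H' (0, delta_mx 0 j); rewrite /pairing /= big1 => [|k _]; last by rewrite mxE mulr0.
  by rewrite add0r => h; rewrite -(D u1 j) -[RHS]h; apply: eq_bigr => k _; exact: mulrC.
have := H' (delta_mx 0 j, 0); rewrite /pairing /= D big1 ?addr0 // => k _.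
by rewrite mxE mul0r.
Qed.

Section ContactSmooth.
Context {R : realType} {n : nat} {M : manifold R n}.
Variables (E : M -> {vspace gfiber R n}) (L : M -> {vspace gfiber R[i] n})
  (e1 e2 : M -> gfiber R n).
Hypothesis E_span : forall p, E p = <<[:: e1 p; e2 p]>>%VS.
Hypotheses (e11 : forall p, ip (e1 p) (e1 p) = 0)
  (e22 : forall p, ip (e2 p) (e2 p) = 0) (e12 : forall p, ip (e1 p) (e2 p) = 2^-1).
Hypothesis Lmax : forall p, maximal_isotropic (cplxv (orthv (E p))) (L p).
Hypothesis Lconj : forall p, (L p :&: conjv (L p) = 0)%VS.

(** L is orthogonal to itself and to E, and the fibre is spanned by L, its conjugate
    and E: a vector of L orthogonal to the conjugate is orthogonal to everything. *)
Lemma L_pair_conj_nondeg p z : z \in L p ->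
  (forall w, w \in L p -> ip z (gconj w) = 0) -> z = 0.
Proof.
move=> zL h; apply: ip_nondeg => [|w]; first by rewrite pnatr_eq0.
have : w \in (L p + conjv (L p) + (<[gcplx (e1 p) 0%R]> + <[gcplx (e2 p) 0%R]>))%VS.
  by rewrite (splitting (E_span p) (e11 p) (e22 p) (e12 p) (Lmax p) (Lconj p)) memvf.
case/memv_addP=> _ /memv_addP[a aL [b /mem_conjv bL ->]].
case=> _ /memv_addP[_ /vlineP[k ->] [_ /vlineP[k' ->] ->]] ->.
have [LV Liso _] := Lmax p.
have /(mem_cplx_orthE (E_span p)) [h1 h2] := subvP LV _ zL.
rewrite !ipDr !ipZr (ipC z (gcplx _ _)) h1 (ipC z (gcplx _ _)) h2 !mulr0 Liso //.
by rewrite -[b]gconjK h // !addr0.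
Qed.

(** In a local frame s of L, the component in L of x solves the linear system whose
    matrix is the Gram matrix < s i, conj (s j) >, invertible by
    [L_pair_conj_nondeg], and whose right-hand side is smooth because
    < x, conj (s j) > only sees the component in L. *)
Lemma contact_endo_smooth : csubbundle L ->
  smooth_endo (fun p => contact_endo (L p) (e1 p) (e2 p)).
Proof.
move=> subL U x oU sx; apply: smooth_section_local => p Up.
have [U' [r [s [[oU' U'p] ss sb]]]] := subL p.
exists U'; split=> //; set O := U `&` U'.
have oO : open O by exact: openI.
have sO i : csmooth_section O (s i).
  by case: (ss i) => h1 h2; split; apply: smooth_sectionW (_ : O `<=` U') _ => // q [].
have sxO : smooth_section O x by apply: smooth_sectionW sx => q [].
(* the Gram matrix of the frame against its conjugate *)
pose G q : 'M[R[i]]_r := \matrix_(i, j) ip (s i q) (gconj (s j q)).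
have sG i j : csmooth_fun O (fun q => G q i j).
  apply: csmooth_fun_ext (csmooth_fun_ip oO (sO i) (csmooth_section_conj oO (sO j))) => q.
  by rewrite mxE.
have sL q i : O q -> s i q \in L q.
  by case=> _ /sb h; apply: (basis_mem h); apply/tnthP; exists i; rewrite tnth_mktuple.
have TN q (i : 'I_r) : [tuple s i q | i < r]`_i = s i q by rewrite -tnth_nth tnth_mktuple.
have coordL q z : O q -> z \in L q -> exists c : 'rV[R[i]]_r, z = \sum_i c 0 i *: s i q.
  case=> _ /sb h zL; exists (\row_i coord [tuple s i q | i < r] i z).
  rewrite {1}(coord_basis h zL); apply: eq_bigr => i _.
  by rewrite mxE TN.
have detG q : O q -> \det (G q) != 0.
  move=> Oq; apply/negP => /det0P [c c0 cG].
  have z0 : \sum_i c 0 i *: s i q = 0.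
    apply: (@L_pair_conj_nondeg q); first by apply: memv_suml => i _; apply: memvZ; exact: sL.
    move=> w /(coordL q w Oq) [d ->].
    have -> : gconj (\sum_i d 0 i *: s i q) = \sum_i (d 0 i)^*%C *: gconj (s i q).
      elim: (index_enum _) => [|i l IH]; first by rewrite !big_nil gconj0.
      by rewrite !big_cons gconjP IH.
    rewrite (linear_sum (ip _ : _ -> (R[i])^o)) big1 //= => j _; rewrite ipZr.
    have /(congr1 (fun m : 'rV_r => m 0 j)) := cG; rewrite !mxE => cGj.
    have S0 : ip (gconj (s j q)) (\sum_i c 0 i *: s i q) = 0.
      rewrite (linear_sum (ip (gconj (s j q)) : _ -> (R[i])^o)).
      apply: etrans cGj; apply: eq_bigr => i _.
      by rewrite /= ipZr mxE (ipC (gconj _)).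
    by rewrite ipC S0 mulr0.
  have := sb q Oq.2; rewrite basisEfree => /andP[/freeP fr _].
  move/eqP: c0; apply; apply/rowP => i; rewrite mxE; apply: (fr (fun i => c 0 i)).
  by apply: etrans z0; apply: eq_bigr => j _; rewrite TN.
pose b j q := ip (gcplx (x q) 0) (gconj (s j q)).
have sb' j : csmooth_fun O (b j).
  exact: (csmooth_fun_ip oO (csmooth_section_real oO sxO) (csmooth_section_conj oO (sO j))).
pose c i q := \sum_j b j q * ((\det (G q))^-1 * \adj (G q) j i).
have sc i : csmooth_fun O (c i).
  exact: (csmooth_fun_sum oO _ (fun j =>
    csmooth_funM oO (sb' j) (csmooth_fun_invmx oO sG detG j i))).
have projE q : O q -> Lproj (L q) (e1 q) (e2 q) (x q) = \sum_i c i q *: s i q.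
  move=> Oq; set z := Lproj _ _ _ _.
  have zL : z \in L q by exact: Lproj_mem.
  have [d dE] := coordL q z Oq zL.
  have bE j : b j q = (d *m G q) 0 j.
    have [LV Liso _] := Lmax q.
    have wL := sL q j Oq; set w := s j q in wL *.
    have [h1 h2 h3 h4] := L_orth (E_span q) (Lmax q) wL.
    have E1 : ip (gcplx (x q) 0) (gconj w) = ip z (gconj w) + ip (gconj z) (gconj w).
      rewrite -ipDl; have -> : z + gconj z = gcplx (perp (e1 q) (e2 q) (x q)) 0.
        rewrite -(Lproj_re (E_span q) (e11 q) (e22 q) (e12 q) (Lmax q) (Lconj q)) -/z.
        apply: gcplx_inj; rewrite ?gReD ?gImD ?gRe_gconj ?gIm_gconj ?gRe_gcplx ?gIm_gcplx ?subrr //.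
        by rewrite -[2]natr1 scalerDl scale1r.
      rewrite !ip_cplx gRe_gconj gIm_gconj !gRe_gcplx !gIm_gcplx !ip0l !ipNr.
      by rewrite (ip_perp _ h1 h2) (ip_perp _ h3 h4).
    rewrite /b E1 ip_gconj (Liso z w zL wL) conjc0 addr0 dE mxE ipC (linear_sum (ip _ : _ -> (R[i])^o)) /=.
    by apply: eq_bigr => i _; rewrite ipZr mxE (ipC (gconj _)).
  rewrite dE; apply: eq_bigr => i _; congr (_ *: _).
  have -> : c i q = ((d *m G q) *m invmx (G q)) 0 i.
    rewrite [in RHS]mxE; apply: eq_bigr => j _; rewrite bE.
    by congr (_ * _); rewrite /invmx unitmxE unitfE (detG q Oq) [RHS]mxE.
  by rewrite mulmxK // unitmxE unitfE detG.
have sI i : smooth_section O (fun q => gIm (s i q)) by exact: (sO i).2.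
have sR i : smooth_section O (fun q => gRe (s i q)) by exact: (sO i).1.
have sT i := smooth_sectionD oO (smooth_sectionZ oO (sc i).1 (sI i))
  (smooth_sectionZ oO (sc i).2 (sR i)).
have := smooth_sectionZ oO (@smooth_fun_cst _ _ M O (-2)) (smooth_section_sum (index_enum 'I_r) oO sT).
apply: (smooth_section_ext oO) => q Oq.
rewrite lfunE /= /contact_fun projE // gIm_sum; congr (_ *: _).
by apply: eq_bigr => i _; rewrite gImZ.
Qed.

End ContactSmooth.

(** * Brackets of isotropic sections *)

Lemma sub_summand (V : zmodType) (a b u : V) x : a + b = u -> a - x = u - x - b.
Proof. by move=> <-; rewrite addrAC addrK. Qed.

Lemma rescale_alg (V : zmodType) (g b c : V) : - c + (- b + g) = g + (- b - c).
Proof. by rewrite !addrA [RHS](AC 3 (3*2*1)). Qed.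

Section Frames.
Context {R : realType} {n : nat} {M : manifold R n}.
Implicit Types (p q : M) (f h k : M -> R) (x y z : M -> gfiber R n).
Local Notation smooth := (smooth_section setT).
#[local] Opaque dfun gdiff dorfman.

Lemma dor0r p x : smooth x -> dorfman x (fun _ => 0) p = 0.
Proof. by move=> sx; rewrite dorfmanE -[emb (fun=> 0)]/(fun=> (0, (0, 0))) (ebr_const_r p _ sx). Qed.

(** The bracket is skew up to the differential of the inner product. *)
Lemma dor_anti p x y (c : R) : smooth x -> smooth y ->
  (forall q, ip (x q) (y q) = c) -> dorfman y x p = - dorfman x y p.
Proof.
move=> sx sy xy; rewrite (dor_sym p sx sy).
rewrite (_ : (fun q => ip _ _) = fun=> c); last exact/funext.
by rewrite gdiff_cst scaler0 addr0.
Qed.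

Lemma dor_self p x : smooth x -> (forall q, ip (x q) (x q) = 0) -> dorfman x x p = 0.
Proof.
move=> sx xx; have /eqP := dor_anti p sx sx xx.
by rewrite -subr_eq0 opprK -mulr2n -scaler_nat scaler_eq0 pnatr_eq0 => /eqP.
Qed.

(** The invariance of the inner product, when its derivative vanishes. *)
Lemma ip_const_inv p x y z (c : R) : smooth x -> smooth y -> smooth z ->
  (forall q, ip (y q) (z q) = c) ->
  ip (dorfman x y p) (z p) = - ip (y p) (dorfman x z p).
Proof.
move=> sx sy sz yz; have := dor_inv p sx sy sz.
rewrite (_ : (fun q => ip _ _) = fun=> c); last exact/funext.
by rewrite dfun_cst => /esym/eqP; rewrite addr_eq0 => /eqP.
Qed.

Section PrPerp.
Variables (E : M -> {vspace gfiber R n}) (p : M) (e1 e2 : gfiber R n).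
Hypothesis E_span : E p = <<[:: e1; e2]>>%VS.
Hypotheses (e11 : ip e1 e1 = 0) (e22 : ip e2 e2 = 0) (e12 : ip e1 e2 = 2^-1).

Lemma mem_E a b : a *: e1 + b *: e2 \in E p.
Proof.
rewrite E_span span_cons span_seq1.
by apply: memv_add; apply: memvZ; exact: memv_line.
Qed.

Lemma mem_E_ex u : u \in E p -> exists a b, u = a *: e1 + b *: e2.
Proof.
rewrite E_span span_cons span_seq1.
by case/memv_addP=> _ /vlineP[a ->] [_ /vlineP[b ->] ->]; exists a, b.
Qed.

Lemma pr_perpE u : pr_perp E p u = perp e1 e2 u.
Proof.
have disj : (orthv (E p) :&: E p)%VS = 0%VS :> {vspace gfiber R n}.
  apply/eqP; rewrite -subv0; apply/subvP => v; rewrite memv_cap memv0.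
  case/andP=> /(mem_orthE E_span) [h1 h2] /mem_E_ex [a [b vE]].
  have := perp_combination e11 e22 e12 a b (ip0l e1) (ip0l e2).
  by rewrite add0r -vE (perp_id (x := v)) ?(ipC v) // => ->.
have [h1 h2] := perpP e11 e22 e12 u.
have xU : perp e1 e2 u \in orthv (E p).
  by apply/(mem_orthE E_span); rewrite ipC h1 ipC h2.
have wV : u - perp e1 e2 u \in E p.
  have -> : u - perp e1 e2 u = (2 * ip u e2) *: e1 + (2 * ip u e1) *: e2.
    by rewrite /perp !opprD !opprK !addrA subrr add0r.
  exact: mem_E.
have uUV : u \in (orthv (E p) + E p)%VS.
  by apply/memv_addP; exists (perp e1 e2 u) => //; exists (u - perp e1 e2 u); rewrite // addrC subrK.
have piE := daddv_pi_add disj uUV.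
set a := daddv_pi (orthv (E p)) (E p) u in piE; set b := daddv_pi _ _ u in piE.
have aU : a \in orthv (E p) by exact: memv_pi.
have bV : b \in E p by exact: memv_pi.
rewrite /pr_perp -/a; apply/eqP; rewrite -subr_eq0 -memv0 -disj memv_cap memvB //=.
rewrite (sub_summand (perp e1 e2 u) piE); exact: memvB.
Qed.

End PrPerp.

Variables (e1 e2 : M -> gfiber R n).
Hypotheses (s1 : smooth e1) (s2 : smooth e2).
Hypotheses (e11 : forall p, ip (e1 p) (e1 p) = 0)
  (e22 : forall p, ip (e2 p) (e2 p) = 0) (e12 : forall p, ip (e1 p) (e2 p) = 2^-1).

(** The Leibniz rules give the derivatives of h and k along e1 and e2 and the term
    k dh; as h k is flat at p, they combine into the projection of k dh. *)
Lemma rescale p h k : smooth_fun setT h -> smooth_fun setT k ->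
  (forall v, dfun p (fun q => h q * k q) v = 0) ->
  dorfman (fun q => h q *: e1 q) (fun q => k q *: e2 q) p =
  (h p * k p) *: dorfman e1 e2 p + k p *: perp (e1 p) (e2 p) (gdiff h p).
Proof.
move=> sh sk hk; have ske := smooth_sectionZ openT sk s2.
rewrite (dorZl p sh s1 ske) (dorZr p sk s1 s2) scalerDr !scalerA.
have -> : 2 * ip (e1 p) (k p *: e2 p) = k p.
  by rewrite ipZr e12 mulrCA mulfV ?mulr1 // pnatr_eq0.
rewrite /perp !(ip_gdiff _ _ sh) !scalerBr !scalerA -!addrA; congr (_ + _).
have -> : h p * dfun p k (e1 p).1 = - (k p * dfun p h (e1 p).1).
  apply/eqP; rewrite -addr_eq0; have := hk (e1 p).1.
  by rewrite (dfunM p _ sh sk) => ->.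
have -> : dfun p h (k p *: e2 p).1 = k p * dfun p h (e2 p).1.
  have := dfun_lin p (k p) (e2 p).1 0 sh.
  by rewrite addr0 (_ : dfun p h 0 = 0) ?addr0 //; have := dfun_lin p (-1) 0 0 sh;
   rewrite scaler0 addr0 mulN1r addNr.
by rewrite scaleNr; exact: rescale_alg.
Qed.

End Frames.

(** * Tensoriality of the Nijenhuis expression *)

Section NijenhuisIdentities.
Context {R : comRingType} {V : lmodType R} (j : {linear V -> V}).
Implicit Types a b c d s t x y u : V.

Lemma nij_add_alg a1 a2 b1 b2 c1 c2 d1 d2 :
  a1 + a2 - (b1 + b2) - j (c1 + c2 + (d1 + d2)) =
  a1 - b1 - j (c1 + d1) + (a2 - b2 - j (c2 + d2)).
Proof.
by rewrite !(linearD j) !opprD (AC ((2*2)*(2*2)) (((1*3)*(5*7))*((2*4)*(6*8)))).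
Qed.

Lemma nij_anti_alg a b c d s t :
  - a + t - (- b + t) - j (- d + s + (- c - s)) = - (a - b - j (c + d)).
Proof.
have -> : - d + s + (- c - s) = - (c + d).
  by rewrite (AC (2*2) ((3*1)*(2*4))) /= subrr addr0 opprD.
rewrite (linearN j) !opprD !opprK (AC (2*2) ((1*3)*(2*4))) /= subrr addr0.
by [].
Qed.

(** The terms with a factor df cancel between the four brackets since J is
    orthogonal and skew, those with a derivative of f since J^2 = -1. *)
Lemma nij_scale_alg (f g h k m : R) a b c d t x y : j x = y -> j y = - x ->
  f *: a - h *: y + k *: t - (f *: b - g *: x + k *: t)
  - j (f *: c - g *: y + (2 * - m) *: t + (f *: d - h *: x + (2 * m) *: t)) =
  f *: (a - b - j (c + d)).
Proof.
move=> jx jy.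
have -> : f *: c - g *: y + (2 * - m) *: t + (f *: d - h *: x + (2 * m) *: t) =
    f *: (c + d) - g *: y - h *: x.
  rewrite mulrN scaleNr scalerDr (AC (3*3) ((1*4)*2*5*(3*6))) /=.
  by rewrite addNr addr0.
have jZ r u : j (r *: u) = r *: j u by rewrite linearZ.
rewrite !(linearB j) !jZ /= jx jy !scalerBr scalerN !opprD !opprK.
rewrite (AC ((3*3)*3) ((1*4*7)*(3*6)*(2*9)*(5*8))) /= subrr addNr.
by rewrite addrN !addr0.
Qed.

Lemma nij_J_alg a b c d : (forall u, j (j u) = - u) ->
  - d - c - j (- b + a) = - j (a - b - j (c + d)).
Proof.
move=> jj; rewrite !linearB jj opprK (addrC (- b)) linearB !opprD !opprK.
by rewrite [RHS]addrC; congr (_ + _); rewrite addrC.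
Qed.

End NijenhuisIdentities.

Section Nijenhuis.
Context {R : realType} {n : nat} {M : manifold R n}.
Implicit Types (p q : M) (f : M -> R) (X Y Z : M -> efiber R n).
Variable J : M -> 'End(efiber R n).
Hypothesis SJ : Sek0 J.
Local Notation smooth := (smooth_esection setT).
#[local] Opaque dfun d_fun ebracket.

Lemma eapp_smooth X : smooth X -> smooth (eapp J X).
Proof. exact: (sek_smooth SJ openT). Qed.

Lemma eappD X Y : eapp J (fun q => X q + Y q) = (fun q => eapp J X q + eapp J Y q).
Proof. by apply/funext => q; rewrite /eapp linearD. Qed.

Lemma eappZ f X : eapp J (fun q => f q *: X q) = (fun q => f q *: eapp J X q).
Proof. by apply/funext => q; rewrite /eapp linearZ. Qed.

Lemma eappJ X : eapp J (eapp J X) = (fun q => (fun=> -1 : R) q *: X q).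
Proof. by apply/funext => q; rewrite /eapp (sek_square SJ) scaleN1r. Qed.

Lemma eip_J p u v : eip (J p u) (J p v) = eip u v.
Proof. by rewrite (sek_skew SJ) (sek_square SJ) eipNr opprK. Qed.

(** The expression whose vanishing is the integrability of J. *)
Definition nijenhuis X Y p : efiber R n :=
  ebracket (eapp J X) (eapp J Y) p - ebracket X Y p
  - J p (ebracket (eapp J X) Y p + ebracket X (eapp J Y) p).

Lemma nijDl p X Y Z : smooth X -> smooth Y -> smooth Z ->
  nijenhuis (fun q => X q + Y q) Z p = nijenhuis X Z p + nijenhuis Y Z p.
Proof.
move=> sX sY sZ; rewrite /nijenhuis eappD.
have jX := eapp_smooth sX; have jY := eapp_smooth sY; have jZ := eapp_smooth sZ.
rewrite (ebrDl p jX jY jZ) (ebrDl p sX sY sZ) (ebrDl p jX jY sZ) (ebrDl p sX sY jZ).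
exact: nij_add_alg.
Qed.

(** The four differentials of inner products cancel, J being orthogonal and
    skew. *)
Lemma nij_anti p X Y : smooth X -> smooth Y -> nijenhuis Y X p = - nijenhuis X Y p.
Proof.
move=> sX sY; rewrite /nijenhuis; have jX := eapp_smooth sX; have jY := eapp_smooth sY.
rewrite (ebr_sym p jX jY) (ebr_sym p sX sY) (ebr_sym p sX jY) (ebr_sym p jX sY).
have -> : (fun q => eip (eapp J X q) (eapp J Y q)) = (fun q => eip (X q) (Y q)).
  by apply/funext => q; rewrite /eapp eip_J.
have E : cofm (d_fun (fun q => eip (eapp J X q) (Y q)) p) =
    - cofm (d_fun (fun q => eip (X q) (eapp J Y q)) p).
  have -> : (fun q => eip (eapp J X q) (Y q)) = (fun q => - eip (X q) (eapp J Y q)).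
    by apply/funext => q; rewrite /eapp (sek_skew SJ).
  have -> : (fun q => - eip (X q) (eapp J Y q)) =
      (fun q => (fun=> -1 : R) q * eip (X q) (eapp J Y q)).
    by apply/funext => q; rewrite mulN1r.
  rewrite -[RHS]scaleN1r -cofmZ; congr cofm; rewrite !d_funE; apply/rowP => j; rewrite !mxE.
  rewrite (dfunM p _ (@smooth_fun_cst _ _ M setT (-1)) (smooth_fun_eip sX jY)).
  by rewrite dfun_cst mulr0 addr0.
rewrite E scalerN; exact: nij_anti_alg.
Qed.

Lemma nijDr p X Y Z : smooth X -> smooth Y -> smooth Z ->
  nijenhuis X (fun q => Y q + Z q) p = nijenhuis X Y p + nijenhuis X Z p.
Proof.
move=> sX sY sZ; rewrite (nij_anti p (smooth_esectionD sY sZ) sX) (nijDl p sY sZ sX).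
by rewrite opprD -!nij_anti.
Qed.

Lemma nijZl p f X Y : smooth_fun setT f -> smooth X -> smooth Y ->
  nijenhuis (fun q => f q *: X q) Y p = f p *: nijenhuis X Y p.
Proof.
move=> sf sX sY; rewrite /nijenhuis eappZ.
have jX := eapp_smooth sX; have jY := eapp_smooth sY.
rewrite (ebrZl p sf jX jY) (ebrZl p sf sX sY) (ebrZl p sf jX sY) (ebrZl p sf sX jY).
rewrite {2 4 5}/eapp eip_J (sek_skew SJ).
have -> : J p (X p) = eapp J X p by [].
have jj : J p (eapp J X p) = - X p by rewrite /eapp (sek_square SJ).
exact: nij_scale_alg.
Qed.

Lemma nijZr p f X Y : smooth_fun setT f -> smooth X -> smooth Y ->
  nijenhuis X (fun q => f q *: Y q) p = f p *: nijenhuis X Y p.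
Proof.
move=> sf sX sY; rewrite (nij_anti p (smooth_esectionZ sf sY) sX) (nijZl p sf sY sX).
by rewrite -scalerN -(nij_anti p sY sX).
Qed.

Let ebrN1l p X Y : smooth X -> smooth Y ->
  ebracket (fun q => (fun=> -1 : R) q *: X q) Y p = - ebracket X Y p.
Proof.
move=> sX sY; rewrite (ebrZl p (@smooth_fun_cst _ _ M setT (-1)) sX sY) dfun_cst.
have -> : d_fun (fun=> -1) p = 0.
  by rewrite d_funE; apply/rowP => j; rewrite !mxE dfun_cst.
by rewrite cofm0 scaler0 scale0r addr0 subr0 scaleN1r.
Qed.

(** Tensoriality gives the vanishing on d/dt and dt from that on e1 and e2. *)
Lemma nijJl p X Y : smooth X -> smooth Y ->
  nijenhuis (eapp J X) Y p = - J p (nijenhuis X Y p).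
Proof.
move=> sX sY; have jX := eapp_smooth sX; have jY := eapp_smooth sY.
rewrite /nijenhuis eappJ (ebrN1l p sX sY) (ebrN1l p sX jY).
exact: nij_J_alg (sek_square SJ p).
Qed.

Lemma nijJr p X Y : smooth X -> smooth Y ->
  nijenhuis X (eapp J Y) p = - J p (nijenhuis X Y p).
Proof.
move=> sX sY; rewrite (nij_anti p (eapp_smooth sY) sX) (nijJl p sY sX).
by rewrite (nij_anti p sX sY) (linearN (J p)) !opprK.
Qed.

End Nijenhuis.

(** * Bracket identities of an integrable J *)

Lemma eip_dt_form (R : realType) n (u : efiber R n) : eip u (0, (0, 1)) = 2^-1 * u.2.1.
Proof. by rewrite /eip /= ip0r add0r mulr1 mul0r addr0. Qed.
Lemma eip_dt_vec (R : realType) n (u : efiber R n) : eip u (0, (1, 0)) = 2^-1 * u.2.2.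
Proof. by rewrite /eip /= ip0r add0r mulr0 add0r mul1r. Qed.

Section IntegrableTriple.
Context {R : realType} {n : nat} {M : manifold R n}.
Implicit Types (p q : M) (x y : M -> gfiber R n).
Local Notation smooth := (smooth_section setT).

Definition perp_section (e1 e2 x : M -> gfiber R n) : Prop :=
  smooth x /\ forall q, ip (x q) (e1 q) = 0 /\ ip (x q) (e2 q) = 0.

Definition endo_app (Phi : M -> 'End(gfiber R n)) x : M -> gfiber R n :=
  fun q => Phi q (x q).

(** The vanishing of the Nijenhuis expression on sections orthogonal to E and on the
    frame, in terms of brackets on M only. *)
Record integrable_triple (Phi : M -> 'End(gfiber R n)) (e1 e2 : M -> gfiber R n) : Prop := {
  triple_frame : forall p, dorfman e1 e2 p = 0 ;
  triple_perp : forall x y, perp_section e1 e2 x -> perp_section e1 e2 y -> forall p,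
    Phi p (dorfman x y p - dorfman (endo_app Phi x) (endo_app Phi y) p) =
      dorfman x (endo_app Phi y) p + dorfman (endo_app Phi x) y p /\
    Phi p (dorfman x (endo_app Phi y) p + dorfman (endo_app Phi x) y p) =
      - (dorfman x y p - dorfman (endo_app Phi x) (endo_app Phi y) p) ;
  triple_e1 : forall x, perp_section e1 e2 x -> forall p,
    Phi p (dorfman x e1 p) = dorfman (endo_app Phi x) e1 p ;
  triple_e2 : forall x, perp_section e1 e2 x -> forall p,
    Phi p (dorfman x e2 p) = dorfman (endo_app Phi x) e2 p }.

(** The two members of the frame play the same role; this halves the arguments
    below. *)
Lemma contact_triple_sym (Phi : M -> 'End(gfiber R n)) (e1 e2 : M -> gfiber R n) :
  contact_triple Phi e1 e2 -> contact_triple Phi e2 e1.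
Proof.
case=> s s1 s2 h11 h22 h12 sk k1 k2 sq; split=> //.
  by move=> p; rewrite ipC.
by move=> p u; rewrite sq -!addrA; congr (_ + _); rewrite addrC.
Qed.

Section ContactTriple.
Variables (Phi : M -> 'End(gfiber R n)) (e1 e2 : M -> gfiber R n).
Hypothesis CT : contact_triple Phi e1 e2.

Lemma ct_orth p u : ip (Phi p u) (e1 p) = 0 /\ ip (Phi p u) (e2 p) = 0.
Proof. by rewrite !(ct_skew CT) (ct_ker1 CT) (ct_ker2 CT) !ip0r oppr0. Qed.

Lemma ct_square_perp p u : ip u (e1 p) = 0 -> ip u (e2 p) = 0 -> Phi p (Phi p u) = - u.
Proof. by move=> h1 h2; rewrite (ct_square CT) h1 h2 !mulr0 !scale0r !addr0. Qed.

Lemma perp_section_Phi x : smooth x -> perp_section e1 e2 (endo_app Phi x).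
Proof.
move=> sx; split; first exact: (ct_smooth CT openT sx).
by move=> q; exact: ct_orth.
Qed.

Lemma integrable_triple_sym : integrable_triple Phi e1 e2 -> integrable_triple Phi e2 e1.
Proof.
have swap x : perp_section e2 e1 x -> perp_section e1 e2 x.
  by case=> sx h; split=> // q; case: (h q).
case=> c0 c1 c2 c3; split.
- by move=> p; rewrite (dor_anti p (ct_smooth1 CT) (ct_smooth2 CT) (ct_ip12 CT)) c0 oppr0.
- by move=> x y /swap px /swap py p; exact: c1.
- by move=> x /swap px p; exact: c3.
- by move=> x /swap px p; exact: c2.
Qed.

End ContactTriple.

Section FromJ.
Variable J : M -> 'End(efiber R n).
Hypotheses (SJ : Sek0 J) (IJ : integrable_Sek0 J).
Local Notation Phi := (Phi_of J).
Local Notation e1 := (e1_of J).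
Local Notation e2 := (e2_of J).
Hypothesis CT : contact_triple Phi e1 e2.

Definition Jres p (u : gfiber R n) : gfiber R n := (J p (u, 0)).1.
Lemma Jres_linear p : linear (Jres p).
Proof.
move=> k u v; rewrite /Jres.
have -> : (k *: u + v, 0) = k *: (u, 0) + (v, 0) :> efiber R n.
  transitivity (k *: u + v, k *: (0 : R^o * R^o) + 0) => //.
  by rewrite scaler0 addr0.
by rewrite linearP.
Qed.
HB.instance Definition _ p :=
  GRing.isLinear.Build R (gfiber R n) (gfiber R n) *:%R (Jres p) (Jres_linear p).

Lemma Phi_ofE p u : Phi p u = (J p (u, 0)).1.
Proof. by rewrite /Phi_of (lfunE (Jres p)). Qed.

Lemma J_dt_vec p : J p (0, (1, 0)) = (e1 p, 0).
Proof. by rewrite [LHS]surjective_pairing (sek_span SJ). Qed.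
Lemma J_dt_form p : J p (0, (0, 1)) = (e2 p, 0).
Proof. by rewrite [LHS]surjective_pairing (sek_span SJ). Qed.

(** J is determined by the triple: since J^* = -J, the components of J x along d/dt and
    dt are inner products of x with J(dt) and J(d/dt). *)
Lemma JE p u : J p (u, 0) = (Phi p u, (- (2 * ip u (e2 p)), - (2 * ip u (e1 p)))).
Proof.
have two : (2 : R) != 0 by rewrite pnatr_eq0.
rewrite [LHS]surjective_pairing Phi_ofE; congr (_, _).
rewrite [LHS]surjective_pairing; congr (_, _); apply: (mulfI (invr_neq0 two)).
  have := sek_skew SJ p (u, 0) (0, (0, 1)); rewrite J_dt_form eip_dt_form.
  rewrite (eip_pair u (e2 p)) => ->.
  by rewrite mulrN mulrA mulVf // mul1r.
have := sek_skew SJ p (u, 0) (0, (1, 0)); rewrite J_dt_vec eip_dt_vec.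
rewrite (eip_pair u (e1 p)) => ->.
by rewrite mulrN mulrA mulVf // mul1r.
Qed.

Lemma J_perp p u : ip u (e1 p) = 0 -> ip u (e2 p) = 0 -> J p (u, 0) = (Phi p u, 0).
Proof. by move=> h1 h2; rewrite JE h1 h2 !mulr0 oppr0. Qed.

Lemma eapp_emb x : perp_section e1 e2 x -> eapp J (emb x) = emb (endo_app Phi x).
Proof. by case=> _ h; apply/funext => q; rewrite /eapp /emb J_perp; case: (h q). Qed.

Lemma eapp_dt_vec : eapp J (fun=> (0, (1, 0))) = emb e1.
Proof. by apply/funext => q; rewrite /eapp J_dt_vec. Qed.
Lemma eapp_dt_form : eapp J (fun=> (0, (0, 1))) = emb e2.
Proof. by apply/funext => q; rewrite /eapp J_dt_form. Qed.

Let se1 : smooth e1 := ct_smooth1 CT.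
Let se2 : smooth e2 := ct_smooth2 CT.

Lemma emb_subr (a b : gfiber R n) : (a, (0, 0)) - (b, (0, 0)) = (a - b, (0, 0)) :> efiber R n.
Proof.
transitivity (a - b, ((0 - 0 : R^o), (0 - 0 : R^o))) => //.
by rewrite subr0.
Qed.
Lemma emb_addr (a b : gfiber R n) : (a, (0, 0)) + (b, (0, 0)) = (a + b, (0, 0)) :> efiber R n.
Proof.
transitivity (a + b, ((0 + 0 : R^o), (0 + 0 : R^o))) => //.
by rewrite addr0.
Qed.

Lemma nij_emb_alg p (a b c d : gfiber R n) :
  (a, (0, 0)) - (b, (0, 0)) - J p ((c, (0, 0)) + (d, (0, 0))) = 0 :> efiber R n ->
  (- (b - a), (0, 0)) = J p (d + c, (0, 0)).
Proof.
by rewrite emb_subr emb_addr addrC opprB => /eqP; rewrite addrC subr_eq0 (addrC d) => /eqP.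
Qed.

(** On (d/dt, dt) integrability gives [e1, e2] = 0; on (x, d/dt) and (x, dt) it
    gives the commutation with Phi; on (x, y) it says that J sends an element of TM
    + T^*M to such an element, which forces it to be orthogonal to E. *)
Lemma integrable_triple_of_J : integrable_triple Phi e1 e2.
Proof.
have nij X Y p : smooth_esection setT X -> smooth_esection setT Y -> nijenhuis J X Y p = 0.
  by move=> sX sY; exact: (IJ sX sY p).
have frame p : dorfman e1 e2 p = 0.
  have := nij _ _ p (const_smooth (M := M) (1, 0)) (const_smooth (0, 1)).
  rewrite /nijenhuis eapp_dt_vec eapp_dt_form ebracket_emb ebr_const_const.
  rewrite (ebr_const_r p _ se1) (ebr_const_emb p _ se2) addr0 (linear0 (J p)) !subr0.
  by move/(congr1 fst).
have ce (e : M -> gfiber R n) (r : R^o * R^o) x p : smooth e ->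
    eapp J (fun=> (0, r)) = emb e -> perp_section e1 e2 x ->
    (forall q, ip (x q) (e q) = 0) ->
    Phi p (dorfman x e p) = dorfman (endo_app Phi x) e p.
  move=> se Je px xe; have [sx hx] := px.
  have sPx := (perp_section_Phi CT sx).1.
  have := nij _ _ p (emb_smooth sx) (const_smooth r).
  rewrite /nijenhuis (eapp_emb px) Je !ebracket_emb (ebr_const_r p _ sx).
  rewrite (ebr_const_r p _ sPx) subr0 add0r => /eqP; rewrite subr_eq0 => /eqP /(congr1 fst) /= ->.
  by rewrite Phi_ofE.
split=> //.
- move=> x y px py p; have [sx hx] := px; have [sy hy] := py.
  pose A := dorfman x y p - dorfman (endo_app Phi x) (endo_app Phi y) p.
  pose B := dorfman x (endo_app Phi y) p + dorfman (endo_app Phi x) y p.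
  change (Phi p A = B /\ Phi p B = - A).
  have N : ebracket (eapp J (emb x)) (eapp J (emb y)) p - ebracket (emb x) (emb y) p
    - J p (ebracket (eapp J (emb x)) (emb y) p + ebracket (emb x) (eapp J (emb y)) p) = 0.
    exact: nij (emb_smooth sx) (emb_smooth sy).
  rewrite (eapp_emb px) (eapp_emb py) !ebracket_emb in N.
  have H : (- A, (0, 0)) = J p (B, (0, 0)).
    exact: (@nij_emb_alg p (dorfman (endo_app Phi x) (endo_app Phi y) p)
      (dorfman x y p) (dorfman (endo_app Phi x) y p) (dorfman x (endo_app Phi y) p) N).
  move: H; rewrite JE => -[E1 E2 E3].
  have B2 : ip B (e2 p) = 0.
    by move/eqP: E2; rewrite eq_sym oppr_eq0 mulf_eq0 pnatr_eq0 => /eqP.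
  have B1 : ip B (e1 p) = 0.
    by move/eqP: E3; rewrite eq_sym oppr_eq0 mulf_eq0 pnatr_eq0 => /eqP.
  split; last by rewrite -E1.
  by rewrite -[A]opprK E1 linearN /= (ct_square_perp CT B1 B2) opprK.
- move=> x px p; apply: (ce e1 (1, 0)) => //; first exact: eapp_dt_vec.
  by move=> q; case: (px.2 q).
- move=> x px p; apply: (ce e2 (0, 1)) => //; first exact: eapp_dt_form.
  by move=> q; case: (px.2 q).
Qed.

End FromJ.
End IntegrableTriple.

(** * The cone endomorphism of a triple *)

Section ConeFun.
Context {R : realType} {n : nat}.

(** The only endomorphism of E'(M) in Sek_0 with associated triple (Phi, e1, e2), by
    [JE]. *)
Definition cone_fun (Phi : 'End(gfiber R n)) (e1 e2 : gfiber R n) (X : efiber R n) : efiber R n :=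
  (Phi X.1 + X.2.1 *: e1 + X.2.2 *: e2, (- (2 * ip X.1 e2) : R^o, - (2 * ip X.1 e1) : R^o)).

Lemma cone_fun_linear Phi e1 e2 : linear (cone_fun Phi e1 e2).
Proof.
move=> k X Y; rewrite /cone_fun.
transitivity (k *: (Phi X.1 + X.2.1 *: e1 + X.2.2 *: e2) +
              (Phi Y.1 + Y.2.1 *: e1 + Y.2.2 *: e2),
  (k * - (2 * ip X.1 e2) + - (2 * ip Y.1 e2) : R^o,
   k * - (2 * ip X.1 e1) + - (2 * ip Y.1 e1) : R^o)) => //.
congr (_, (_, _)).
- have -> : (k *: X + Y).2.1 = k * X.2.1 + Y.2.1 by [].
  have -> : (k *: X + Y).2.2 = k * X.2.2 + Y.2.2 by [].
  rewrite /= linearP !scalerDl !scalerDr !scalerA.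
  by rewrite (AC ((2*2)*2) ((1*3*5)*(2*4*6))).
- by rewrite /= ip_linl; ring.
- by rewrite /= ip_linl; ring.
Qed.
HB.instance Definition _ Phi e1 e2 :=
  GRing.isLinear.Build R (efiber R n) (efiber R n) *:%R (cone_fun Phi e1 e2)
    (cone_fun_linear Phi e1 e2).

End ConeFun.

Lemma nij_emb_zero (R : realType) n (J : 'End(efiber R n)) (a b c d : gfiber R n) :
  J (c + d, (0, 0)) = (a - b, (0, 0)) ->
  (a, (0, 0)) - (b, (0, 0)) - J ((c, (0, 0)) + (d, (0, 0))) = 0 :> efiber R n.
Proof. by move=> h; rewrite emb_subr emb_addr h subrr. Qed.

Section ConeEndo.
Context {R : realType} {n : nat} {M : manifold R n}.
Implicit Types (p q : M) (x y : M -> gfiber R n) (X Y : M -> efiber R n).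
Local Notation smooth := (smooth_section setT).
Local Notation esmooth := (smooth_esection setT).
Variables (Phi : M -> 'End(gfiber R n)) (e1 e2 : M -> gfiber R n).
Hypothesis CT : contact_triple Phi e1 e2.

Definition cone_endo p : 'End(efiber R n) := linfun (cone_fun (Phi p) (e1 p) (e2 p)).
Local Notation J := cone_endo.

Lemma cone_endoE p (X : efiber R n) : J p X =
  (Phi p X.1 + X.2.1 *: e1 p + X.2.2 *: e2 p,
   (- (2 * ip X.1 (e2 p)) : R^o, - (2 * ip X.1 (e1 p)) : R^o)).
Proof. by rewrite /cone_endo lfunE. Qed.

Lemma e1_of_cone : e1_of J = e1.
Proof.
by apply/funext => p; rewrite /e1_of cone_endoE /= linear0 scale0r scale1r add0r addr0.
Qed.
Lemma e2_of_cone : e2_of J = e2.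
Proof.
by apply/funext => p; rewrite /e2_of cone_endoE /= linear0 scale0r scale1r !add0r.
Qed.
Lemma Phi_of_cone : Phi_of J = Phi.
Proof.
apply/funext => p; apply/lfunP => u; rewrite Phi_ofE cone_endoE /=.
by rewrite !scale0r !addr0.
Qed.

Lemma Sek0_cone : Sek0 J.
Proof.
split.
- move=> U X oU [sX1 sX2 sX3].
  have s1 : smooth_section U e1 by apply: smooth_sectionW (ct_smooth1 CT).
  have s2 : smooth_section U e2 by apply: smooth_sectionW (ct_smooth2 CT).
  have sc := @smooth_fun_cst _ _ M U 2.
  split.
  + apply: (smooth_section_ext oU) (smooth_sectionD oU (smooth_sectionD oU
      (ct_smooth CT oU sX1) (smooth_sectionZ oU sX2 s1)) (smooth_sectionZ oU sX3 s2)) => q _.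
    by rewrite /gpart /eapp cone_endoE.
  + apply: (smooth_fun_ext oU) (smooth_funN oU (smooth_funM oU sc (smooth_fun_ip oU sX1 s2))) => q _.
    by rewrite /dt_vec /eapp cone_endoE.
  + apply: (smooth_fun_ext oU) (smooth_funN oU (smooth_funM oU sc (smooth_fun_ip oU sX1 s1))) => q _.
    by rewrite /dt_form /eapp cone_endoE.
- move=> p [u [f g]]; rewrite !cone_endoE /=.
  have e12 := ct_ip12 CT p; have e21 : ip (e2 p) (e1 p) = 2^-1 by rewrite ipC.
  have [h1 h2] := ct_orth CT p u.
  transitivity (- u, ((- f : R^o), (- g : R^o))) => //; congr (_, (_, _)).
  + have PZ (k : R) w : Phi p (k *: w) = k *: Phi p w by rewrite linearZ.
    rewrite !(linearD (Phi p)) /= !PZ (ct_ker1 CT) (ct_ker2 CT) !scaler0 !addr0 (ct_square CT).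
    by rewrite !scaleNr (AC ((3*1)*1) (1*(2*5)*(3*4))) /= !subrr !addr0.
  + rewrite !ipDl !ipZl h2 (ct_ip22 CT) e12; by field.
  + rewrite !ipDl !ipZl h1 (ct_ip11 CT) e21; by field.
- move=> p [u [f g]] [v [f' g']]; rewrite !cone_endoE /eip /=.
  rewrite !ipDl !ipDr !ipZl !ipZr (ct_skew CT) (ipC (e1 p)) (ipC (e2 p)).
  by field.
- by move=> p r; rewrite cone_endoE /= !ip0l !mulr0 oppr0.
Qed.

(** Every section splits along the orthogonal of E and the frame. *)
Lemma frame_decomposition x : x = (fun q => perp (e1 q) (e2 q) (x q) +
   ((2 * ip (x q) (e2 q)) *: e1 q + (2 * ip (x q) (e1 q)) *: e2 q)).
Proof.
by apply/funext => q; rewrite /perp -[X in X + _]addrA -opprD subrK.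
Qed.

Lemma perp_section_perp x : smooth x ->
  perp_section e1 e2 (fun q => perp (e1 q) (e2 q) (x q)).
Proof.
move=> sx; have s1 := ct_smooth1 CT; have s2 := ct_smooth2 CT.
have sc := @smooth_fun_cst _ _ M setT 2.
split; last by move=> q; apply: perpP; [exact: ct_ip11 CT q|exact: ct_ip22 CT q|exact: ct_ip12 CT q].
exact: (smooth_sectionB openT (smooth_sectionB openT sx
  (smooth_sectionZ openT (smooth_funM openT sc (smooth_fun_ip openT sx s2)) s1))
  (smooth_sectionZ openT (smooth_funM openT sc (smooth_fun_ip openT sx s1)) s2)).
Qed.

Lemma cone_endo_perp p (A A' B : gfiber R n) :
  ip (Phi p A) (e1 p) = 0 /\ ip (Phi p A) (e2 p) = 0 ->
  Phi p A = B -> Phi p B = - A -> A' = - A -> J p (B, (0, 0)) = (A', (0, 0)).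
Proof.
move=> [h1 h2] hA hB ->; rewrite -hB -hA cone_endoE /= !scale0r !addr0 h1 h2.
by rewrite !mulr0 oppr0.
Qed.

Hypothesis C : integrable_triple Phi e1 e2.
Let SJ := Sek0_cone.
Let se1 : smooth e1 := ct_smooth1 CT.
Let se2 : smooth e2 := ct_smooth2 CT.

Let eapp_perp x : perp_section e1 e2 x -> eapp J (emb x) = emb (endo_app Phi x).
Proof.
move=> px; rewrite -[in RHS]Phi_of_cone; apply: (eapp_emb SJ).
by rewrite e1_of_cone e2_of_cone.
Qed.
Let eapp_vec : eapp J (fun=> (0, (1, 0))) = emb e1.
Proof. by rewrite (eapp_dt_vec SJ) e1_of_cone. Qed.
Let eapp_form : eapp J (fun=> (0, (0, 1))) = emb e2.
Proof. by rewrite (eapp_dt_form SJ) e2_of_cone. Qed.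

Let opp_const (r : R^o * R^o) : eapp J (eapp J (fun=> (0, r))) = (fun=> (0, - r)).
Proof.
rewrite (eappJ SJ); apply/funext => q /=; rewrite scaleN1r.
by transitivity ((- 0, - r) : efiber R n) => //; rewrite oppr0.
Qed.
Let eapp_e1 : eapp J (emb e1) = (fun=> (0, - (1, 0))).
Proof. by rewrite -eapp_vec opp_const. Qed.
Let eapp_e2 : eapp J (emb e2) = (fun=> (0, - (0, 1))).
Proof. by rewrite -eapp_form opp_const. Qed.

Let nij_perp_perp p x y : perp_section e1 e2 x -> perp_section e1 e2 y ->
  nijenhuis J (emb x) (emb y) p = 0.
Proof.
move=> px py; rewrite /nijenhuis (eapp_perp px) (eapp_perp py) !ebracket_emb.
have [h' h] := triple_perp C px py p.
have K : J p (dorfman x (endo_app Phi y) p + dorfman (endo_app Phi x) y p, (0, 0)) =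
    (dorfman (endo_app Phi x) (endo_app Phi y) p - dorfman x y p, (0, 0)).
  exact: (cone_endo_perp (ct_orth CT p _) h' h (esym (opprB _ _))).
exact: (@nij_emb_zero _ _ (J p) _ _ (dorfman (endo_app Phi x) y p)
  (dorfman x (endo_app Phi y) p)
  (etrans (congr1 (fun w => J p (w, (0, 0))) (addrC _ _)) K)).
Qed.

Let nij_perp_frame p x (e : M -> gfiber R n) (r : R^o * R^o) :
  smooth e -> eapp J (emb e) = (fun=> (0, r)) -> perp_section e1 e2 x ->
  Phi p (dorfman x e p) = dorfman (endo_app Phi x) e p ->
  Phi p (dorfman (endo_app Phi x) e p) = - dorfman x e p ->
  nijenhuis J (emb x) (emb e) p = 0.
Proof.
move=> se Je px h h'; have [sx _] := px; have [sPx _] := perp_section_Phi CT sx.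
rewrite /nijenhuis (eapp_perp px) Je !ebracket_emb (ebr_const_r p _ sx) (ebr_const_r p _ sPx).
rewrite addr0 sub0r -h cone_endoE /= !scale0r !addr0 h h'.
have := ct_orth CT p (dorfman x e p); rewrite h => -[-> ->]; rewrite !mulr0 oppr0.
have -> : ((- dorfman x e p, (0, 0)) : efiber R n) = - (dorfman x e p, (0, 0)).
  by transitivity (- dorfman x e p, ((- 0 : R^o), (- 0 : R^o))) => //; rewrite oppr0.
by rewrite subrr.
Qed.

Let nij_frame_frame p (e e' : M -> gfiber R n) (r r' : R^o * R^o) :
  smooth e -> smooth e' -> eapp J (emb e) = (fun=> (0, r)) ->
  eapp J (emb e') = (fun=> (0, r')) -> dorfman e e' p = 0 ->
  nijenhuis J (emb e) (emb e') p = 0.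
Proof.
move=> se se' Je Je' h; rewrite /nijenhuis Je Je' ebr_const_const ebracket_emb h.
rewrite (ebr_const_r p _ se) (ebr_const_emb p _ se') addr0 (linear0 (J p)).
by rewrite -[X in _ - X - _]/(0 : efiber R n) !subr0.
Qed.

Let perp_smooth x : smooth x -> perp_section e1 e2 (fun q => perp (e1 q) (e2 q) (x q)).
Proof. exact: perp_section_perp. Qed.

Let decompose X : esmooth X -> exists x f1 f2 f3 f4,
  [/\ perp_section e1 e2 x, [/\ smooth_fun setT f1, smooth_fun setT f2, smooth_fun setT f3 & smooth_fun setT f4] &
   X = (fun q => emb x q + (f1 q *: emb e1 q + (f2 q *: emb e2 q +
          (f3 q *: eapp J (emb e1) q + f4 q *: eapp J (emb e2) q))))].
Proof.
move=> [sX1 sX2 sX3].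
have sc := @smooth_fun_cst _ _ M setT 2.
exists (fun q => perp (e1 q) (e2 q) (X q).1), (fun q => 2 * ip (X q).1 (e2 q)),
  (fun q => 2 * ip (X q).1 (e1 q)), (fun q => - (X q).2.1), (fun q => - (X q).2.2).
split; [exact: perp_smooth sX1| |].
  split; [exact: smooth_funM openT sc (smooth_fun_ip openT sX1 se2)|
          exact: smooth_funM openT sc (smooth_fun_ip openT sX1 se1)|
          exact: smooth_funN openT sX2|exact: smooth_funN openT sX3].
apply/funext => q; rewrite eapp_e1 eapp_e2 /emb.
have E := congr1 (fun F : M -> gfiber R n => F q) (frame_decomposition (gpart X)).
rewrite /gpart /= in E.
transitivity (perp (e1 q) (e2 q) (X q).1 +
   ((2 * ip (X q).1 (e2 q)) *: e1 q + ((2 * ip (X q).1 (e1 q)) *: e2 q +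
     (- (X q).2.1 *: (0 : gfiber R n) + - (X q).2.2 *: (0 : gfiber R n)))),
   ((0 + ((2 * ip (X q).1 (e2 q)) * 0 + ((2 * ip (X q).1 (e1 q)) * 0 +
      (- (X q).2.1 * - 1 + - (X q).2.2 * - 0))) : R^o),
    (0 + ((2 * ip (X q).1 (e2 q)) * 0 + ((2 * ip (X q).1 (e1 q)) * 0 +
      (- (X q).2.1 * - 0 + - (X q).2.2 * - 1))) : R^o))) => //.
rewrite !scaler0 !addr0 -E !mulr0 oppr0 !mulr0 !add0r addr0 !mulrN1 !opprK.
by case: (X q) => a [b c].
Qed.

Let nij_gen p X (Y : M -> efiber R n) : esmooth X -> esmooth Y ->
  (forall y, perp_section e1 e2 y -> nijenhuis J X (emb y) p = 0) ->
  nijenhuis J X (emb e1) p = 0 -> nijenhuis J X (emb e2) p = 0 ->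
  nijenhuis J X Y p = 0.
Proof.
move=> sX sY hp h1 h2; have [y [f1 [f2 [f3 [f4 [py [s1 s2 s3 s4] ->]]]]]] := decompose sY.
have sE1 := emb_smooth se1; have sE2 := emb_smooth se2.
have sJ1 := eapp_smooth SJ sE1; have sJ2 := eapp_smooth SJ sE2.
have t4 := smooth_esectionZ s4 sJ2; have t3 := smooth_esectionZ s3 sJ1.
have t2 := smooth_esectionZ s2 sE2; have t1 := smooth_esectionZ s1 sE1.
have t34 := smooth_esectionD t3 t4; have t234 := smooth_esectionD t2 t34.
have t1234 := smooth_esectionD t1 t234.
rewrite (nijDr SJ p sX (emb_smooth py.1) t1234) (nijDr SJ p sX t1 t234).
rewrite (nijDr SJ p sX t2 t34) (nijDr SJ p sX t3 t4).
rewrite (nijZr SJ p s1 sX sE1) (nijZr SJ p s2 sX sE2) (nijZr SJ p s3 sX sJ1) (nijZr SJ p s4 sX sJ2).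
rewrite (nijJr SJ p sX sE1) (nijJr SJ p sX sE2) (hp y py) h1 h2 (linear0 (J p)).
by rewrite oppr0 !scaler0 !addr0.
Qed.

(** By tensoriality it suffices to evaluate on sections orthogonal to E, on e1, e2
    and on their images under J, which span the constants in d/dt and dt. *)
Lemma integrable_cone : integrable_Sek0 J.
Proof.
have sE1 := emb_smooth se1; have sE2 := emb_smooth se2.
have frame2 p x (e : M -> gfiber R n) :
    (forall x, perp_section e1 e2 x -> forall p,
       Phi p (dorfman x e p) = dorfman (endo_app Phi x) e p) ->
    perp_section e1 e2 x -> smooth e -> (forall q, ip (x q) (e q) = 0) ->
    Phi p (dorfman (endo_app Phi x) e p) = - dorfman x e p.
  move=> h px se _; have pPx := perp_section_Phi CT px.1.
  rewrite (h _ pPx p).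
  have -> : endo_app Phi (endo_app Phi x) = (fun q => - x q).
    by apply/funext => q; rewrite /endo_app (ct_square_perp CT) //; case: (px.2 q).
  exact: (dorNl p px.1 se).
have Ne1 p x : perp_section e1 e2 x -> nijenhuis J (emb x) (emb e1) p = 0.
  move=> px; apply: (nij_perp_frame se1 eapp_e1 px (triple_e1 C px p)).
  by apply: frame2 => //; [exact: triple_e1 C|move=> q; case: (px.2 q)].
have Ne2 p x : perp_section e1 e2 x -> nijenhuis J (emb x) (emb e2) p = 0.
  move=> px; apply: (nij_perp_frame se2 eapp_e2 px (triple_e2 C px p)).
  by apply: frame2 => //; [exact: triple_e2 C|move=> q; case: (px.2 q)].
have N11 p : nijenhuis J (emb e1) (emb e1) p = 0.
  exact: (nij_frame_frame se1 se1 eapp_e1 eapp_e1 (dor_self p se1 (ct_ip11 CT))).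
have N22 p : nijenhuis J (emb e2) (emb e2) p = 0.
  exact: (nij_frame_frame se2 se2 eapp_e2 eapp_e2 (dor_self p se2 (ct_ip22 CT))).
have N12 p : nijenhuis J (emb e1) (emb e2) p = 0.
  exact: (nij_frame_frame se1 se2 eapp_e1 eapp_e2 (triple_frame C p)).
have Nx p x Y : perp_section e1 e2 x -> esmooth Y -> nijenhuis J (emb x) Y p = 0.
  move=> px sY; exact: (nij_gen (emb_smooth px.1) sY
    (fun y py => nij_perp_perp p px py) (Ne1 p x px) (Ne2 p x px)).
have anti p X Y : esmooth X -> esmooth Y -> nijenhuis J X Y p = 0 -> nijenhuis J Y X p = 0.
  by move=> sX sY h; rewrite (nij_anti SJ p sX sY) h oppr0.
have N1 p Y : esmooth Y -> nijenhuis J (emb e1) Y p = 0.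
  move=> sY; exact: (nij_gen sE1 sY
    (fun y py => anti _ _ _ (emb_smooth py.1) sE1 (Ne1 p y py)) (N11 p) (N12 p)).
have N2 p Y : esmooth Y -> nijenhuis J (emb e2) Y p = 0.
  move=> sY; exact: (nij_gen sE2 sY
    (fun y py => anti _ _ _ (emb_smooth py.1) sE2 (Ne2 p y py))
    (anti _ _ _ sE1 sE2 (N12 p)) (N22 p)).
move=> X Y sX sY p.
exact: (nij_gen sX sY (fun y py => anti _ _ _ (emb_smooth py.1) sX (Nx p y X py sX))
  (anti _ _ _ sE1 sX (N1 p X sX)) (anti _ _ _ sE2 sX (N2 p X sX))).
Qed.

End ConeEndo.

(** * Brackets modulo an isotropic line *)

Section ContinuityOfSmooth.
Context {R : realType} {n : nat} {M : manifold R n}.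

(** Smooth functions on a manifold are continuous, because charts are. *)
Lemma smooth_fun_neq0_near (U : set M) (f : M -> R) (p : M) : open U -> U p ->
  smooth_fun U f -> f p != 0 -> \forall q \near p, f q != 0.
Proof.
move=> oU Up sf fp; set c := chart_at p.
have dp : chart_dom c p := mem_at p.
have [cf _] := sf c (atlas_at p) [::] _ (chart_img_mem dp Up).
have cc := continuous_chart_map dp.
have nf : \forall u \near chart_map c p, (f \o chart_inv c) u != 0.
  have nz : nbhs ((f \o chart_inv c : _ -> R^o) (chart_map c p)) [set r : R^o | r != 0].
    apply: open_nbhs_nbhs; split; first exact: open_neq.
    by rewrite /= chart_mapK.
  exact: (cf _ nz).
have := @filterI _ _ (nbhs_filter p) _ _ (near_dom dp) (cc _ nf).
by apply: filterS => q [dq]; rewrite /= chart_mapK.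
Qed.

End ContinuityOfSmooth.

Lemma mod_e1_alg (R : pzRingType) (V : lmodType R) (k1 k2 k3 : R) (ab A1 A2 B C1 C2 D c d e : V) :
  A1 = c + k1 *: e -> A2 = 0 -> B = - d - k2 *: e -> C1 = k3 *: e -> C2 = 0 -> D = 0 ->
  ab + (A1 + A2) + ((B + (C1 + C2)) + D) = ab + c - d + (k1 - k2 + k3) *: e.
Proof.
move=> -> -> -> -> -> ->; rewrite !addr0 !scalerDl scaleNr.
by rewrite (AC ((1*2)*(2*1)) ((1*2*4)*(3*5*6))).
Qed.

Lemma scale_sub_alg (R : pzRingType) (V : lmodType R) (al k c : R) (X e g : V) (D : V) :
  D = - X -> c = 0 -> al *: D - k *: e + c *: g = - (al *: X) - k *: e.
Proof. by move=> -> ->; rewrite scale0r addr0 scalerN. Qed.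

Lemma scale_sub_alg2 (R : pzRingType) (V : lmodType R) (al k r c ga : R) (e g D D' : V) :
  D = ga *: D' + r *: e -> D' = 0 -> c = 0 -> al *: D - k *: e + c *: g = (al * r - k) *: e.
Proof. by move=> -> -> ->; rewrite scaler0 add0r scale0r addr0 scalerA scalerBl. Qed.

Section BracketsModLine.
Context {R : realType} {n : nat} {M : manifold R n}.
Implicit Types (p q : M) (x y : M -> gfiber R n) (f : M -> R).
Local Notation smooth := (smooth_section setT).
#[local] Opaque dfun gdiff dorfman.

Lemma gdiff_dfun0 p f : (forall v, dfun p f v = 0) -> gdiff f p = 0.
Proof. by move=> h; congr (_, _); rewrite d_funE; apply/rowP => j; rewrite !mxE h. Qed.

Section Expansion.
Variables (e1 e2 : M -> gfiber R n).
Hypotheses (s1 : smooth e1) (s2 : smooth e2).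
Hypothesis (e11 : forall q, ip (e1 q) (e1 q) = 0).
Implicit Types (a b : M -> gfiber R n).

(** Functions vanishing to first order at p: multiples by such functions do not
    contribute to brackets at p. *)
Definition flat_zero p f := f p = 0 /\ forall v, dfun p f v = 0.

Lemma dor_flat_r p x f : smooth x -> smooth_fun setT f -> flat_zero p f ->
  dorfman x (fun q => f q *: e2 q) p = 0.
Proof. by move=> sx sf [f0 df]; rewrite (dorZr p sf sx s2) f0 df !scale0r addr0. Qed.

Lemma dor_flat_l p x f : smooth x -> smooth_fun setT f -> flat_zero p f ->
  dorfman (fun q => f q *: e2 q) x p = 0.
Proof.
move=> sx sf [f0 df]; rewrite (dorZl p sf s2 sx) f0 df !scale0r subrr add0r.
by rewrite (gdiff_dfun0 df) scaler0.
Qed.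

Lemma dorfman_expand p a a1 a2 b b1 b2 : smooth a -> smooth a1 -> smooth a2 ->
  smooth b -> smooth b1 -> smooth b2 ->
  dorfman (fun q => a q + (a1 q + a2 q)) (fun q => b q + (b1 q + b2 q)) p =
  dorfman a b p + (dorfman a b1 p + dorfman a b2 p) +
  ((dorfman a1 b p + (dorfman a1 b1 p + dorfman a1 b2 p)) +
    dorfman a2 (fun q => b q + (b1 q + b2 q)) p).
Proof.
move=> sa sa1 sa2 sb sb1 sb2.
have sa12 := smooth_sectionD openT sa1 sa2; have sb12 := smooth_sectionD openT sb1 sb2.
have sw := smooth_sectionD openT sb sb12.
apply: etrans (dorDl p sa sa12 sw) _; congr (_ + _).
  apply: etrans (dorDr p sa sb sb12) _; congr (_ + _); exact: (dorDr p sa sb1 sb2).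
apply: etrans (dorDl p sa1 sa2 sw) _; congr (_ + _).
apply: etrans (dorDr p sa1 sb sb12) _; congr (_ + _); exact: (dorDr p sa1 sb1 sb2).
Qed.

(** For sections of the orthogonal of e1, up to terms flat at p, the bracket is
    computed by the Leibniz rule; every term with a differential of a coefficient
    is a multiple of e1, since the inner products of the sections with e1 vanish. *)
Lemma dorfman_mod_e1 p a b (al be ga de : M -> R) :
  smooth a -> smooth b -> (forall q, ip (a q) (e1 q) = 0) -> (forall q, ip (b q) (e1 q) = 0) ->
  smooth_fun setT al -> smooth_fun setT be -> smooth_fun setT ga -> smooth_fun setT de ->
  flat_zero p be -> flat_zero p de ->
  exists k, dorfman (fun q => a q + (al q *: e1 q + be q *: e2 q))
      (fun q => b q + (ga q *: e1 q + de q *: e2 q)) p =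
    dorfman a b p + ga p *: dorfman a e1 p - al p *: dorfman b e1 p + k *: e1 p.
Proof.
move=> sa sb ae be1 sal sbe sga sde zbe zde.
have t1 := smooth_sectionZ openT sal s1; have t2 := smooth_sectionZ openT sbe s2.
have u1 := smooth_sectionZ openT sga s1; have u2 := smooth_sectionZ openT sde s2.
have t := smooth_sectionD openT t1 t2; have u := smooth_sectionD openT u1 u2.
have w := smooth_sectionD openT sb u.
exists (dfun p ga (a p).1 - dfun p al (b p).1 +
  (al p * dfun p ga (e1 p).1 - dfun p al (ga p *: e1 p).1)).
have c1 : 2 * ip (e1 p) (b p) = 0 by rewrite ipC be1 mulr0.
have c2 : 2 * ip (e1 p) (ga p *: e1 p) = 0 by rewrite ipZr e11 !mulr0.
have E1 := dorZr p sga sa s1.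
have E2 := dor_flat_r sa sde zde.
have E3 := etrans (dorZl p sal s1 sb) (scale_sub_alg _ _ _ _ (dor_anti p sb s1 be1) c1).
have E4 := etrans (dorZl p sal s1 u1)
  (scale_sub_alg2 _ _ _ (dorZr p sga s1 s1) (dor_self p s1 e11) c2).
have E5 := dor_flat_r t1 sde zde.
have E6 := dor_flat_l w sbe zbe.
exact: (etrans (dorfman_expand p sa t1 t2 sb u1 u2) (mod_e1_alg _ E1 E2 E3 E4 E5 E6)).
Qed.
End Expansion.

End BracketsModLine.

(** * Maximal isotropic subbundles of E *)

Section IsotropicLine.
Context {R : realType} {n : nat} {M : manifold R n}.
Implicit Types (p q : M) (x y : M -> gfiber R n) (f : M -> R).
Local Notation smooth := (smooth_section setT).
Variables (E : M -> {vspace gfiber R n}) (e1 e2 : M -> gfiber R n).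
Hypothesis E_span : forall p, E p = <<[:: e1 p; e2 p]>>%VS.
Hypotheses (s1 : smooth e1) (s2 : smooth e2).
Hypotheses (e11 : forall p, ip (e1 p) (e1 p) = 0)
  (e22 : forall p, ip (e2 p) (e2 p) = 0) (e12 : forall p, ip (e1 p) (e2 p) = 2^-1).

Let two0 : (2 : R) != 0. Proof. by rewrite pnatr_eq0. Qed.

Lemma frame_neq0 p : e1 p != 0.
Proof.
by apply/eqP => z; have /esym/eqP := e12 p; rewrite z ip0l invr_eq0 (negPf two0).
Qed.

Lemma frame_sub p : (<[e1 p]> <= E p)%VS.
Proof. by rewrite E_span span_cons addvSl. Qed.

Lemma ip_frame p a b : ip (a *: e1 p + b *: e2 p) (e1 p) = b * 2^-1 /\
  ip (a *: e1 p + b *: e2 p) (e2 p) = a * 2^-1.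
Proof.
by rewrite !ipDl !ipZl e11 e22 e12 (ipC (e2 p)) e12 !mulr0 addr0 add0r.
Qed.

(** On E the quadratic form is u1 u2, so its zeros are the two lines of the frame. *)
Lemma isotropic_coef p u : u \in E p -> ip u u = 0 -> ip u (e2 p) != 0 ->
  exists2 a, a != 0 & u = a *: e1 p.
Proof.
move=> /(mem_E_ex (E_span p)) [a [b ->]] uu.
have [h1 h2] := ip_frame p a b; rewrite h2 mulf_eq0 invr_eq0 (negPf two0) orbF => a0.
exists a => //; move: uu; rewrite ipDr !ipZr h1 h2 => /eqP.
rewrite !mulrA -mulrDl mulf_eq0 invr_eq0 (negPf two0) orbF (mulrC b) -mulr2n -mulr_natl.
rewrite !mulf_eq0 (negPf two0) (negPf a0) /= => /eqP ->.
by rewrite scale0r addr0.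
Qed.

Lemma line_maximal p : maximal_isotropic (E p) <[e1 p]>%VS.
Proof.
split; [exact: frame_sub|exact: isotropic_vline (e11 p)|].
move=> W eW WE iW; apply/eqP; rewrite eq_sym eqEsubv eW /=; apply/subvP => u uW.
have uE := subvP WE u uW.
have e1W : e1 p \in W by apply: (subvP eW); exact: memv_line.
have [a [b uab]] := mem_E_ex (E_span p) uE; move: (iW u (e1 p) uW e1W).
have [h1 _] := ip_frame p a b; rewrite uab h1 => /eqP.
rewrite mulf_eq0 invr_eq0 (negPf two0) orbF => /eqP ->.
by rewrite scale0r addr0 memvZ // memv_line.
Qed.

Lemma line_subbundle : subbundle (fun p => <[e1 p]>%VS).
Proof.
move=> p; exists setT, 1%N, (fun=> e1); split; [by split; [exact: openT|]|by []|].
move=> q _; have -> : [tuple e1 q | i < 1] = [:: e1 q] :> seq _.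
  by rewrite /= enum_ordSl /= (_ : enum 'I_0 = [::]) //; apply/nilP; rewrite /nilp -cardE card_ord.
rewrite /basis_of span_seq1 eqxx /=.
by rewrite seq1_free frame_neq0.
Qed.

(** A section of l that is not orthogonal to e2 at p is not orthogonal to it near p,
    where it must then be a multiple of e1. *)
Lemma near_line (l : M -> {vspace gfiber R n}) (U : set M) (s : M -> gfiber R n) p :
  (forall q, maximal_isotropic (E q) (l q)) ->
  open U -> U p -> smooth_section U s -> (forall q, U q -> s q \in l q) ->
  ip (s p) (e2 p) != 0 ->
  e1 p \in l p /\ \forall q \near p, forall u, u \in l q -> ip u (e1 q) = 0.
Proof.
move=> ml oU Up ss sl sp.
have key q : U q -> ip (s q) (e2 q) != 0 -> e1 q \in l q.
  move=> Uq sq; have [lE il _] := ml q; have sq' := sl q Uq.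
  have [a a0 E'] := isotropic_coef (subvP lE _ sq') (il _ _ sq' sq') sq.
  by rewrite -[e1 q](scalerK a0) memvZ // -E'.
split; first exact: key.
have sf : smooth_fun U (fun q => ip (s q) (e2 q)).
  exact: (smooth_fun_ip oU ss (smooth_sectionW (@subsetT _ U) s2)).
have := @filterI _ _ (nbhs_filter p) _ _ (open_nbhs_nbhs (conj oU Up))
  (smooth_fun_neq0_near oU Up sf sp).
apply: filterS => q [Uq sq] u ul; have [_ il _] := ml q; exact: (il _ _ ul (key q Uq sq)).
Qed.

End IsotropicLine.

Section LineType.
Context {R : realType} {n : nat} {M : manifold R n}.
Implicit Types (p q : M).
Local Notation smooth := (smooth_section setT).
Variables (E : M -> {vspace gfiber R n}) (e1 e2 : M -> gfiber R n).
Hypothesis E_span : forall p, E p = <<[:: e1 p; e2 p]>>%VS.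
Hypotheses (s1 : smooth e1) (s2 : smooth e2).
Hypotheses (e11 : forall p, ip (e1 p) (e1 p) = 0)
  (e22 : forall p, ip (e2 p) (e2 p) = 0) (e12 : forall p, ip (e1 p) (e2 p) = 2^-1).

Lemma span_swap p : E p = <<[:: e2 p; e1 p]>>%VS.
Proof. by rewrite E_span; apply: eq_span => u; rewrite !inE orbC. Qed.

(** By maximality l is nowhere zero, so a local section does not vanish at p. *)
Lemma maximal_isotropic_line (l : M -> {vspace gfiber R n}) p :
  subbundle l -> (forall q, maximal_isotropic (E q) (l q)) ->
  (e1 p \in l p /\ \forall q \near p, forall u, u \in l q -> ip u (e1 q) = 0) \/
  (e2 p \in l p /\ \forall q \near p, forall u, u \in l q -> ip u (e2 q) = 0).
Proof.
move=> sl ml; have [U [r [s [[oU Up] ss bs]]]] := sl p.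
have e21 q : ip (e2 q) (e1 q) = 2^-1 by rewrite ipC.
have smem i q : U q -> s i q \in l q.
  move=> Uq; rewrite -(span_basis (bs q Uq)); apply: memv_span.
  by apply/mapP; exists i => //; rewrite mem_enum.
have [i si] : exists i, s i p != 0.
  apply: contrapT => none; have lp : l p = 0%VS.
    apply/eqP; rewrite -subv0 -(span_basis (bs p Up)); apply/span_subvP => u /mapP[i _ ->].
    by rewrite memv0; apply/negP => /negP h; apply: none; exists i.
  have [_ _ m] := ml p; have := m <[e1 p]>%VS.
  rewrite lp sub0v => /(_ isT (frame_sub E_span p) (isotropic_vline (e11 p))) z.
  by have := memv_line (e1 p); rewrite z memv0 (negPf (frame_neq0 e12 p)).
have [h2|h2] := eqVneq (ip (s i p) (e2 p)) 0; last first.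
  left; exact: (near_line E_span s2 e11 e22 e12 ml oU Up (ss i) (fun q Uq => smem i q Uq) h2).
right; apply: (near_line span_swap s1 e22 e11 e21 ml oU Up (ss i) (fun q Uq => smem i q Uq)).
have [lE _ _] := ml p.
have [a [b E']] := mem_E_ex (E_span p) (subvP lE _ (smem i p Up)).
apply: contra si => /eqP; rewrite E' in h2 *; move: h2.
have [-> ->] := ip_frame e11 e22 e12 p a b => /eqP h2 /eqP h1.
have two0 : (2 : R) != 0 by rewrite pnatr_eq0.
move: h1 h2; rewrite !mulf_eq0 invr_eq0 (negPf two0) !orbF => /eqP -> /eqP ->.
by rewrite !scale0r addr0.
Qed.

End LineType.

Section Eigenbundle.
Context {R : realType} {n : nat}.
Variables (Phi : 'End(gfiber R n)) (L : {vspace gfiber R[i] n}).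
Hypothesis Leig : forall u, u \in L <-> cextend Phi u = 'i%C *: u.

(** The eigenvector equation in real terms: elements of L are x - i Phi x. *)
Lemma mem_eigen u : u \in L <-> Phi (gRe u) = - gIm u /\ Phi (gIm u) = gRe u.
Proof.
rewrite Leig /cextend -{3}(gcplxK u) gcplxZi; split=> [h|[-> ->]//].
by split; [have := congr1 gRe h|have := congr1 gIm h]; rewrite !(gRe_gcplx, gIm_gcplx).
Qed.

Lemma mem_eigen_line u (e : gfiber R n) : u \in (L + cplxv <[e]>)%VS ->
  exists a b k k', [/\ gRe u = a + k *: e, gIm u = b + k' *: e, Phi a = - b & Phi b = a].
Proof.
case/memv_addP => v /mem_eigen[h1 h2] [w /mem_cplxv[/vlineP[k ke] /vlineP[k' ke']] ->].
by exists (gRe v), (gIm v), k, k'; rewrite gReD gImD ke ke'.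
Qed.

End Eigenbundle.

(** * The bracket as an eigenvector *)

Section BracketAlgebra.
Variables (R : comPzRingType) (V : lmodType R).

(** The real part, modulo e1, of the bracket of two sections of L + <e1>.  Here P, Q
    come from brackets in L, and X, Y stand for [x, e1], [y, e1], X', Y' for
    their images by Phi. *)
Definition bracket_re (P X Y X' Y' : V) (a1 a2 g1 g2 : R) :=
  P + g1 *: X - a1 *: Y + (g2 *: X' - a2 *: Y').
(** The corresponding imaginary part. *)
Definition bracket_im (Q X Y X' Y' : V) (a1 a2 g1 g2 : R) :=
  - Q + g2 *: X - a2 *: Y + (a1 *: Y' - g1 *: X').

Lemma bracket_reE (P1 P2 X Y X' Y' e : V) (a1 a2 g1 g2 k k' : R) :
  P1 + g1 *: X - a1 *: Y + k *: e - (P2 + g2 *: (- X') - a2 *: (- Y') + k' *: e) =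
  bracket_re (P1 - P2) X Y X' Y' a1 a2 g1 g2 + (k - k') *: e.
Proof.
rewrite /bracket_re !scalerN scalerBl !opprD !opprK.
by rewrite (AC (4*4) ((1*5)*2*3*(6*7)*(4*8))).
Qed.

Lemma bracket_imE (Q1 Q2 X Y X' Y' e : V) (a1 a2 g1 g2 k k' : R) :
  - Q1 + g2 *: X - a1 *: (- Y') + k *: e + (- Q2 + g1 *: (- X') - a2 *: Y + k' *: e) =
  bracket_im (Q1 + Q2) X Y X' Y' a1 a2 g1 g2 + (k + k') *: e.
Proof.
rewrite /bracket_im !scalerN scalerDl !opprD !opprK.
by rewrite (AC (4*4) ((1*5)*2*7*(3*6)*(4*8))).
Qed.

End BracketAlgebra.

Section BracketEigen.
Variables (R : fieldType) (V : vectType R) (Phi : 'End(V)).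
Variables (P Q X X' Y Y' : V) (a1 a2 g1 g2 : R).
Hypotheses (PP : Phi P = Q) (PQ : Phi Q = - P) (PX : Phi X = X') (PX' : Phi X' = - X)
  (PY : Phi Y = Y') (PY' : Phi Y' = - Y).

Lemma bracket_eigen : Phi (bracket_re P X Y X' Y' a1 a2 g1 g2) = - bracket_im Q X Y X' Y' a1 a2 g1 g2 /\
  Phi (bracket_im Q X Y X' Y' a1 a2 g1 g2) = bracket_re P X Y X' Y' a1 a2 g1 g2.
Proof.
have PD u v : Phi (u + v) = Phi u + Phi v by rewrite linearD.
have PN u : Phi (- u) = - Phi u by rewrite linearN.
have PZ k v : Phi (k *: v) = k *: Phi v by rewrite linearZ.
split; rewrite /bracket_re /bracket_im !PD !PN !PZ ?PN ?PP ?PQ ?PX ?PX' ?PY ?PY'.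
  rewrite !opprD !opprK !scalerN !opprK.
  by rewrite (AC (3*2) (1*4*5*(3*2))) .
rewrite !scalerN !opprK.
by rewrite (AC (3*2) (1*5*4*(2*3))).
Qed.
End BracketEigen.

(** * Involutivity from the bracket identities *)

Section Involutivity.
Context {R : realType} {n : nat} {M : manifold R n}.
Implicit Types (p q : M) (x y : M -> gfiber R n) (f : M -> R).
Local Notation smooth := (smooth_section setT).
#[local] Opaque dfun gdiff dorfman.
Variables (Phi : M -> 'End(gfiber R n)) (L : M -> {vspace gfiber R[i] n}).
Hypothesis Leig : forall p u, u \in L p <-> cextend (Phi p) u = 'i%C *: u.

Section OneLine.
Variables (e1 e2 : M -> gfiber R n) (l : M -> {vspace gfiber R n}).
Hypothesis CT : contact_triple Phi e1 e2.
Hypothesis C : integrable_triple Phi e1 e2.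
Hypothesis lE : forall p u, u \in l p -> exists a b, u = a *: e1 p + b *: e2 p.

Let s1 : smooth e1 := ct_smooth1 CT.
Let s2 : smooth e2 := ct_smooth2 CT.

Lemma perp_add_line p (a v : gfiber R n) : ip a (e1 p) = 0 -> ip a (e2 p) = 0 -> v \in l p ->
  perp (e1 p) (e2 p) (a + v) = a.
Proof.
move=> h1 h2 /lE[k [k' ->]].
exact: (perp_combination (ct_ip11 CT p) (ct_ip22 CT p) (ct_ip12 CT p) k k' h1 h2).
Qed.

(** The part orthogonal to E of a section of L + l is a section of L, and the rest is a
    combination of the frame with real and imaginary parts in l. *)
Lemma section_line z : csections (fun p => L p + cplxv (l p))%VS z ->
  forall q, perp (e1 q) (e2 q) (gIm (z q)) = - Phi q (perp (e1 q) (e2 q) (gRe (z q))) /\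
  exists u v, [/\ u \in l q, v \in l q, ip (gRe (z q)) (e1 q) = ip u (e1 q) &
    ip (gIm (z q)) (e1 q) = ip v (e1 q)].
Proof.
move=> [_ zL] q; have /memv_addP[u /(mem_eigen (Leig q))[h1 h2] [v /mem_cplxv[v1 v2] ->]] := zL q.
have [z1 z2] := ct_orth CT q (gIm u); rewrite h2 in z1 z2.
have [z3 z4] : ip (gIm u) (e1 q) = 0 /\ ip (gIm u) (e2 q) = 0.
  have := ct_orth CT q (gRe u); rewrite h1 !ipNl => -[/eqP + /eqP].
  by rewrite !oppr_eq0 => /eqP -> /eqP ->.
rewrite gReD gImD !perp_add_line // h1 opprK; split=> //.
by exists (gRe v), (gIm v); rewrite !ipDl z1 z3 !add0r.
Qed.

Lemma near_flat_zero p x : (\forall q \near p, ip (x q) (e1 q) = 0) ->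
  flat_zero p (fun q => 2 * ip (x q) (e1 q)).
Proof.
move=> h; split; first by rewrite (nbhs_singleton h) mulr0.
have h0 : \forall q \near p, (fun q => 2 * ip (x q) (e1 q)) q = (fun _ : M => (0 : R)) q.
  by apply: filterS h => q ->; rewrite mulr0.
by move=> v; rewrite (near_dfun v h0) dfun_cst.
Qed.

(** A section of L + l is orthogonal to e1 near a point where l is spanned by e1, so
    [dorfman_mod_e1] applies to its real and imaginary parts. *)
Lemma dorfman_mod_line p x y a b : smooth x -> smooth y -> smooth a -> smooth b ->
  (forall q, perp (e1 q) (e2 q) (x q) = a q) -> (forall q, perp (e1 q) (e2 q) (y q) = b q) ->
  (\forall q \near p, ip (x q) (e1 q) = 0) -> (\forall q \near p, ip (y q) (e1 q) = 0) ->
  exists k, dorfman x y p = dorfman a b p + (2 * ip (y p) (e2 p)) *: dorfman a e1 p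
    - (2 * ip (x p) (e2 p)) *: dorfman b e1 p + k *: e1 p.
Proof.
move=> sx sy sa sb xa yb nx ny.
have sc := @smooth_fun_cst _ _ M setT 2.
have co x' e : smooth x' -> smooth e -> smooth_fun setT (fun q => 2 * ip (x' q) (e q)).
  by move=> s s'; exact: (smooth_funM openT sc (smooth_fun_ip openT s s')).
have orth (x' a' : M -> gfiber R n) : (forall q, perp (e1 q) (e2 q) (x' q) = a' q) ->
    forall q, ip (a' q) (e1 q) = 0.
  move=> h q; rewrite -h.
  by case: (perpP (ct_ip11 CT q) (ct_ip22 CT q) (ct_ip12 CT q) (x' q)).
have [k kE] := dorfman_mod_e1 s1 s2 (ct_ip11 CT) sa sb (orth _ _ xa) (orth _ _ yb)
  (co x e2 sx s2) (co x e1 sx s1) (co y e2 sy s2) (co y e1 sy s1)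
  (near_flat_zero nx) (near_flat_zero ny).
have frame (x' a' : M -> gfiber R n) : smooth x' -> (forall q, perp (e1 q) (e2 q) (x' q) = a' q) ->
    x' = (fun q => a' q + ((2 * ip (x' q) (e2 q)) *: e1 q + (2 * ip (x' q) (e1 q)) *: e2 q)).
  by move=> s h; rewrite [LHS](frame_decomposition e1 e2 x'); apply/funext => q; rewrite h.
by exists k; exact: (etrans (congr2 (fun u v => dorfman u v p) (frame _ _ sx xa) (frame _ _ sy yb)) kE).
Qed.

Lemma triple_e1_twice p u : perp_section e1 e2 u ->
  Phi p (dorfman (endo_app Phi u) e1 p) = - dorfman u e1 p.
Proof.
move=> pu; have pPu := perp_section_Phi CT pu.1.
rewrite (triple_e1 C pPu p).
have -> : endo_app Phi (endo_app Phi u) = (fun q => - u q).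
  by apply/funext => q; rewrite /endo_app (ct_square_perp CT) //; case: (pu.2 q).
exact: (dorNl p pu.1 s1).
Qed.

(** The four real brackets entering the complex bracket are given by
    [dorfman_mod_line]; their combination is an eigenvector of Phi by
    [bracket_eigen], up to a multiple of e1. *)
Lemma involutive_line p z w : csections (fun p => L p + cplxv (l p))%VS z ->
  csections (fun p => L p + cplxv (l p))%VS w ->
  e1 p \in l p -> (\forall q \near p, forall u, u \in l q -> ip u (e1 q) = 0) ->
  cdorfman z w p \in (L p + cplxv (l p))%VS.
Proof.
move=> cz cw e1l nl; have Hz := section_line cz; have Hw := section_line cw.
have [[sz1 sz2] _] := cz; have [[sw1 sw2] _] := cw.
set x := fun q => perp (e1 q) (e2 q) (gRe (z q)).
set y := fun q => perp (e1 q) (e2 q) (gRe (w q)).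
have px : perp_section e1 e2 x := perp_section_perp CT sz1.
have py : perp_section e1 e2 y := perp_section_perp CT sw1.
have pPx := perp_section_Phi CT px.1; have pPy := perp_section_Phi CT py.1.
have near0 (v : M -> gfiber R[i] n) : csections (fun p => L p + cplxv (l p))%VS v ->
   (\forall q \near p, ip (gRe (v q)) (e1 q) = 0) /\ (\forall q \near p, ip (gIm (v q)) (e1 q) = 0).
  move=> cv; split; apply: filterS nl => q lq; 
    have [_ [a [b [al bl h1 h2]]]] := section_line cv q; [rewrite h1|rewrite h2]; exact: lq.
have [nz1 nz2] := near0 z cz; have [nw1 nw2] := near0 w cw.
have sPx : smooth (fun q => - endo_app Phi x q) := smooth_sectionN openT pPx.1.
have sPy : smooth (fun q => - endo_app Phi y q) := smooth_sectionN openT pPy.1.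
have hx q : perp (e1 q) (e2 q) (gIm (z q)) = - endo_app Phi x q := (Hz q).1.
have hy q : perp (e1 q) (e2 q) (gIm (w q)) = - endo_app Phi y q := (Hw q).1.
have [k11 E11] := dorfman_mod_line sz1 sw1 px.1 py.1 (fun=> erefl) (fun=> erefl) nz1 nw1.
have [k22 E22] := dorfman_mod_line sz2 sw2 sPx sPy hx hy nz2 nw2.
have [k12 E12] := dorfman_mod_line sz1 sw2 px.1 sPy (fun=> erefl) hy nz1 nw2.
have [k21 E21] := dorfman_mod_line sz2 sw1 sPx py.1 hx (fun=> erefl) nz2 nw1.
have N1 : dorfman (fun q => - endo_app Phi x q) (fun q => - endo_app Phi y q) p =
    dorfman (endo_app Phi x) (endo_app Phi y) p.
  apply: etrans (dorNl p pPx.1 sPy) _; rewrite (dorNr p pPx.1 pPy.1); exact: opprK.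
rewrite N1 (dorNl p pPx.1 s1) (dorNl p pPy.1 s1) in E22.
rewrite (dorNr p px.1 pPy.1) (dorNl p pPy.1 s1) in E12.
rewrite (dorNl p pPx.1 py.1) (dorNl p pPx.1 s1) in E21.
have PPX := @triple_e1_twice p.
have [PP PQ] := triple_perp C px py p.
have [eA eB] := bracket_eigen (2 * ip (gRe (z p)) (e2 p)) (2 * ip (gIm (z p)) (e2 p))
  (2 * ip (gRe (w p)) (e2 p)) (2 * ip (gIm (w p)) (e2 p))
  PP PQ (triple_e1 C px p) (PPX x px) (triple_e1 C py p) (PPX y py).
have rE : gRe (cdorfman z w p) = _ :=
  etrans (gRe_gcplx _ _) (etrans (congr2 (fun a b => a - b) E11 E22) (bracket_reE _ _ _ _ _ _ _ _ _ _ _ _ _)).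
have iE : gIm (cdorfman z w p) = _ :=
  etrans (gIm_gcplx _ _) (etrans (congr2 (fun a b => a + b) E12 E21) (bracket_imE _ _ _ _ _ _ _ _ _ _ _ _ _)).
rewrite -[cdorfman z w p]gcplxK rE iE -gcplxD; apply: memv_add.
  by apply/(mem_eigen (Leig p)); rewrite gRe_gcplx gIm_gcplx; split; [exact: eA|exact: eB].
by apply/mem_cplxv; rewrite gRe_gcplx gIm_gcplx; split; exact: memvZ.
Qed.

End OneLine.
End Involutivity.

(** * Strong integrability and the bracket identities *)

Section StronglyIntegrable.
Context {R : realType} {n : nat} {M : manifold R n}.
Implicit Types (p q : M) (x y : M -> gfiber R n).
Local Notation smooth := (smooth_section setT).
#[local] Opaque dorfman.
Variables (E : M -> {vspace gfiber R n}) (L : M -> {vspace gfiber R[i] n}).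

Lemma cdorfman_smooth z w : csmooth_section setT z -> csmooth_section setT w ->
  csmooth_section setT (cdorfman z w : M -> gfiber R[i] n).
Proof.
move=> [z1 z2] [w1 w2]; split.
  have h := smooth_sectionB openT (dorfman_smooth z1 w1) (dorfman_smooth z2 w2).
  by apply: (smooth_section_ext openT) h => q _; rewrite /= gRe_gcplx.
have h := smooth_sectionD openT (dorfman_smooth z1 w2) (dorfman_smooth z2 w1).
by apply: (smooth_section_ext openT) h => q _; rewrite /= gIm_gcplx.
Qed.

Section FromTriple.
Variables (Phi : M -> 'End(gfiber R n)) (e1 e2 : M -> gfiber R n).
Hypothesis TR : triple_represents Phi e1 e2 E L.

(** Near each point l is spanned by one of the members of the frame. *)
Lemma integrable_triple_strong : integrable_triple Phi e1 e2 -> strongly_integrable E L.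
Proof.
move=> C l sl ml; have [CT Es Leig] := TR.
have lE p u : u \in l p -> exists a b, u = a *: e1 p + b *: e2 p.
  by have [lE _ _] := ml p; move=> /(subvP lE) /(mem_E_ex (Es p)).
have lE' p u : u \in l p -> exists a b, u = a *: e2 p + b *: e1 p.
  by move=> /lE[a [b ->]]; exists b, a; rewrite addrC.
have CT' := contact_triple_sym CT; have C' := integrable_triple_sym CT C.
move=> z w cz cw; split; first exact: (cdorfman_smooth cz.1 cw.1).
move=> p; have := maximal_isotropic_line Es (ct_smooth1 CT) (ct_smooth2 CT)
  (ct_ip11 CT) (ct_ip22 CT) (ct_ip12 CT) p sl ml.
case=> [] [h1 h2].
  exact: (involutive_line Leig CT C lE cz cw h1 h2).
exact: (involutive_line Leig CT' C' lE' cz cw h1 h2).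
Qed.

End FromTriple.

Section ToTriple.
Variables (Phi : M -> 'End(gfiber R n)) (e1 e2 : M -> gfiber R n).
Hypothesis CT : contact_triple Phi e1 e2.
Hypothesis Es : forall p, E p = <<[:: e1 p; e2 p]>>%VS.
Hypothesis Leig : forall p u, u \in L p <-> cextend (Phi p) u = 'i%C *: u.
Hypothesis SI : strongly_integrable E L.
Hypothesis bracket0 : forall p, dorfman e1 e2 p = 0.
Let s1 : smooth e1 := ct_smooth1 CT.
Let s2 : smooth e2 := ct_smooth2 CT.
Let two0 : (2 : R) != 0. Proof. by rewrite pnatr_eq0. Qed.

(** For x orthogonal to E, a section of L. *)
Definition eigen_section x : M -> gfiber R[i] n := fun q => gcplx (x q) (- Phi q (x q)).

Lemma Re_eigen_section x : gRe \o eigen_section x = x.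
Proof. by apply/funext => q; rewrite /= gRe_gcplx. Qed.
Lemma Im_eigen_section x : gIm \o eigen_section x = (fun q => - endo_app Phi x q).
Proof. by apply/funext => q; rewrite /= gIm_gcplx. Qed.

Lemma eigen_csection x : perp_section e1 e2 x ->
  csections (fun p => L p + cplxv <[e1 p]>)%VS (eigen_section x).
Proof.
move=> px; split.
  split; first by rewrite Re_eigen_section; exact: px.1.
  by rewrite Im_eigen_section; exact: (smooth_sectionN openT (perp_section_Phi CT px.1).1).
move=> p; apply: (subvP (addvSl _ _)); apply/(mem_eigen (Leig p)).
rewrite gRe_gcplx gIm_gcplx opprK; split=> //.
have N : Phi p (- Phi p (x p)) = - Phi p (Phi p (x p)) by rewrite linearN.
by rewrite N (ct_square_perp CT) ?opprK //; case: (px.2 p).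
Qed.

Lemma line_csection : csections (fun p => L p + cplxv <[e1 p]>)%VS (fun p => gcplx (e1 p) 0).
Proof.
split; first split.
- by apply: (smooth_section_ext openT) s1 => q _; rewrite /= gRe_gcplx.
- apply: (smooth_section_ext openT) (@smooth_section0 _ _ M setT openT) => q _.
  by rewrite /= gIm_gcplx.
- move=> p; apply: (subvP (addvSr _ _)); apply/mem_cplxv.
  by rewrite gRe_gcplx gIm_gcplx memv_line mem0v.
Qed.

Lemma line_involutive : Defs.involutive (fun p => L p + cplxv <[e1 p]>)%VS.
Proof.
apply: SI; first exact: (line_subbundle s1 (ct_ip12 CT)).
by move=> p; exact: (line_maximal Es (ct_ip11 CT) (ct_ip22 CT) (ct_ip12 CT)).
Qed.

Lemma eigen_orth p a b : Phi p a = - b -> Phi p b = a ->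
  [/\ ip a (e1 p) = 0, ip a (e2 p) = 0, ip b (e1 p) = 0 & ip b (e2 p) = 0].
Proof.
move=> h1 h2; have [z1 z2] := ct_orth CT p b; rewrite h2 in z1 z2.
have := ct_orth CT p a; rewrite h1 !ipNl => -[/eqP + /eqP].
by rewrite !oppr_eq0 => /eqP -> /eqP ->.
Qed.

(** L + <e1> is orthogonal to e1. *)
Lemma eigen_line_ip p (u : gfiber R[i] n) : u \in (L p + cplxv <[e1 p]>)%VS ->
  ip (gRe u) (e1 p) = 0 /\ ip (gIm u) (e1 p) = 0.
Proof.
case/(mem_eigen_line (Leig p)) => a [b [k [k' [-> -> h1 h2]]]].
have [a1 _ b1 _] := eigen_orth h1 h2.
by rewrite !ipDl !ipZl (ct_ip11 CT) a1 b1 !mulr0 addr0.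
Qed.

(** The elements of L + <e1> that are orthogonal to e2 lie in L. *)
Lemma eigen_line_Phi p (u : gfiber R[i] n) : u \in (L p + cplxv <[e1 p]>)%VS ->
  ip (gRe u) (e2 p) = 0 -> ip (gIm u) (e2 p) = 0 ->
  Phi p (gRe u) = - gIm u /\ Phi p (gIm u) = gRe u.
Proof.
case/(mem_eigen_line (Leig p)) => a [b [k [k' [-> -> h1 h2]]]].
have [_ a2 _ b2] := eigen_orth h1 h2.
have half0 : (2^-1 : R) != 0 by rewrite invr_eq0.
rewrite !ipDl !ipZl (ct_ip12 CT) a2 b2 !add0r.
move=> /eqP; rewrite mulf_eq0 (negPf half0) orbF => /eqP ->.
move=> /eqP; rewrite mulf_eq0 (negPf half0) orbF => /eqP ->.
by rewrite !scale0r !addr0.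
Qed.

Lemma cdorfman_eigen p x y : perp_section e1 e2 x -> perp_section e1 e2 y ->
  gRe (cdorfman (eigen_section x) (eigen_section y) p) =
    dorfman x y p - dorfman (endo_app Phi x) (endo_app Phi y) p /\
  gIm (cdorfman (eigen_section x) (eigen_section y) p) =
    - (dorfman x (endo_app Phi y) p + dorfman (endo_app Phi x) y p).
Proof.
move=> px py; have sPx := (perp_section_Phi CT px.1).1.
have sPy := (perp_section_Phi CT py.1).1.
rewrite /cdorfman gRe_gcplx gIm_gcplx !Re_eigen_section !Im_eigen_section.
have E1 := dorNl p sPx (smooth_sectionN openT sPy).
have E2 := dorNr p sPx sPy.
have E3 := dorNr p px.1 sPy; have E4 := dorNl p sPx py.1.
split.
  by apply: (congr1 (fun u => dorfman x y p - u)); apply: etrans E1 _; rewrite E2; exact: opprK.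
by apply: etrans (congr2 (fun u v => u + v) E3 E4) _; rewrite opprD.
Qed.

Lemma cdorfman_line p x : perp_section e1 e2 x ->
  gRe (cdorfman (eigen_section x) (fun q => gcplx (e1 q) 0) p) = dorfman x e1 p /\
  gIm (cdorfman (eigen_section x) (fun q => gcplx (e1 q) 0) p) = - dorfman (endo_app Phi x) e1 p.
Proof.
move=> px; have sPx := (perp_section_Phi CT px.1).1.
have e1E : gRe \o (fun q => gcplx (e1 q) 0) = e1.
  by apply/funext => q; rewrite /= gRe_gcplx.
have e0E : gIm \o (fun q => gcplx (e1 q) 0) = (fun=> 0).
  by apply/funext => q; rewrite /= gIm_gcplx.
rewrite /cdorfman gRe_gcplx gIm_gcplx Re_eigen_section Im_eigen_section e1E e0E.
rewrite (dor0r p px.1) (dor0r p (smooth_sectionN openT sPx)) subr0 add0r.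
by split=> //; exact: (dorNl p sPx s1).
Qed.

(** The bracket of x - i Phi x with e1 lies in L + <e1> by involutivity, and it is
    orthogonal to e2 because [e1, e2] = 0 and the inner product is invariant. *)
Lemma bracket_line p x : perp_section e1 e2 x -> Phi p (dorfman x e1 p) = dorfman (endo_app Phi x) e1 p.
Proof.
move=> px; have pPx := perp_section_Phi CT px.1.
have := (line_involutive (eigen_csection px) line_csection).2 p.
have orth2 y : perp_section e1 e2 y -> ip (dorfman y e1 p) (e2 p) = 0.
  move=> py.
  have h : ip (dorfman e1 y p) (e2 p) = 0.
    by rewrite (ip_const_inv p s1 py.1 s2 (fun q => (py.2 q).2)) bracket0 ip0r oppr0.
  rewrite (dor_anti (c := 0) p s1 py.1) ?ipNl ?h ?oppr0 // => q.
  by rewrite ipC; case: (py.2 q).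
have [R1 I1] := cdorfman_line p px.
move=> /eigen_line_Phi; rewrite R1 I1 => /(_ (orth2 x px)).
by rewrite ipNl (orth2 _ pPx) oppr0 => /(_ erefl) [-> _]; rewrite opprK.
Qed.

End ToTriple.

(** The bracket of two sections of L lies both in L + <e1> and in L + <e2>, hence in
    L. *)
Lemma strong_integrable_triple (Phi : M -> 'End(gfiber R n)) (e1 e2 : M -> gfiber R n) :
  triple_represents Phi e1 e2 E L -> strongly_integrable E L ->
  (forall p, dorfman e1 e2 p = 0) -> integrable_triple Phi e1 e2.
Proof.
case=> CT Es Leig SI b0; have CT' := contact_triple_sym CT; have Es' := span_swap Es.
have b0' p : dorfman e2 e1 p = 0.
  by rewrite (dor_anti p (ct_smooth1 CT) (ct_smooth2 CT) (ct_ip12 CT)) b0 oppr0.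
have swap x : perp_section e1 e2 x -> perp_section e2 e1 x.
  by case=> sx h; split=> // q; case: (h q).
split=> //; first last.
- by move=> x px p; exact: (bracket_line CT' Es' Leig SI b0' p (swap x px)).
- by move=> x px p; exact: (bracket_line CT Es Leig SI b0 p px).
move=> x y px py p; have [rE iE] := cdorfman_eigen CT p px py.
have m1 := (line_involutive CT Es SI (eigen_csection CT Leig px) (eigen_csection CT Leig py)).2 p.
have m2 := (line_involutive CT' Es' SI (eigen_csection CT' Leig (swap x px))
  (eigen_csection CT' Leig (swap y py))).2 p.
have [r2 i2] := eigen_line_ip CT' Leig m2.
have := eigen_line_Phi CT Leig m1 r2 i2; rewrite rE iE opprK => -[-> h]; split=> //.
by move: h; rewrite (linearN (Phi p)) => /(congr1 -%R); rewrite opprK.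
Qed.
End StronglyIntegrable.

(** * Rescaling isotropic frames *)

Section ExpLn.
Context {R : realType} {n : nat} {M : manifold R n}.
Implicit Types (p q : M) (f g : M -> R).

Lemma dfun_exp p f v : smooth_fun setT f ->
  dfun p (fun q => expR (f q)) v = expR (f p) * dfun p f v.
Proof.
move=> /(smooth_fun_differentiable p); set F := (f \o _ : _ -> R^o); set u := chart_map _ _ => dF.
have FE : F u = f p by rewrite /F /= chart_mapK //; exact: mem_at.
have dE : differentiable (expR : R^o -> R^o) (F u).
  by apply/derivable1_diffP; exact: derivable_expR.
rewrite {1}/dfun -[X in 'D_v X _]/((expR : R^o -> R^o) \o F) -/u.
rewrite (deriveE _ (differentiable_comp dF dE)) (diff_comp dF dE) /=.
rewrite (diff1E dE) /= derive1E derive_val FE /dfun -/F -/u (deriveE _ dF) mulrC.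
exact: erefl.
Qed.

(** Differentiate exp (ln f) = f. *)
Lemma dfun_ln p f v : smooth_fun setT f -> (forall q, 0 < f q) ->
  dfun p (fun q => ln (f q)) v = (f p)^-1 * dfun p f v.
Proof.
move=> sf f0; have sl := smooth_fun_ln openT (fun q _ => f0 q) sf.
have := dfun_exp p v sl; rewrite lnK ?posrE //.
have -> : (fun q => expR (ln (f q))) = f by apply/funext => q; rewrite lnK // posrE.
by move=> ->; rewrite mulKf // gt_eqF.
Qed.

Lemma dfunN p f v : smooth_fun setT f -> dfun p (fun q => - f q) v = - dfun p f v.
Proof.
move=> sf; have -> : (fun q => - f q) = (fun q => -1 * f q) by apply/funext => q; rewrite mulN1r.
by rewrite (dfunM p v (@smooth_fun_cst _ _ M setT (-1)) sf) dfun_cst mulr0 addr0 mulN1r.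
Qed.

Lemma dfunV0 p f : smooth_fun setT f -> (forall q, f q != 0) -> (forall v, dfun p f v = 0) ->
  forall v, dfun p (fun q => (f q)^-1) v = 0.
Proof.
move=> sf f0 df v; have := dfunM p v sf (smooth_funV openT (fun q _ => f0 q) sf).
have -> : (fun q => f q * (f q)^-1) = (fun=> 1) by apply/funext => q; rewrite mulfV.
rewrite dfun_cst df mulr0 addr0 => /esym/eqP.
by rewrite mulf_eq0 (negPf (f0 p)) => /eqP.
Qed.

Lemma d_fun_eq0 p f : smooth_fun setT f -> d_fun f p = 0 -> forall v, dfun p f v = 0.
Proof.
move=> sf h v; rewrite -(pairing_d_fun p v sf) h /pairing big1 // => j _.
by rewrite mxE mul0r.
Qed.

Lemma gdiff_dfun p f g (k : R) : (forall v, dfun p f v = k * dfun p g v) ->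
  gdiff f p = k *: gdiff g p.
Proof.
move=> h; transitivity ((k *: 0, k *: d_fun g p) : gfiber R n); last by [].
by rewrite scaler0; congr (_, _); rewrite !d_funE; apply/rowP => j; rewrite !mxE h.
Qed.

End ExpLn.

Section PerpAlgebra.
Context {R : realType} {n : nat}.

Lemma perpZ (e1 e2 x : gfiber R n) (k : R) : perp e1 e2 (k *: x) = k *: perp e1 e2 x.
Proof.
have p0 : perp e1 e2 0 = 0 by rewrite /perp !ip0l mulr0 !scale0r !subr0.
by have := perp_linear e1 e2 k x 0; rewrite p0 !addr0.
Qed.

Lemma perpC (e1 e2 x : gfiber R n) : perp e2 e1 x = perp e1 e2 x.
Proof. by rewrite /perp addrAC. Qed.

End PerpAlgebra.

Section FrameChange.
Context {R : realType} {n : nat} {M : manifold R n}.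
Implicit Types (p q : M) (x y : M -> gfiber R n) (a b c d f : M -> R).
Local Notation smooth := (smooth_section setT).
#[local] Opaque dfun gdiff dorfman.
Let two0 : (2 : R) != 0. Proof. by rewrite pnatr_eq0. Qed.

Section Normalized.
Variables (e1 e2 : M -> gfiber R n).
Hypotheses (s1 : smooth e1) (s2 : smooth e2).
Hypotheses (e11 : forall p, ip (e1 p) (e1 p) = 0)
  (e22 : forall p, ip (e2 p) (e2 p) = 0) (e12 : forall p, ip (e1 p) (e2 p) = 2^-1).

Lemma dorfman_frame_change p a b c d :
  smooth_fun setT a -> smooth_fun setT b -> smooth_fun setT c -> smooth_fun setT d ->
  flat_zero p b -> flat_zero p c -> (forall v, dfun p (fun q => a q * d q) v = 0) ->
  dorfman (fun q => a q *: e1 q + b q *: e2 q) (fun q => c q *: e1 q + d q *: e2 q) p =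
  (a p * d p) *: dorfman e1 e2 p + d p *: perp (e1 p) (e2 p) (gdiff a p).
Proof.
move=> sa sb sc sd zb zc ad.
have ta := smooth_sectionZ openT sa s1; have tb := smooth_sectionZ openT sb s2.
have tc := smooth_sectionZ openT sc s1; have td := smooth_sectionZ openT sd s2.
have tcd := smooth_sectionD openT tc td.
apply: etrans (dorDl p ta tb tcd) _; rewrite (dor_flat_l s2 tcd sb zb) addr0.
apply: etrans (dorDr p ta tc td) _; rewrite (dor_flat_r s1 ta sc zc) add0r.
exact: (rescale s1 s2 e12 sa sd ad).
Qed.

(** For e1' = a e1 + b e2 and e2' = c e1 + d e2 isotropic, one of the pairs (a, d) and
    (b, c) vanishes near each point.  This single formula is c0 log |a| in one case and
    c0 log |b| in the other, c0 being the locally constant a d + b c. *)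
Definition log_ratio a b c d q := (a q * d q + b q * c q) * (2^-1 * ln ((a q + b q) * (a q + b q))).

Lemma log_ratioC a b c d : log_ratio b a d c = log_ratio a b c d.
Proof. by apply/funext => q; rewrite /log_ratio (addrC (b q)) (addrC (b q * c q)). Qed.

Section Coefficients.
Variables a b c d : M -> R.
Hypotheses (sa : smooth_fun setT a) (sb : smooth_fun setT b)
  (sc : smooth_fun setT c) (sd : smooth_fun setT d).
Hypotheses (ab : forall q, a q * b q = 0) (cd : forall q, c q * d q = 0)
  (abcd : forall q, a q * d q + b q * c q != 0)
  (d0 : forall p v, dfun p (fun q => a q * d q + b q * c q) v = 0).

Let det := fun q => a q * d q + b q * c q.
Let w := fun q => (a q + b q) * (a q + b q).

Lemma sqr_sum_gt0 q : 0 < w q.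
Proof.
rewrite /w -expr2 exprn_even_gt0 //=; apply: contra (abcd q) => /eqP h.
have /eqP := ab q; rewrite mulf_eq0 => /orP[] /eqP z; move: h; rewrite z ?add0r ?addr0 => ->;
  by rewrite !mul0r addr0.
Qed.

Lemma smooth_det : smooth_fun setT det.
Proof. exact: (smooth_funD openT (smooth_funM openT sa sd) (smooth_funM openT sb sc)). Qed.

Lemma smooth_sqr_sum : smooth_fun setT w.
Proof.
have sab := smooth_funD openT sa sb; exact: (smooth_funM openT sab sab).
Qed.

Lemma smooth_log_ratio : smooth_fun setT (log_ratio a b c d).
Proof.
exact: (smooth_funM openT smooth_det (smooth_funM openT (@smooth_fun_cst _ _ M setT 2^-1)
  (smooth_fun_ln openT (fun q _ => sqr_sum_gt0 q) smooth_sqr_sum))).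
Qed.

Lemma near_diagonal p : a p != 0 -> \forall q \near p, b q = 0 /\ c q = 0.
Proof.
move=> ap; have := smooth_fun_neq0_near openT I sa ap; apply: filterS => q aq.
have bq : b q = 0 by have /eqP := ab q; rewrite mulf_eq0 (negPf aq) => /eqP.
split=> //; have := abcd q; rewrite bq mul0r addr0 mulf_eq0 negb_or => /andP[_ dq].
by have /eqP := cd q; rewrite mulf_eq0 (negPf dq) orbF => /eqP.
Qed.

Lemma near_flat p f : (\forall q \near p, f q = 0) -> flat_zero p f.
Proof.
move=> h; split; first exact: (nbhs_singleton h).
by move=> v; rewrite (near_dfun v (g := fun=> 0) h) dfun_cst.
Qed.

Lemma dfun_log_ratio p v : a p != 0 -> dfun p (log_ratio a b c d) v = d p * dfun p a v.
Proof.
move=> ap; have nd := near_diagonal ap.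
have [bp cp] := nbhs_singleton nd.
have sl := smooth_fun_ln openT (fun q _ => sqr_sum_gt0 q) smooth_sqr_sum.
have sh := @smooth_fun_cst _ _ M setT 2^-1.
apply: etrans (dfunM p v smooth_det (smooth_funM openT sh sl)) _.
rewrite (dfunM p v sh sl) dfun_cst (d0 p v) !mulr0 !addr0.
rewrite (dfun_ln p v smooth_sqr_sum sqr_sum_gt0).
have -> : dfun p w v = 2 * a p * dfun p a v.
  rewrite (@near_dfun _ _ _ p w (fun q => a q * a q)).
    by rewrite (dfunM p v sa sa) -mulrA mulr_natl mulr2n.
  by apply: filterS nd => q [bq _]; rewrite /w bq addr0.
by rewrite /det /w bp mul0r !addr0; field; rewrite ap.
Qed.

(** Where a does not vanish, b and c vanish nearby, and the differential of
    [log_ratio] is a d (da / a) = d da, the term produced by [rescale]. *)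
Lemma dorfman_log_ratio p : (forall p, dorfman e1 e2 p = 0) -> a p != 0 ->
  dorfman (fun q => a q *: e1 q + b q *: e2 q) (fun q => c q *: e1 q + d q *: e2 q) p =
  perp (e1 p) (e2 p) (gdiff (log_ratio a b c d) p).
Proof.
move=> e0 ap; have nd := near_diagonal ap.
have zb : flat_zero p b by apply: near_flat; apply: filterS nd => q [].
have zc : flat_zero p c by apply: near_flat; apply: filterS nd => q [].
have ad v : dfun p (fun q => a q * d q) v = 0.
  rewrite -(d0 p v); apply: near_dfun; apply: filterS nd => q [-> _].
  by rewrite mul0r addr0.
apply: etrans (dorfman_frame_change sa sb sc sd zb zc ad) _.
rewrite e0 scaler0 add0r (gdiff_dfun (fun v => dfun_log_ratio v ap)).
by rewrite perpZ.
Qed.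

End Coefficients.
End Normalized.
End FrameChange.

(** * The equivalences *)

Section SpanScale.
Variables (K : fieldType) (V : vectType K).

Lemma vline_scale (k : K) (v : V) : k != 0 -> <[k *: v]>%VS = <[v]>%VS.
Proof.
move=> k0; apply/vspaceP => u; apply/vlineP/vlineP => -[m ->].
  by exists (m * k); rewrite scalerA.
by exists (m * k^-1); rewrite scalerA mulfVK.
Qed.

Lemma span_scale2 (h k : K) (u v : V) : h != 0 -> k != 0 ->
  << [:: h *: u; k *: v] >>%VS = << [:: u; v] >>%VS.
Proof. by move=> h0 k0; rewrite !span_cons span_nil !vline_scale. Qed.

End SpanScale.

Section Assembly.
Context {R : realType} {n : nat} {M : manifold R n}.
Implicit Types (p q : M) (f : M -> R).
Local Notation smooth := (smooth_section setT).
#[local] Opaque dfun gdiff dorfman.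
Variables (E : M -> {vspace gfiber R n}) (L : M -> {vspace gfiber R[i] n}).
Let two0 : (2 : R) != 0. Proof. by rewrite pnatr_eq0. Qed.

Lemma frame_span (e1 e2 : M -> gfiber R n) : isotropic_frame E e1 e2 ->
  forall p, E p = <<[:: e1 p; e2 p]>>%VS.
Proof. by case=> _ _ b _ _ p; rewrite (span_basis (b p)). Qed.

Lemma normal_integrable_triple : is_normal E L ->
  exists Phi e1 e2, triple_represents Phi e1 e2 E L /\ integrable_triple Phi e1 e2.
Proof.
case=> J [SJ IJ TR]; exists (Phi_of J), (e1_of J), (e2_of J); split=> //.
by case: TR => CT _ _; exact: integrable_triple_of_J.
Qed.

Lemma integrable_triple_normal (Phi : M -> 'End(gfiber R n)) (e1 e2 : M -> gfiber R n) :
  triple_represents Phi e1 e2 E L -> integrable_triple Phi e1 e2 -> is_normal E L.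
Proof.
move=> TR C; have [CT _ _] := TR; exists (cone_endo Phi e1 e2).
rewrite e1_of_cone e2_of_cone Phi_of_cone; split; [exact: (Sek0_cone CT)|exact: integrable_cone|exact: TR].
Qed.

(** A generalized almost contact structure and a normalized isotropic frame of E
    determine a triple. *)
Lemma contact_endo_represents (e1 e2 : M -> gfiber R n) : gen_almost_contact E L ->
  smooth e1 -> smooth e2 -> (forall p, E p = <<[:: e1 p; e2 p]>>%VS) ->
  (forall p, ip (e1 p) (e1 p) = 0) -> (forall p, ip (e2 p) (e2 p) = 0) ->
  (forall p, ip (e1 p) (e2 p) = 2^-1) ->
  triple_represents (fun p => contact_endo (L p) (e1 p) (e2 p)) e1 e2 E L.
Proof.
move=> [_ subL Lmax Lconj] s1 s2 Es e11 e22 e12.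
have PE p u : contact_endo (L p) (e1 p) (e2 p) u = contact_fun (L p) (e1 p) (e2 p) u.
  by rewrite lfunE.
split; [|exact: Es|]; last first.
  move=> p u; rewrite /cextend !PE.
  exact: (contact_fun_eigen (Es p) (e11 p) (e22 p) (e12 p) (Lmax p) (Lconj p)).
split; [|exact: s1|exact: s2|exact: e11|exact: e22|exact: e12| | | |].
- exact: (contact_endo_smooth Es e11 e22 e12 Lmax Lconj subL).
- move=> p u v; rewrite !PE.
  exact: (contact_fun_skew (Es p) (e11 p) (e22 p) (e12 p) (Lmax p) (Lconj p)).
- move=> p; rewrite PE.
  exact: (contact_fun_e1 (Es p) (e11 p) (e22 p) (e12 p) (Lmax p) (Lconj p)).
- move=> p; rewrite PE.
  exact: (contact_fun_e2 (Es p) (e11 p) (e22 p) (e12 p) (Lmax p) (Lconj p)).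
- move=> p u; rewrite !PE.
  rewrite (contact_fun_square (Es p) (e11 p) (e22 p) (e12 p) (Lmax p) (Lconj p)).
  by rewrite /perp !opprD !opprK addrAC.
Qed.

Hypothesis gacEL : gen_almost_contact E L.

(** Otherwise e1 would be orthogonal to E, on which the inner product is
    nondegenerate. *)
Lemma isotropic_frame_ip (e1 e2 : M -> gfiber R n) p : isotropic_frame E e1 e2 ->
  ip (e1 p) (e2 p) != 0.
Proof.
move=> F; have Es := frame_span F; have [_ _ b e11 _] := F.
have [g1 [g2 [G g12]]] := gac_trivial gacEL.
have Gs := frame_span G; have [_ _ _ g11 g22] := G.
apply/negP => /eqP e12.
have orth u : u \in E p -> ip (e1 p) u = 0.
  by move=> /(mem_E_ex (Es p)) [x [y ->]]; rewrite ipDr !ipZr e11 e12 !mulr0 addr0.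
have Ee1 : e1 p \in E p by rewrite Es memv_span // mem_head.
have g1E : g1 p \in E p by rewrite Gs memv_span // mem_head.
have g2E : g2 p \in E p by rewrite Gs memv_span // !inE eqxx orbT.
have [x [y e1E]] := mem_E_ex (Gs p) Ee1.
have half0 : (2^-1 : R) != 0 by rewrite invr_eq0.
have := orth _ g1E; have := orth _ g2E; rewrite e1E.
have [-> ->] := ip_frame g11 g22 g12 p x y.
move=> /eqP; rewrite mulf_eq0 (negPf half0) orbF => /eqP x0.
move=> /eqP; rewrite mulf_eq0 (negPf half0) orbF => /eqP y0.
have := free_not0 (basis_free (b p)) (mem_head _ _).
by rewrite e1E x0 y0 !scale0r addr0 eqxx.
Qed.

Section Frame.
Variables (e1 e2 : M -> gfiber R n).
Hypothesis F : isotropic_frame E e1 e2.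
Hypothesis dF : forall p, d_fun (fun q => ip (e1 q) (e2 q)) p = 0.

(** The locally constant factor by which the frame fails to be normalized. *)
Definition frame_det q := 2 * ip (e1 q) (e2 q).

Lemma frame_det_neq0 q : frame_det q != 0.
Proof. by rewrite mulf_neq0 // isotropic_frame_ip. Qed.

Lemma smooth_frame_det : smooth_fun setT frame_det.
Proof.
have [s1 s2 _ _ _] := F.
exact: (smooth_funM openT (@smooth_fun_cst _ _ M setT 2) (smooth_fun_ip openT s1 s2)).
Qed.

Lemma frame_det_flat p v : dfun p frame_det v = 0.
Proof.
have [s1 s2 _ _ _] := F; have s12 := smooth_fun_ip openT s1 s2.
rewrite (dfunM p v (@smooth_fun_cst _ _ M setT 2) s12) dfun_cst.
by rewrite (d_fun_eq0 s12 (dF p)) !mulr0 addr0.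
Qed.

(** With c = 2 <e1, e2> locally constant, replace e1 by exp(-f/c) e1 and e2 by
    exp(f/c) e2 / c: by [rescale] the bracket pr(df)/c is cancelled. *)
Lemma normalize_frame f : smooth_fun setT f ->
  (forall p, dorfman e1 e2 p = pr_perp E p (gdiff f p)) ->
  exists e1' e2' : M -> gfiber R n, [/\ smooth e1' /\ smooth e2',
    forall p, E p = <<[:: e1' p; e2' p]>>%VS,
    (forall p, ip (e1' p) (e1' p) = 0) /\ (forall p, ip (e2' p) (e2' p) = 0),
    forall p, ip (e1' p) (e2' p) = 2^-1 &
    forall p, dorfman e1' e2' p = 0].
Proof.
move=> sf br; have [s1 s2 _ e11 e22] := F; have Es := frame_span F.
have c0 := frame_det_neq0; have sc := smooth_frame_det.
have ci0 q : (frame_det q)^-1 != 0 by rewrite invr_eq0.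
have sci := smooth_funV openT (fun q _ => c0 q) sc.
have sg := smooth_funM openT sci sf; set g := fun q => _ in sg.
have sh := smooth_fun_exp openT (smooth_funN openT sg).
have sk := smooth_fun_exp openT sg.
set h := fun q => _ in sh; set k := fun q => _ in sk.
have sn := smooth_sectionZ openT sci s2; set e2n := fun q => _ in sn.
have e2n2 q : ip (e2n q) (e2n q) = 0 by rewrite /e2n ipZl ipZr e22 !mulr0.
have e1n q : ip (e1 q) (e2n q) = 2^-1.
  rewrite /e2n ipZr; apply: (mulfI (c0 q)); rewrite mulrA mulfV // mul1r.
  by rewrite /frame_det mulrAC mulfV // mul1r.
have En p : E p = <<[:: e1 p; e2n p]>>%VS.
  by rewrite Es -{2}[e1 p]scale1r span_scale2 ?oner_eq0.
(* the constant product of the two factors, as required by rescale *)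
have hk q : h q * k q = 1 by rewrite /h /k -expRD addNr expR0.
have brn p : dorfman e1 e2n p = perp (e1 p) (e2n p) (gdiff g p).
  have dci v := dfunV0 sc c0 (frame_det_flat p) v.
  have gE : gdiff g p = (frame_det p)^-1 *: gdiff f p.
    apply: gdiff_dfun => v; rewrite (dfunM p v sci sf) dci mulr0 addr0.
    exact: erefl.
  apply: etrans (dorZr p sci s1 s2) _; rewrite dci scale0r addr0 br gE perpZ.
  by rewrite (pr_perpE (En p) (e11 p) (e2n2 p) (e1n p)).
exists (fun q => h q *: e1 q), (fun q => k q *: e2n q); split.
- by split; [exact: (smooth_sectionZ openT sh s1)|exact: (smooth_sectionZ openT sk sn)].
- by move=> p; rewrite span_scale2 // /h /k gt_eqF // expR_gt0.
- by split=> p; rewrite ipZl ipZr ?e11 ?e2n2 !mulr0.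
- by move=> p; rewrite ipZl ipZr e1n mulrA hk mul1r.
move=> p; have dhk v : dfun p (fun q => h q * k q) v = 0.
  by rewrite (_ : (fun q => _) = fun=> 1) ?dfun_cst //; apply/funext => q; exact: hk.
have hE : gdiff h p = (- h p) *: gdiff g p.
  apply: gdiff_dfun => v; apply: etrans (dfun_exp p v (smooth_funN openT sg)) _.
  by rewrite (dfunN p v sg) mulrN mulNr.
apply: etrans (rescale s1 sn e1n sh sk dhk) _.
by rewrite hk scale1r brn hE perpZ scalerA mulrN mulrC hk scaleN1r subrr.
Qed.

End Frame.

(** Write the frame in terms of a normalized frame with vanishing bracket, coming
    from normality.  At each point one of the coefficients of e1 is nonzero, and
    [dorfman_log_ratio] applies to the frame or to the frame with its members
    exchanged; the function is the same in both cases. *)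
Lemma normal_bracket_exact (e1 e2 : M -> gfiber R n) : is_normal E L ->
  isotropic_frame E e1 e2 -> (forall p, d_fun (fun q => ip (e1 q) (e2 q)) p = 0) ->
  exists f, smooth_fun setT f /\ forall p, dorfman e1 e2 p = pr_perp E p (gdiff f p).
Proof.
move=> /normal_integrable_triple[Phi [g1 [g2 [TR C]]]] F dF.
have [CT Gs _] := TR; have [s1 s2 _ e11 e22] := F; have Es := frame_span F.
have [t1 t2 g11 g22 g12] : [/\ smooth g1, smooth g2, (forall p, ip (g1 p) (g1 p) = 0),
    (forall p, ip (g2 p) (g2 p) = 0) & (forall p, ip (g1 p) (g2 p) = 2^-1)].
  by case: CT.
have g21 p : ip (g2 p) (g1 p) = 2^-1 by rewrite ipC.
have coef (x y : M -> gfiber R n) : smooth x -> smooth y ->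
    smooth_fun setT (fun q => 2 * ip (x q) (y q)).
  move=> sx sy; exact: (smooth_funM openT (@smooth_fun_cst _ _ M setT 2) (smooth_fun_ip openT sx sy)).
pose a q := 2 * ip (e1 q) (g2 q); pose b q := 2 * ip (e1 q) (g1 q).
pose c q := 2 * ip (e2 q) (g2 q); pose d q := 2 * ip (e2 q) (g1 q).
have expand (x : M -> gfiber R n) : (forall q, x q \in E q) -> forall q,
    x q = (2 * ip (x q) (g2 q)) *: g1 q + (2 * ip (x q) (g1 q)) *: g2 q.
  move=> xE q; have [k [m kE]] := mem_E_ex (Gs q) (xE q).
  have [h1 h2] := ip_frame g11 g22 g12 q k m.
  by rewrite {2 3}kE h1 h2 !(mulrC 2) !mulfVK.
have E1 : forall q, e1 q = a q *: g1 q + b q *: g2 q.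
  by apply: expand => q; rewrite Es memv_span // mem_head.
have E2 : forall q, e2 q = c q *: g1 q + d q *: g2 q.
  by apply: expand => q; rewrite Es memv_span // !inE eqxx orbT.
have ipE (k m k' m' : R) q : 2 * ip (k *: g1 q + m *: g2 q) (k' *: g1 q + m' *: g2 q) =
    k * m' + m * k'.
  rewrite ipDr !ipZr; have [-> ->] := ip_frame g11 g22 g12 q k m.
  by field.
have ab q : a q * b q = 0.
  have := ipE (a q) (b q) (a q) (b q) q; rewrite -E1 e11 mulr0 (mulrC (b q)) -mulr2n.
  by move=> /esym/eqP; rewrite mulrn_eq0 /= => /eqP.
have cd q : c q * d q = 0.
  have := ipE (c q) (d q) (c q) (d q) q; rewrite -E2 e22 mulr0 (mulrC (d q)) -mulr2n.
  by move=> /esym/eqP; rewrite mulrn_eq0 /= => /eqP.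
have detE q : a q * d q + b q * c q = frame_det e1 e2 q.
  by rewrite -(ipE (a q) (b q) (c q) (d q) q) -E1 -E2.
have abcd q : a q * d q + b q * c q != 0 by rewrite detE; exact: frame_det_neq0.
have d0 p v : dfun p (fun q => a q * d q + b q * c q) v = 0.
  rewrite -(frame_det_flat F dF p v); apply: near_dfun; apply: nearW => q; exact: detE.
have sa := coef _ _ s1 t2; have sb := coef _ _ s1 t1.
have sc := coef _ _ s2 t2; have sd := coef _ _ s2 t1.
exists (log_ratio a b c d); split; first exact: (smooth_log_ratio sa sb sc sd ab abcd).
move=> p; rewrite (pr_perpE (Gs p) (g11 p) (g22 p) (g12 p)).
have br p : dorfman g1 g2 p = 0 := triple_frame C p.
have [ap|ap] := eqVneq (a p) 0; last first.
  have eE : dorfman e1 e2 p = dorfman (fun q => a q *: g1 q + b q *: g2 q)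
      (fun q => c q *: g1 q + d q *: g2 q) p.
    by apply: (congr2 (fun x y => dorfman x y p)); apply/funext.
  apply: etrans eE _; exact: (dorfman_log_ratio t1 t2 g12 sa sb sc sd ab cd abcd d0 br ap).
have bp : b p != 0.
  by apply: contra (abcd p) => /eqP ->; rewrite ap !mul0r addr0.
have eE : dorfman e1 e2 p = dorfman (fun q => b q *: g2 q + a q *: g1 q)
    (fun q => d q *: g2 q + c q *: g1 q) p.
  apply: (congr2 (fun x y => dorfman x y p)); apply/funext => q.
    by rewrite addrC; exact: E1.
  by rewrite addrC; exact: E2.
apply: etrans eE _; rewrite -log_ratioC -perpC.
have ba q : b q * a q = 0 by rewrite mulrC.
have dc q : d q * c q = 0 by rewrite mulrC.
have badc q : b q * c q + a q * d q != 0 by rewrite addrC.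
have d0' p' v : dfun p' (fun q => b q * c q + a q * d q) v = 0.
  by rewrite -(d0 p' v); apply: near_dfun; apply: nearW => q; exact: addrC.
have br' p' : dorfman g2 g1 p' = 0 by rewrite (dor_anti p' t1 t2 g12) br oppr0.
exact: (dorfman_log_ratio t2 t1 g21 sb sa sd sc ba dc badc d0' br' bp).
Qed.

Lemma normal_strongly_integrable : is_normal E L -> strongly_integrable E L.
Proof. by move=> /normal_integrable_triple[Phi [g1 [g2 [TR C]]]]; exact: integrable_triple_strong TR C. Qed.

Lemma strongly_integrable_normal (e1 e2 : M -> gfiber R n) f : strongly_integrable E L ->
  isotropic_frame E e1 e2 -> smooth_fun setT f ->
  (forall p, d_fun (fun q => ip (e1 q) (e2 q)) p = 0) ->
  (forall p, dorfman e1 e2 p = pr_perp E p (gdiff f p)) -> is_normal E L.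
Proof.
move=> SI F sf dF br.
have [g1 [g2 [[s1 s2] Gs [g11 g22] g12 br0]]] := normalize_frame F dF sf br.
have TR := contact_endo_represents gacEL s1 s2 Gs g11 g22 g12.
exact: (integrable_triple_normal TR (strong_integrable_triple TR SI br0)).
Qed.

End Assembly.

Theorem theorem24 (R : realType) (n : nat) (odd_n : odd n) (M : manifold R n)
    (E : M -> {vspace gfiber R n}) (L : M -> {vspace gfiber R[i] n})
    (gacEL : gen_almost_contact E L) :
  (is_normal E L <->
   (strongly_integrable E L /\
    exists e1 e2 : M -> gfiber R n, exists f : M -> R,
      [/\ isotropic_frame E e1 e2, smooth_fun setT f,
          forall p : M, d_fun (fun q => ip (e1 q) (e2 q)) p = 0 &
          forall p : M, dorfman e1 e2 p = pr_perp E p (gdiff f p)]))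
  /\
  (is_normal E L <->
   (strongly_integrable E L /\
    forall e1 e2 : M -> gfiber R n,
      isotropic_frame E e1 e2 ->
      (forall p : M, d_fun (fun q => ip (e1 q) (e2 q)) p = 0) ->
      exists f : M -> R, smooth_fun setT f /\
        forall p : M, dorfman e1 e2 p = pr_perp E p (gdiff f p))).
Proof.
have [g1 [g2 [G g12]]] := gac_trivial gacEL.
have dG p : d_fun (fun q => ip (g1 q) (g2 q)) p = 0.
  rewrite (_ : (fun q => _) = fun=> 2^-1); last exact/funext.
  by rewrite d_funE; apply/rowP => j; rewrite !mxE dfun_cst.
split; split.
- move=> N; split; first exact: normal_strongly_integrable N.
  have [f [sf br]] := normal_bracket_exact gacEL N G dG.
  by exists g1, g2, f; split; [exact: G|exact: sf|exact: dG|exact: br].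
- case=> SI [e1 [e2 [f [F sf dF br]]]].
  exact: (strongly_integrable_normal gacEL SI F sf dF br).
- move=> N; split; first exact: normal_strongly_integrable N.
  move=> e1 e2; exact: (normal_bracket_exact gacEL N).
- case=> SI /(_ g1 g2 G dG) [f [sf br]].
  exact: (strongly_integrable_normal gacEL SI G sf dG br).
Qed.
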